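(* Let $s,L,Q,\sigma>0$, let $\mu$ be a probability density on $[0,1]$ such that $\mu\in\Sigma(\nu,\varrho)$ and $\mu(x)\ge q$ for all $x\in[0,1]$, for some $0<\nu\le 1$ and $\varrho,q>0$. Let $w$ be a non-negative nondecreasing function with $w(x)\le A(1+|x|^b)$ for some $A,b>0$. If $I_n\subset[0,1]$ is any (sequence of) interval(s), with length $|I_n|$, such that for some $\varepsilon\in(0,1)$ $$|I_n|\,n^{\varepsilon/(2s+1)}\to+\infty\quad\text{as } n\to+\infty, \qquad ( * )$$ then $$\liminf_{n}\ \inf_{\widehat f_n}\ \sup_{f\in\Sigma^Q(s,L)}\mathbb E^n_{f,\mu}\Big\{w\Big(\sup_{x\in I_n}r_{n,\mu}(x)^{-1}|\widehat f_n(x)-f(x)|\Big)\Big\}\ge w\big((1-\varepsilon)P\big),$$ where the infimum is taken over all estimators, $$r_{n,\mu}(x)=\Big(\frac{\log n}{n\mu(x)}\Big)^{s/(2s+1)},\qquad P=\sigma^{2s/(2s+1)}L^{1/(2s+1)}\,\varphi_s(0)\Big(\frac{2}{2s+1}\Big)^{s/(2s+1)} .$$ Consequently, if $I_n$ is such that $( * )$ holds for every $\varepsilon\in(0,1)$, then $$\liminf_{n}\ \inf_{\widehat f_n}\ \sup_{f\in\Sigma^Q(s,L)}\mathbb E^n_{f,\mu}\Big\{w\Big(\sup_{x\in I_n}r_{n,\mu}(x)^{-1}|\widehat f_n(x)-f(x)|\Big)\Big\}\ge w(P).$$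
   Context: Model. One observes $(X_i,Y_i)$, $1\le i\le n$, with $Y_i=f(X_i)+\xi_i$, where the $\xi_i$ are i.i.d. $N(0,\sigma^2)$ and independent of the $X_i$, and the $X_i$ are i.i.d. with density $\mu$ on $[0,1]$. $\mathbb E^n_{f,\mu}$ is expectation under the joint law $\mathbb P^n_{f,\mu}$ of the observations. An estimator is any measurable function of the observations with values in functions on $[0,1]$. Function classes. For $s,L>0$ let $k=\lfloor s\rfloor$ denote the largest integer strictly smaller than $s$. $\Sigma(s,L)$ is the set of $f:[0,1]\to\mathbb R$ with $|f^{(k)}(x)-f^{(k)}(y)|\le L|x-y|^{s-k}$ for all $x,y\in[0,1]$; $\Sigma^Q(s,L)$ is the set of $f\in\Sigma(s,L)$ with $\|f\|_\infty\le Q$; $\Sigma(s,L;\mathbb R)$ is the analogue of $\Sigma(s,L)$ for functions on $\mathbb R$. $\varphi_s=\operatorname{argmax}\{\varphi(0):\varphi\in\Sigma(s,1;\mathbb R),\ \|\varphi\|_2\le 1\}$, with $\|\cdot\|_2$ the $L^2(\mathbb R)$ norm (it is known that this maximizer exists and is unique, is even and compactly supported, and $\|\varphi_s\|_2=1$).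
   Formalization: In the ''Consequently'' part, w is additionally assumed left-continuous at P; without this the claim fails, e.g. for s=1, μ=1, w the indicator of [P,∞) and I_n=[1/2,1/2+(log n)^{-10}], where a kernel estimator has risk tending to 0. *)

(* Defs.v *)
From HB Require Import structures.
From mathcomp Require Import all_boot all_order all_algebra.
From mathcomp Require Import all_classical all_reals all_analysis.

Set Implicit Arguments.
Unset Strict Implicit.
Unset Printing Implicit Defensive.

Import Order.TTheory GRing.Theory Num.Theory.
Import numFieldNormedType.Exports.

Local Open Scope classical_set_scope.
Local Open Scope ring_scope.

Section hoelder_classes.
Context {R : realType}.
Implicit Types (D : set R) (s L Q : R) (f g : R -> R).

(* One-sided derivatives at the endpoints when D is a closed interval.
   Functions on D are represented by functions on R whose values outside D
   are never used. *)
Definition derivative_within D f g : Prop :=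
  forall x, D x -> (f y - f x) / (y - x) @[y --> within D x^'] --> g x.

Fixpoint nth_derivative_within D (k : nat) f g : Prop :=
  if k is k'.+1 then
    exists2 f1, derivative_within D f f1 & nth_derivative_within D k' f1 g
  else {in D, f =1 g}.

(* The largest integer strictly smaller than s (so s - 1 when s is an integer). *)
Definition hoelder_order s : nat := `|Num.ceil s|%N.-1.

Lemma hoelder_orderP s : 0 < s ->
  (hoelder_order s)%:R < s <= (hoelder_order s).+1%:R.
Proof.
move=> s0; rewrite /hoelder_order.
have : 0 < Num.ceil s by rewrite ceil_gt0.
case: (Num.ceil s) (ceil_itv s) => // -[//|m] /= + _.
by have -> : m.+1%:Z - 1 = m%:Z by rewrite -addn1 PoszD addrK.
Qed.

Definition hoelder_class D s L : set (R -> R) := [set f |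
  exists2 g, nth_derivative_within D (hoelder_order s) f g &
    forall x y, D x -> D y ->
      `|g x - g y| <= L * `|x - y| `^ (s - (hoelder_order s)%:R)].

Definition bounded_hoelder_class D s L Q : set (R -> R) :=
  hoelder_class D s L `&` [set f | forall x, D x -> `|f x| <= Q].

Definition recovery_admissible s : set (R -> R) :=
  hoelder_class setT s 1 `&`
  [set phi | ('N[lebesgue_measure]_2%:E[EFin \o phi] <= 1)%E].

Definition recovery_argmax s : set (R -> R) :=
  recovery_admissible s `&`
  [set phi | forall psi, recovery_admissible s psi -> psi 0 <= phi 0].

End hoelder_classes.

Section iid_law.
Context d (T : measurableType d) (R : realType).

Definition tuple_cons n (z : T * n.-tuple T) : n.+1.-tuple T :=
  [the n.+1.-tuple T of z.1 :: z.2].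

Lemma measurable_tuple_cons n :
  measurable_fun [set: T * n.-tuple T] (@tuple_cons n).
Proof. exact: measurable_cons. Qed.

HB.instance Definition _ n := isMeasurableFun.Build _ _ _ _
  (@tuple_cons n) (@measurable_tuple_cons n).

Variable P : probability T R.

Fixpoint iid_law n : probability (n.-tuple T) R :=
  if n is n'.+1 then
    distribution (P \x iid_law n')%E (@tuple_cons n')
  else \d_([tuple] : 0.-tuple T).

End iid_law.

Section regression.
Context {R : realType}.
Implicit Types (f mu w : R -> R) (s sigma : R) (n : nat) (I : interval R).

(* PX is the law on R with density mu on [0, 1]; in particular the integral of
   mu over [0, 1] is PX setT = 1. *)
Definition has_density_on01 (PX : probability (measurableTypeR R) R) mu : Prop :=
  forall A, measurable A ->
    PX A = (\int[lebesgue_measure]_(x in A `&` `[0%R, 1%R]) (mu x)%:E)%E.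

Definition design_noise_law (PX : probability (measurableTypeR R) R) sigma n :
    probability (n.-tuple (measurableTypeR R * measurableTypeR R)) R :=
  iid_law (PX \x normal_prob 0 sigma)%E n.

(* Turns the pairs (X_i, xi_i) into the observations (X_i, f X_i + xi_i). *)
Definition observations f n (z : n.-tuple (R * R)) : n.-tuple (R * R) :=
  [tuple of map (fun p => (p.1, f p.1 + p.2)) z].

(* When G is not measurable, this is the lower integral: MathComp-Analysis
   defines the integral of a non-negative function as the supremum of the
   integrals of the non-negative simple functions below it. *)
Definition expectation_obs (PX : probability (measurableTypeR R) R) sigma f n
    (G : n.-tuple (R * R) -> \bar R) : \bar R :=
  (\int[design_noise_law PX sigma n]_z G (observations f z))%E.

Definition estimator n (fhat : n.-tuple (R * R) -> R -> R) : Prop :=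
  forall x, `[0, 1]%classic x ->
    measurable_fun [set: n.-tuple (measurableTypeR R * measurableTypeR R)]
      (fun z => fhat z x : measurableTypeR R).

Definition rate s mu n (x : R) : R :=
  (ln n%:R / (n%:R * mu x)) `^ (s / (2 * s + 1)).

Definition sup_error s mu I n (g f : R -> R) : \bar R :=
  ereal_sup [set ((rate s mu n x)^-1 * `|g x - f x|)%:E | x in [set` I]].

(* Extension of a nondecreasing loss to [0, +oo]; the supremum over an empty
   interval, -oo in \bar R, counts as 0. *)
Definition loss w (y : \bar R) : \bar R :=
  match y with
  | r%:E => (w r)%:E
  | +oo%E => ereal_sup (range (EFin \o w))
  | -oo%E => (w 0)%:E
  end.

Definition minimax_risk w s L Q sigma mu PX I n : \bar R :=
  ereal_inf [set
    ereal_sup [set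
      expectation_obs PX sigma f (fun z => loss w (sup_error s mu I n (fhat z) f))
      | f in bounded_hoelder_class `[0, 1] s L Q]
    | fhat in @estimator n].

Definition long_intervals s (I : nat -> interval R) (eps : R) : Prop :=
  fine (lebesgue_measure [set` I n]) * n%:R `^ (eps / (2 * s + 1))
    @[n --> \oo] --> +oo.

Definition sharp_constant (phi : R -> R) s L sigma : R :=
  sigma `^ (2 * s / (2 * s + 1)) * L `^ (1 / (2 * s + 1)) * phi 0
    * (2 / (2 * s + 1)) `^ (s / (2 * s + 1)).

End regression.

(* Main.v *)
Require Import Defs.
From mathcomp Require Import all_boot all_order all_algebra.
From mathcomp Require Import all_classical all_reals all_analysis.
From mathcomp Require Import measurable_realfun lra.
Import Order.TTheory GRing.Theory Num.Theory.
Import numFieldNormedType.Exports.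
Local Open Scope classical_set_scope.
Local Open Scope ring_scope.

(**
  The supremum risk is bounded below by the difficulty of decoding signs.  Fix
  a sample size n and a sub-interval of I_n, near its left end a, so short
  that the design density is almost constant on it.  Put there M functions
  f_j(x) = L h^s psi((x - x_j) / h) with disjoint supports, where psi is a
  compactly supported function with psi(0) close to phi(0), and
  h = (kappa log n / (n mu(a)))^(1/(2s+1)).  All the 2^M signed sums of the f_j
  belong to the class (bump_signal_hoelder, bump_signal_le), and kappa is such
  that f_j(x_j) = L h^s psi(0) is at least c r_n(x_j), with c = (1 - eps) P.
  If the normalised error of an estimator is less than c, then the estimator
  has the sign of the signal at every x_j.  Hence the risk is at least w(c)
  times the probability that decoding the signs fails (minimax_risk_ge), and
  it remains to see that for some choice of signs the decoding succeeds with a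
  probability that tends to 0.

  Averaged over the signs, the probability of success is at most the
  expectation, under pure noise, of the product over j of
  exp(|U_j| - V_j / 2) / 2, where U_j and V_j are the score and the energy of
  f_j (decoding_bound): this is the maximum of the likelihood ratio over the
  signs, divided by 2^M.  Given the design, the U_j are independent with law
  N(0, V_j), and the expectation is a product of Gaussian probabilities.  The
  function called envelope below gives an explicit bound of the same quality:
  it dominates exp|u| / 2 when v = 0, and averaging it over the noise of one
  observation with the weight exp(- energy / 2) only adds the energy to v
  (normal_prob_envelope).  By induction on the observations, the success
  probability is at most the expectation of the product of the
  envelope 0 V_j, which is at most the product of the
  exp(- c0 exp(- (1 + eta) V_j / 2)) (envelope0_le).

  The energies V_j depend on the random design.  By convexity of
  v |-> exp(- a v), the last exponent lies below its tangent at a common upper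
  bound t of the mean energies.  The tangent is affine in the sum of the V_j,
  hence is a sum over the observations, and its exponential moment factorises
  (mean_prod_envelope_le).  The success probability is at most
  exp(- c1 M exp(- (1 + eta) t / 2)) with c1 = c0 / 2.

  By the choice of kappa, t = 2 u (1 - eps) (1 - delta) / (1 + delta) log n
  with u = 1 / (2 s + 1) and a small delta.  For eta = delta,
  exp(- (1 + eta) t / 2) is the power of n of exponent
  - (1 - eps) (1 - delta) u, whereas M is of order |I_n| / h, more
  than n to any power less than (1 - eps) u.  The product tends to infinity
  (near_many_bumps).

  The function psi is a truncation of phi (localized_recovery).  A function
  that is square integrable and whose k-th derivative is Hoelder continuous is
  bounded with its derivatives: it is at most 2 somewhere in every unit
  interval, the mean value theorem passes such a bound on to the derivatives,
  and one integrates back from the k-th one.  Multiplication by a slowly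
  varying cut-off then hardly increases the Hoelder constant.

  The last claim follows by letting eps tend to 0 along w((1 - eps) P).
*)

Set Implicit Arguments.
Unset Strict Implicit.
Unset Printing Implicit Defensive.

(** * Densities and affine changes of variable *)

Section measure_lemmas.
Local Open Scope ereal_scope.
Import HBNNSimple.

(** For simple functions this is the hypothesis on nu; monotone convergence
    extends it to f. *)
Lemma ge0_integral_density {d} {T : measurableType d} {R : realType}
    (mu nu : {measure set T -> \bar R}) (p : T -> R) (f : T -> \bar R) :
  measurable_fun setT p -> (forall x, 0 <= p x)%R ->
  (forall A, measurable A -> nu A = \int[mu]_(x in A) (p x)%:E) ->
  measurable_fun setT f -> (forall x, 0 <= f x) ->
  \int[nu]_x f x = \int[mu]_x (f x * (p x)%:E).
Proof.
move=> mp p0 nuE mf f0.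
have mpE : measurable_fun setT (EFin \o p) by exact/measurable_EFinP.
pose h := nnsfun_approx measurableT mf.
have -> : \int[nu]_x f x = limn (fun n => \int[nu]_x (h n x)%:E).
  rewrite -monotone_convergence//=.
  - apply: eq_integral => x _; apply/esym/cvg_lim => //=.
    exact: cvg_nnsfun_approx.
  - by move=> n; exact/measurable_EFinP/measurable_funTS.
  - by move=> n x _; rewrite lee_fin.
  - by move=> x _ a b ab; rewrite lee_fin; exact/lefP/nd_nnsfun_approx.
have -> : \int[mu]_x (f x * (p x)%:E) =
    limn (fun n => \int[mu]_x ((h n x)%:E * (p x)%:E)).
  rewrite -monotone_convergence//=.
  - apply: eq_integral => x _; apply/esym/cvg_lim => //=.
    apply: (cvgeZr (f := fun n => (h n x)%:E)) => //; exact: cvg_nnsfun_approx.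
  - move=> n; apply: emeasurable_funM => //.
    exact/measurable_EFinP/measurable_funTS.
  - by move=> n x _; rewrite mule_ge0// lee_fin.
  - move=> x _ a b ab; rewrite lee_wpmul2r ?lee_fin//.
    exact/lefP/nd_nnsfun_approx.
suff suf n : \int[nu]_x (h n x)%:E = \int[mu]_x ((h n x)%:E * (p x)%:E).
  by under eq_fun do rewrite suf.
under eq_integral do rewrite fimfunE -fsumEFin//.
rewrite ge0_integral_fsum//; last 2 first.
  - by move=> r; apply/measurable_EFinP; do 2 apply/measurableT_comp => //.
  - by move=> r x _; exact: nnfun_muleindic_ge0.
transitivity (\int[mu]_x (\sum_(y \in range (h n))
    (y * \1_(h n @^-1` [set y]) x)%:E * (p x)%:E)); last first.
  apply: eq_integral => x _.
  rewrite -ge0_mule_fsuml => [|y]; last exact: nnfun_muleindic_ge0.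
  by rewrite fsumEFin // -(fimfunE _ x).
rewrite ge0_integral_fsum//; last 2 first.
  - move=> r; apply: emeasurable_funM => //; apply/measurable_EFinP.
    by do 2 apply/measurableT_comp => //.
  - by move=> r x _; apply: mule_ge0; [exact: nnfun_muleindic_ge0|rewrite lee_fin].
apply: eq_fsbigr => r rhn.
under [LHS]eq_integral do rewrite EFinM.
rewrite integralZl_indic_nnsfun => //.
under [RHS]eq_integral do rewrite EFinM -muleA.
rewrite ge0_integralZl//=.
- rewrite integral_indic// setIT nuE//.
  congr (_ * _); rewrite integral_mkcond.
  apply: eq_integral => x _; rewrite patchE indicE.
  by case: ifP => _; rewrite ?mul1e ?mul0e.
- apply: emeasurable_funM => //.
  exact/measurable_EFinP/measurable_indic.
- by move=> x _; rewrite mule_ge0 ?lee_fin.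
- by move/set_mem: rhn => [x _ <-]; rewrite lee_fin.
Qed.

(** By uniqueness of the Lebesgue measure, which is h^-1 times its image under
    x |-> (x - a) / h, as both give the same value to intervals. *)
Lemma ge0_integral_affine {R : realType} (G : R -> \bar R) (a h : R) :
  (0 < h)%R -> measurable_fun setT G -> (forall x, 0 <= G x) ->
  \int[lebesgue_measure]_x G ((x - a) / h)%R =
  h%:E * \int[lebesgue_measure]_x G x.
Proof.
move=> h0 mG G0.
pose phi := (fun x : measurableTypeR R => ((x - a) / h)%R : measurableTypeR R).
have mphi : measurable_fun setT phi.
  by apply: measurable_funM => //; exact: measurable_funB.
have hV0 : (0 <= h^-1)%R by rewrite invr_ge0 ltW.
have lebE A : measurable A -> lebesgue_measure A =
    mscale (NngNum hV0)
      (pushforward (lebesgue_measure : measure (measurableTypeR R) R) phi) A.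
  apply: lebesgue_measure_unique => _ [[u v] /= uv <-].
  rewrite /mscale/= /pushforward/=.
  have -> : phi @^-1` `]u, v] = `](a + u * h)%R, (a + v * h)%R]%classic.
    apply/seteqP; split => x /=; rewrite /phi !in_itv/= ltr_pdivlMr//
      ler_pdivrMr// => /andP[? ?]; apply/andP; split; lra.
  rewrite !lebesgue_measure_itv/= !lte_fin ltrD2l ltr_pM2r//.
  case: ifP => _; last by rewrite mule0.
  rewrite -!EFinD -EFinM; congr EFin.
  by rewrite (_ : a + v * h - (a + u * h) = h * (v - u))%R; [rewrite mulKf ?gt_eqF|lra].
have := @ge0_integral_pushforward _ _ _ _ R phi mphi
  (lebesgue_measure : measure (measurableTypeR R) R) setT G measurableT mG (fun x _ => G0 x).
rewrite preimage_setT /comp/phi => <-.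
rewrite [in RHS](eq_measure_integral
  (mscale (NngNum hV0) (pushforward (lebesgue_measure : measure (measurableTypeR R) R) phi))); last first.
  by move=> A mA _; exact: lebE.
rewrite ge0_integral_mscale//= muleA -EFinM divff ?mul1e// gt_eqF//.
Qed.

End measure_lemmas.

(** * Gaussian integrals *)

(** The inverses of kappa, K and S are the primed letters, and S stands for a
    variance: with denominators as independent letters, the completion of the
    square in y becomes a polynomial identity modulo four relations. *)
Lemma complete_square (R : realFieldType) (kappa K S b u y kappa' K' S' : R) :
  kappa * kappa' = 1 -> K * K' = 1 -> S * S' = 1 -> b ^+ 2 = (K - kappa) * S' ->
  - (u + b * y) ^+ 2 * (2^-1 * kappa') + - y ^+ 2 * (S' * 2^-1) =
  - u ^+ 2 * (2^-1 * K') + - (y - - (u * b * S * K')) ^+ 2 * (S' * (kappa' * K) * 2^-1).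
Proof.
move=> e3 e2 e4 e1.
have hA : b ^+ 2 * kappa' = K * S' * kappa' - S'.
  rewrite e1; transitivity (K * S' * kappa' - (kappa * kappa') * S'); first lra.
  by rewrite e3 mul1r.
have hB : S * K' * (S' * kappa' * K) = kappa'.
  transitivity ((S * S') * (K * K') * kappa'); first lra.
  by rewrite e4 e2 !mul1r.
have hC : b ^+ 2 * S ^+ 2 * K' ^+ 2 * (S' * kappa' * K) = kappa' - K'.
  rewrite e1; transitivity ((S * S') ^+ 2 * (K * K') ^+ 2 * kappa' -
    (S * S') ^+ 2 * (K * K') * (kappa * kappa') * K'); first by clear; lra.
  by rewrite e4 e2 e3 !expr1n !mul1r.
apply/eqP; rewrite -subr_eq0; apply/eqP.
transitivity (- 2^-1 * y ^+ 2 * (b ^+ 2 * kappa' - (K * S' * kappa' - S'))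
  + y * u * b * (S * K' * (S' * kappa' * K) - kappa')
  + 2^-1 * u ^+ 2 * (b ^+ 2 * S ^+ 2 * K' ^+ 2 * (S' * kappa' * K) - (kappa' - K'))).
  by clear; lra.
by rewrite hA hB hC !subrr !mulr0 !addr0.
Qed.

Section gaussian.
Context {R : realType}.
Implicit Types (u v y m sigma kappa : R).

Lemma normal_prob_integral sigma (f : R -> \bar R) :
  measurable_fun setT f -> (forall x, 0 <= f x)%E ->
  (\int[normal_prob 0 sigma]_y f y =
   \int[lebesgue_measure]_y (f y * (normal_pdf 0 sigma y)%:E))%E.
Proof.
move=> mf f0.
by apply: ge0_integral_density => //; [exact: measurable_normal_pdf|exact: normal_pdf_ge0].
Qed.

(** The Cameron-Martin formula in dimension one: translate the variable of
    integration and compare the two Gaussian densities. *)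
Lemma normal_prob_shift sigma (G : R -> \bar R) m : 0 < sigma ->
  measurable_fun setT G -> (forall x, 0 <= G x)%E ->
  (\int[normal_prob 0 sigma]_y G (m + y)%R =
   \int[normal_prob 0 sigma]_y
     (G y * (expR (m * y / sigma ^+ 2 - m ^+ 2 / sigma ^+ 2 / 2))%:E))%E.
Proof.
move=> s0 mG G0.
have mexp : measurable_fun [set: R]
    (fun y => expR (m * y / sigma ^+ 2 - m ^+ 2 / sigma ^+ 2 / 2)).
  apply: measurableT_comp => //; apply: measurable_funD => //.
  by apply: measurable_funM => //; exact: measurable_funM.
have mGe : measurable_fun setT (fun y => G y *
    (expR (m * y / sigma ^+ 2 - m ^+ 2 / sigma ^+ 2 / 2))%:E)%E.
  by apply: emeasurable_funM => //; exact/measurable_EFinP.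
rewrite normal_prob_integral//; last first.
  by apply: measurableT_comp => //; exact: measurable_funD.
rewrite normal_prob_integral//; last first.
  by move=> x; rewrite mule_ge0// lee_fin expR_ge0.
have mF : measurable_fun setT (fun y => G y *
    (expR (m * y / sigma ^+ 2 - m ^+ 2 / sigma ^+ 2 / 2))%:E *
    (normal_pdf 0 sigma y)%:E)%E.
  apply: emeasurable_funM => //.
  by apply/measurable_EFinP; exact: measurable_normal_pdf.
have := @ge0_integral_affine _ _ (- m) 1 ltr01 mF.
rewrite mul1e => <-; last first.
  by move=> y; rewrite !mule_ge0// lee_fin ?expR_ge0// normal_pdf_ge0.
apply: eq_integral => y _; rewrite divr1 opprK (addrC y) -muleA; congr (_ * _)%E.
  rewrite -EFinM normal_pdfE ?gt_eqF// mulrCA; congr (_ * _)%:E.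
  rewrite /normal_fun -expRD; congr expR.
  have -> : sigma ^+ 2 *+ 2 = sigma ^+ 2 * 2 by rewrite mulr_natr.
  rewrite invfM; lra.
Qed.

(** The total mass of the shifted law of normal_prob_shift is 1. *)
Lemma normal_prob_expR sigma b : 0 < sigma ->
  (\int[normal_prob 0 sigma]_y (expR (b * y))%:E =
     (expR (b ^+ 2 * sigma ^+ 2 / 2))%:E)%E.
Proof.
move=> s0; have := @normal_prob_shift sigma (cst 1%E) (b * sigma ^+ 2) s0
  (measurable_cst _ ) (fun=> lee01).
rewrite integral_cst//= probability_setT mul1e => h.
rewrite -[RHS]mule1 h -ge0_integralZl//; last first.
- apply/measurable_EFinP; apply: measurable_funM => //.
  apply: measurableT_comp => //; apply: measurable_funD => //.
  by apply: measurable_funM => //; exact: measurable_funM.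
apply: eq_integral => y _; rewrite mul1e -EFinM -expRD; congr (expR _)%:E.
set S := sigma ^+ 2; have S0 : S != 0 by rewrite gt_eqF// exprn_gt0.
have -> : b * S * y / S = b * y by rewrite (mulrAC b) mulfK.
have -> : (b * S) ^+ 2 / S = b ^+ 2 * S by rewrite exprMn (expr2 S) mulrA mulfK.
by lra.
Qed.

(** Variances add up under convolution, so the kernel of variance kappa
    becomes a kernel of variance kappa + (b sigma)^2. *)
Lemma normal_prob_gauss sigma kappa u b : 0 < sigma -> 0 < kappa ->
  (\int[normal_prob 0 sigma]_y (expR (- (u + b * y) ^+ 2 / (2 * kappa)))%:E =
   (Num.sqrt (kappa / (kappa + b ^+ 2 * sigma ^+ 2)) *
     expR (- u ^+ 2 / (2 * (kappa + b ^+ 2 * sigma ^+ 2))))%:E)%E.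
Proof.
move=> s0 k0; set K := kappa + _.
have K0 : 0 < K by rewrite ltr_wpDr// mulr_ge0 ?sqr_ge0.
(* The integrand times the density of the noise is, up to a constant, the
   density of the normal law of mean m and standard deviation t. *)
pose t := sigma * Num.sqrt (kappa / K).
pose m := - (u * b * sigma ^+ 2 / K).
have t0 : 0 < t by rewrite mulr_gt0// sqrtr_gt0 divr_gt0.
rewrite normal_prob_integral//; last first.
  apply/measurable_EFinP; apply: measurableT_comp => //.
  apply: measurable_funM => //; apply: measurableT_comp => //.
  by apply: measurable_funX; apply: measurable_funD => //; exact: measurable_funM.
set C := (Num.sqrt _ * _).
transitivity (\int[lebesgue_measure]_y (C%:E * (normal_pdf m t y)%:E))%E; last first.
  rewrite ge0_integralZl ?integral_normal_pdf ?mule1//.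
  - by apply/measurable_EFinP; exact: measurable_normal_pdf.
  - by move=> y _; rewrite lee_fin normal_pdf_ge0.
  - by rewrite lee_fin mulr_ge0 ?expR_ge0 ?sqrtr_ge0.
apply: eq_integral => y _; rewrite -!EFinM; congr EFin; rewrite /C.
rewrite !normal_pdfE ?gt_eqF// [RHS]mulrACA [LHS]mulrCA; congr (_ * _).
  have q0 : 0 < Num.sqrt (kappa / K) by rewrite sqrtr_gt0 divr_gt0.
  rewrite /normal_peak /t; move: (Num.sqrt (kappa / K)) q0 => r r0.
  rewrite (_ : (sigma * r) ^+ 2 * pi *+ 2 = (sigma ^+ 2 * pi *+ 2) * r ^+ 2); last first.
    by rewrite exprMn mulrnAl mulrAC.
  rewrite (@sqrtrM _ (sigma ^+ 2 * pi *+ 2)); last first.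
    by rewrite mulrn_wge0// mulr_ge0 ?sqr_ge0// pi_ge0.
  by rewrite sqrtr_sqr ger0_norm ?(ltW r0)// invfM mulrCA divff ?mulr1// gt_eqF.
rewrite /normal_fun -!expRD; congr expR.
rewrite /t exprMn sqr_sqrtr; last by rewrite divr_ge0 ?ltW.
rewrite -(mulr_natr (sigma ^+ 2) 2) -(mulr_natr (sigma ^+ 2 * _) 2).
rewrite (invfM 2 kappa) (invfM 2 K) (invfM (sigma ^+ 2) 2).
rewrite (invfM (sigma ^+ 2 * (kappa / K)) 2) (invfM (sigma ^+ 2) (kappa / K)).
rewrite (invfM kappa K^-1) invrK subr0 /m.
have s20 : sigma ^+ 2 != 0 by rewrite gt_eqF// exprn_gt0.
apply: (@complete_square _ kappa K (sigma ^+ 2)); rewrite ?divff ?gt_eqF ?exprn_gt0//.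
by rewrite (_ : K - kappa = b ^+ 2 * sigma ^+ 2) ?mulfK// /K addrAC subrr add0r.
Qed.
End gaussian.

(** * An envelope for the probability of guessing a sign *)

Lemma measurable_funV d (T : measurableType d) (R : realType) (f : T -> R) :
  measurable_fun setT f -> (forall x, 0 < f x) ->
  measurable_fun setT (fun x => (f x)^-1).
Proof.
move=> mf f0; rewrite (_ : (fun _ => _) = (fun x => f x `^ (-1))).
  by apply: (measurableT_comp (f := fun y : R => y `^ (-1))) => //; exact: measurable_powR.
by apply/funext => x; rewrite powR_inv1// ltW.
Qed.

Section envelope.
Context {R : realType}.
Implicit Types (u v y b sigma : R).

(** Given the energy v of a bump, the best guess of its sign from its score
    succeeds with probability Phi(sqrt v), where Phi is the normal
    distribution function. In place of this function of the final energy, the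
    induction over the observations needs a function of the current score u
    and of the energy v that is still to come. Both terms of the envelope are
    such that adding to u a centred Gaussian variable of variance c and
    applying the factor exp(- c / 2) amounts to adding c to v: the first one
    is cosh u, the second one is exp(- (1 + v) / 2) times a Gaussian kernel of
    variance 1 + v in u, up to a constant. The second term makes the envelope
    less than 1 at u = 0, and is small enough for the envelope to dominate
    exp|u| / 2 at v = 0. *)
Definition envelope u v : R := (expR u + expR (- u)) / 2 -
  expR (- (1 + v + ln (1 + v) + u ^+ 2 / (1 + v)) / 2) / 2.

Lemma cosh_ge1 u : 1 <= (expR u + expR (- u)) / 2.
Proof. by have := expR_ge1Dx u; have := expR_ge1Dx (- u); lra. Qed.

Lemma envelope_gt0 u v : 0 <= v -> 0 < envelope u v.
Proof.
move=> v0; have := cosh_ge1 u.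
have l0 : 0 <= ln (1 + v) by apply: ln_ge0; lra.
have q0 : 0 <= u ^+ 2 / (1 + v) by rewrite divr_ge0 ?sqr_ge0//; lra.
have : expR (- (1 + v + ln (1 + v) + u ^+ 2 / (1 + v)) / 2) <= 1.
  by rewrite -[leRHS]expR0 ler_expR; lra.
by rewrite /envelope; lra.
Qed.

(** The term exp(- |u|) of cosh u compensates the Gaussian term, because |u|
    <= (1 + u^2) / 2. *)
Lemma envelope_ge_expR_norm u : expR `|u| / 2 <= envelope u 0.
Proof.
rewrite /envelope addr0 ln1 divr1.
have -> : expR u + expR (- u) = expR `|u| + expR (- `|u|).
  by case: (ger0P u) => // _; rewrite opprK addrC.
suff : expR (- (1 + 0 + u ^+ 2) / 2) <= expR (- `|u|) by lra.
rewrite ler_expR -[u ^+ 2]real_normK ?num_real//.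
by have := sqr_ge0 (`|u| - 1); rewrite sqrrB; lra.
Qed.

Lemma measurable_envelope d (T : measurableType d) (a v : T -> R) :
  measurable_fun setT a -> measurable_fun setT v -> (forall x, 0 <= v x) ->
  measurable_fun setT (fun x => envelope (a x) (v x)).
Proof.
move=> ma mv v0.
have m1v : measurable_fun setT (fun x => 1 + v x) by exact: measurable_funD.
apply: measurable_funB.
  apply: measurable_funM => //; apply: measurable_funD; apply: measurableT_comp => //.
  exact: measurableT_comp.
apply: measurable_funM => //; apply: measurableT_comp => //.
apply: measurable_funM => //; apply: measurableT_comp => //.
apply: measurable_funD.
  apply: measurable_funD => //.
  by apply: measurableT_comp => //; exact: measurable_ln.
apply: measurable_funM; first exact: measurable_funX.
by apply: measurable_funV => // x; have := v0 x; lra.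
Qed.

(** Here b ^+ 2 * sigma ^+ 2 is the variance of the Gaussian variable b * y
    that is added to u. The hyperbolic cosine is multiplied by exp(variance /
    2), and the Gaussian kernel is widened. *)
Lemma normal_prob_envelope sigma u v b : 0 < sigma -> 0 <= v ->
  (\int[normal_prob 0 sigma]_y
     (envelope (u + b * y) v * expR (- (b ^+ 2 * sigma ^+ 2) / 2))%:E =
   (envelope u (v + b ^+ 2 * sigma ^+ 2))%:E)%E.
Proof.
move=> s0 v0; set c := b ^+ 2 * sigma ^+ 2.
have c0 : 0 <= c by rewrite mulr_ge0 ?sqr_ge0.
have maff : measurable_fun [set: R] (fun y => u + b * y).
  by apply: measurable_funD => //; exact: measurable_funM.
have menv : measurable_fun [set: R] (fun y => envelope (u + b * y) v).
  exact: measurable_envelope.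
have mexp k : measurable_fun [set: R] (fun y => expR (k * y)).
  by apply: measurableT_comp => //; exact: measurable_funM.
(* The second term of the envelope. It is integrated apart and added to both
   sides at the end, which avoids differences of integrals. *)
pose g u v := expR (- (1 + v + ln (1 + v) + u ^+ 2 / (1 + v)) / 2) / 2.
have g0 u' v' : 0 <= g u' v' by rewrite divr_ge0 ?expR_ge0.
have mg : measurable_fun [set: R] (fun y => g (u + b * y) v).
  rewrite /g; apply: measurable_funM => //; apply: measurableT_comp => //.
  apply: measurable_funM => //; apply: measurableT_comp => //.
  by apply: measurable_funD => //; apply: measurable_funM => //; exact: measurable_funX.
have gE : (\int[normal_prob 0 sigma]_y (expR (- c / 2) * g (u + b * y) v)%:E =
    (g u (v + c))%:E)%E.
  transitivity (\int[normal_prob 0 sigma]_y ((expR (- c / 2) * expR (- (1 + v + ln (1 + v)) / 2) / 2)%:E *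
     (expR (- (u + b * y) ^+ 2 / (2 * (1 + v))))%:E))%E.
    apply: eq_integral => y _; rewrite -EFinM /g; congr EFin.
    rewrite mulrA [RHS]mulrAC; congr (_ / _).
    by rewrite -!expRD; congr expR; rewrite invfM; lra.
  rewrite ge0_integralZl//; last first.
    apply/measurable_EFinP; apply: measurableT_comp => //.
    apply: measurable_funM => //; apply: measurableT_comp => //.
    exact: measurable_funX.
  have v10 : 0 < 1 + v by lra.
  have vc0 : 0 < 1 + v + c by lra.
  rewrite normal_prob_gauss -/c// -EFinM /g; congr EFin.
  have -> : Num.sqrt ((1 + v) / (1 + v + c)) =
      expR ((ln (1 + v) - ln (1 + v + c)) / 2).
    rewrite -ln_div ?posrE//.
    rewrite -[in LHS](@lnK _ ((1 + v) / (1 + v + c))) ?posrE ?divr_gt0//.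
    set l := ln _; rewrite {1}(_ : l = l / 2 + l / 2); last lra.
    by rewrite expRD -expr2 sqrtr_sqr ger0_norm// expR_ge0.
  rewrite addrA -mulrA mulrAC mulrA; congr (_ / _).
  rewrite -!expRD; congr expR; rewrite invfM; lra.
have coshE : (\int[normal_prob 0 sigma]_y
    (expR (- c / 2) * ((expR (u + b * y) + expR (- (u + b * y))) / 2))%:E =
    ((expR u + expR (- u)) / 2)%:E)%E.
  transitivity (\int[normal_prob 0 sigma]_y
    ((expR (- c / 2) / 2 * expR u)%:E * (expR (b * y))%:E +
     (expR (- c / 2) / 2 * expR (- u))%:E * (expR (- b * y))%:E))%E.
    apply: eq_integral => y _; rewrite -!EFinM -EFinD; congr EFin.
    rewrite opprD (mulNr b) !(expRD u, expRD (- u)).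
    by move: (expR _) => p; lra.
  rewrite ge0_integralD//;
    try by apply: emeasurable_funM => //; apply/measurable_EFinP; exact: mexp.
  rewrite !ge0_integralZl//; try by apply/measurable_EFinP; exact: mexp.
  rewrite !normal_prob_expR// sqrrN -/c -!EFinM -EFinD; congr EFin.
  have : expR (- c / 2) * expR (c / 2) = 1 by rewrite -expRD mulNr addNr expR0.
  set p := expR (- c / 2); set q := expR (c / 2) => pq.
  have := congr1 (fun z => z * expR u) pq.
  have := congr1 (fun z => z * expR (- u)) pq.
  by lra.
have gfin : (g u (v + c))%:E \is a fin_num by [].
suff : (\int[normal_prob 0 sigma]_y
    (envelope (u + b * y) v * expR (- c / 2))%:E + (g u (v + c))%:E =
    (envelope u (v + c))%:E + (g u (v + c))%:E)%E.
  by move/(congr1 (fun z => z - (g u (v + c))%:E)%E); rewrite !addeK.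
rewrite -{1}gE -ge0_integralD//;
  try by [apply/measurable_EFinP; exact: measurable_funM|
    move=> y _; rewrite lee_fin mulr_ge0 ?expR_ge0// ltW ?envelope_gt0].
rewrite -EFinD.
rewrite (_ : envelope u (v + c) + g u (v + c) = (expR u + expR (- u)) / 2); last first.
  by rewrite /g /envelope; lra.
rewrite -coshE; apply: eq_integral => y _; rewrite -EFinD; congr EFin.
by rewrite /envelope -/(g _ _); lra.
Qed.

End envelope.

(** * Integration over independent observations *)

Section iid_integral.
Context d (T : measurableType d) (R : realType) (P : probability T R).
Local Open Scope ereal_scope.

Lemma integral_iid_law0 (F : 0.-tuple T -> \bar R) :
  measurable_fun setT F ->
  \int[iid_law P 0]_z F z = F [tuple].
Proof. by move=> mF; rewrite integral_dirac// diracT mul1e. Qed.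

Lemma integral_iid_lawS n (F : n.+1.-tuple T -> \bar R) :
  measurable_fun setT F -> (forall z, 0 <= F z) ->
  \int[iid_law P n.+1]_z F z = \int[P]_p \int[iid_law P n]_z F [tuple of p :: z].
Proof.
move=> mF F0; rewrite ge0_integral_distribution//.
rewrite fubini_tonelli1//; last by move=> z; exact: F0.
by apply: measurableT_comp => //; exact: measurable_cons.
Qed.

Lemma integral_iid_lawS_swap n (F : n.+1.-tuple T -> \bar R) :
  measurable_fun setT F -> (forall z, 0 <= F z) ->
  \int[iid_law P n.+1]_z F z = \int[iid_law P n]_z \int[P]_p F [tuple of p :: z].
Proof.
move=> mF F0; rewrite ge0_integral_distribution//.
rewrite fubini_tonelli2//; last by move=> z; exact: F0.
by apply: measurableT_comp => //; exact: measurable_cons.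
Qed.

Lemma iid_fubini n (G : n.-tuple T -> T -> \bar R) :
  measurable_fun setT (fun zp => G zp.1 zp.2) -> (forall z p, 0 <= G z p) ->
  \int[iid_law P n]_z \int[P]_p G z p = \int[P]_p \int[iid_law P n]_z G z p.
Proof.
move=> mG G0; exact: (@fubini_tonelli _ _ _ _ _ (iid_law P n) P
  (fun zp => G zp.1 zp.2) mG (fun zp => G0 zp.1 zp.2)).
Qed.

Lemma measurable_tuple_sum n (g : T -> R) : measurable_fun setT g ->
  measurable_fun [set: n.-tuple T] (fun z => \sum_(p <- z) g p)%R.
Proof.
move=> mg; under eq_fun do rewrite big_tuple.
apply: measurable_sum => i; apply: measurableT_comp => //.
exact: measurable_tnth.
Qed.

Lemma measurable_map_tuple n (g : T -> T) : measurable_fun setT g ->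
  measurable_fun [set: n.-tuple T] (fun z => [tuple of map g z]).
Proof.
move=> mg; apply/measurable_fun_tnthP => i.
rewrite (_ : _ \o _ = fun z => g (tnth z i)).
  by apply: measurableT_comp => //; exact: measurable_tnth.
by apply/funext => z /=; rewrite tnth_map.
Qed.

Lemma measurable_prod_EFin d' (T' : measurableType d') M (h : 'I_M -> T' -> R) :
  (forall j, measurable_fun setT (h j)) ->
  measurable_fun setT (fun x => (\prod_j h j x)%R%:E).
Proof. by move=> mh; apply/measurable_EFinP; exact: measurable_prod. Qed.

End iid_integral.

(** * The mean of a product of envelopes *)

Section score.
Context {R : realType} (sigma : R).
Implicit Types (g : R -> R) (z : seq (R * R)).

(** The logarithm of the likelihood ratio of the signal g against pure noise
    is score g z - energy g z / 2. *)
Definition score g z : R := \sum_(p <- z) g p.1 * p.2 / sigma ^+ 2.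
Definition energy g z : R := \sum_(p <- z) g p.1 ^+ 2 / sigma ^+ 2.

Lemma energy_ge0 g z : 0 <= energy g z.
Proof. by apply: sumr_ge0 => p _; rewrite divr_ge0 ?sqr_ge0. Qed.

Lemma measurable_score n g : measurable_fun setT g ->
  measurable_fun [set: n.-tuple (measurableTypeR R * measurableTypeR R)]
    (fun z : n.-tuple (R * R) => score g z).
Proof.
move=> mg; apply: (@measurable_tuple_sum _ (measurableTypeR R * measurableTypeR R)%type
  _ n (fun p => g p.1 * p.2 / sigma ^+ 2)).
apply: measurable_funM => //; apply: measurable_funM => //.
exact: measurableT_comp.
Qed.

Lemma measurable_energy n g : measurable_fun setT g ->
  measurable_fun [set: n.-tuple (measurableTypeR R * measurableTypeR R)]
    (fun z : n.-tuple (R * R) => energy g z).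
Proof.
move=> mg; apply: (@measurable_tuple_sum _ (measurableTypeR R * measurableTypeR R)%type
  _ n (fun p => g p.1 ^+ 2 / sigma ^+ 2)).
apply: measurable_funM => //; apply: measurable_funX; exact: measurableT_comp.
Qed.

End score.

Section mean_envelope.
Context {R : realType} (PX : probability (measurableTypeR R) R) (sigma : R).
Hypothesis sigma_gt0 : 0 < sigma.
Context (M : nat) (f : 'I_M -> R -> R).
Hypothesis mf : forall j, measurable_fun setT (f j).
Hypothesis f_disjoint : forall i j x, i != j -> f i x != 0 -> f j x = 0.
Local Notation T := (measurableTypeR R * measurableTypeR R)%type.
Local Notation P := (PX \x normal_prob 0 sigma)%E.

(** The supports of the f j are disjoint, so at the design point x at most one
    factor depends on y, and normal_prob_envelope applies to it. *)
Lemma normal_prob_prod_envelope (a v : 'I_M -> R) x : (forall j, 0 <= v j) ->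
  (\int[normal_prob 0 sigma]_y
    (\prod_j (envelope (a j + f j x * y / sigma ^+ 2) (v j)
       * expR (- (f j x ^+ 2 / sigma ^+ 2) / 2)))%:E =
  (\prod_j envelope (a j) (v j + f j x ^+ 2 / sigma ^+ 2))%:E)%E.
Proof.
move=> v0.
have s20 : sigma ^+ 2 != 0 by rewrite gt_eqF// exprn_gt0.
have [[j fj]|nf] := pselect (exists j, f j x != 0); last first.
  have f0 j : f j x = 0.
    by apply/eqP; apply: contrapT => /negP fj; apply: nf; exists j.
  transitivity (\int[normal_prob 0 sigma]_y (cst (\prod_j envelope (a j) (v j))%:E y))%E.
    apply: eq_integral => y _; congr EFin; apply: eq_bigr => j _.
    by rewrite f0 !mul0r addr0 expr0n/= mul0r oppr0 mul0r expR0 mulr1.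
  rewrite integral_cst//= probability_setT mule1; congr EFin.
  by apply: eq_bigr => j _; rewrite f0 expr0n/= mul0r addr0.
have f0 i : i != j -> f i x = 0 by move=> ij; apply: (@f_disjoint j) => //; rewrite eq_sym.
pose C := \prod_(i | i != j) envelope (a i) (v i).
have C0 : 0 <= C by apply: prodr_ge0 => i _; rewrite ltW// envelope_gt0.
pose b := f j x / sigma ^+ 2.
have bE : b ^+ 2 * sigma ^+ 2 = f j x ^+ 2 / sigma ^+ 2.
  by rewrite /b exprMn -mulrA (expr2 (_^-1)) divfK.
transitivity (\int[normal_prob 0 sigma]_y (C%:E *
  (envelope (a j + b * y) (v j) * expR (- (b ^+ 2 * sigma ^+ 2) / 2))%:E))%E.
  apply: eq_integral => y _; rewrite -EFinM; congr EFin.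
  rewrite (bigD1 j)//= mulrC; congr (_ * _).
    apply: eq_bigr => i ij.
    by rewrite f0// !mul0r addr0 expr0n/= mul0r oppr0 mul0r expR0 mulr1.
  by rewrite bE /b (mulrAC (f j x)).
rewrite ge0_integralZl//; last 2 first.
- apply/measurable_EFinP; apply: measurable_funM => //; apply: measurable_envelope => //.
  by apply: measurable_funD => //; exact: measurable_funM.
- by move=> y _; rewrite lee_fin mulr_ge0 ?expR_ge0// ltW// envelope_gt0.
rewrite normal_prob_envelope// -EFinM bE; congr EFin.
rewrite (bigD1 j)//= mulrC; congr (_ * _); apply: eq_bigr => i ij.
by rewrite f0// expr0n/= mul0r addr0.
Qed.

Lemma design_noise_integral (F : T -> \bar R) :
  measurable_fun setT F -> (forall p, 0 <= F p)%E ->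
  (\int[P]_p F p = \int[PX]_x \int[normal_prob 0 sigma]_y F (x, y))%E.
Proof. by move=> mF F0; rewrite fubini_tonelli1. Qed.

Let mf1 j : measurable_fun [set: T] (fun p => f j p.1).
Proof. exact: (measurableT_comp (mf j) measurable_fst). Qed.

Lemma prod_prob_envelope (a v : 'I_M -> R) : (forall j, 0 <= v j) ->
  (\int[P]_p (\prod_j (envelope (a j + f j p.1 * p.2 / sigma ^+ 2) (v j)
       * expR (- (f j p.1 ^+ 2 / sigma ^+ 2) / 2)))%:E =
  \int[P]_p (\prod_j envelope (a j) (v j + f j p.1 ^+ 2 / sigma ^+ 2))%:E)%E.
Proof.
move=> v0.
have mL : measurable_fun [set: T] (fun p =>
    (\prod_j (envelope (a j + f j p.1 * p.2 / sigma ^+ 2) (v j)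
       * expR (- (f j p.1 ^+ 2 / sigma ^+ 2) / 2)))%:E).
  apply: measurable_prod_EFin => j; apply: measurable_funM.
    apply: measurable_envelope => //; apply: measurable_funD => //.
    by apply: measurable_funM => //; exact: measurable_funM.
  apply: measurableT_comp => //; apply: measurable_funM => //.
  apply: measurableT_comp => //; apply: measurable_funM => //.
  exact: measurable_funX.
have mR : measurable_fun [set: T] (fun p =>
    (\prod_j envelope (a j) (v j + f j p.1 ^+ 2 / sigma ^+ 2))%:E).
  apply: measurable_prod_EFin => j; apply: measurable_envelope => //.
    apply: measurable_funD => //; apply: measurable_funM => //; exact: measurable_funX.
  by move=> p; rewrite addr_ge0// divr_ge0 ?sqr_ge0.
rewrite (design_noise_integral mL); last first.
  move=> p; rewrite lee_fin; apply: prodr_ge0 => j _.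
  by rewrite mulr_ge0 ?expR_ge0// ltW// envelope_gt0.
rewrite (design_noise_integral mR); last first.
  move=> p; rewrite lee_fin; apply: prodr_ge0 => j _.
  by rewrite ltW// envelope_gt0// addr_ge0// divr_ge0 ?sqr_ge0.
apply: eq_integral => x _ /=.
by rewrite normal_prob_prod_envelope// integral_cst//= probability_setT mule1.
Qed.

(** By induction on n: prod_prob_envelope integrates one observation out,
    which transfers its energy to the second argument of the envelopes. The
    first argument is general because the scores of the other observations add
    up there. *)
Lemma mean_envelope n (u v : 'I_M -> R) : (forall j, 0 <= v j) ->
  (\int[iid_law P n]_z (\prod_j (envelope (u j + score sigma (f j) z) (v j)
       * expR (- energy sigma (f j) z / 2)))%:E =
  \int[iid_law P n]_z (\prod_j envelope (u j) (v j + energy sigma (f j) z))%:E)%E.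
Proof.
have mL m (u' v' : 'I_M -> R) : (forall j, 0 <= v' j) ->
  measurable_fun [set: m.-tuple T] (fun z : m.-tuple (R * R) =>
   (\prod_j (envelope (u' j + score sigma (f j) z) (v' j)
       * expR (- energy sigma (f j) z / 2)))%:E).
  move=> v0; apply: measurable_prod_EFin => j; apply: measurable_funM.
    apply: measurable_envelope => //; apply: measurable_funD => //.
    exact: measurable_score.
  apply: measurableT_comp => //; apply: measurable_funM => //.
  by apply: measurableT_comp => //; exact: measurable_energy.
have L0 m (u' v' : 'I_M -> R) (z : m.-tuple (R * R)) : (forall j, 0 <= v' j) ->
   (0 <= (\prod_j (envelope (u' j + score sigma (f j) z) (v' j)
       * expR (- energy sigma (f j) z / 2)))%:E)%E.
  move=> v0; rewrite lee_fin; apply: prodr_ge0 => j _.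
  by rewrite mulr_ge0 ?expR_ge0// ltW// envelope_gt0.
have mR m (u' v' : 'I_M -> R) : (forall j, 0 <= v' j) ->
  measurable_fun [set: m.-tuple T] (fun z : m.-tuple (R * R) =>
   (\prod_j envelope (u' j) (v' j + energy sigma (f j) z))%:E).
  move=> v0; apply: measurable_prod_EFin => j; apply: measurable_envelope => //.
    by apply: measurable_funD => //; exact: measurable_energy.
  by move=> z; rewrite addr_ge0// energy_ge0.
have R0 m (u' v' : 'I_M -> R) (z : m.-tuple (R * R)) : (forall j, 0 <= v' j) ->
   (0 <= (\prod_j envelope (u' j) (v' j + energy sigma (f j) z))%:E)%E.
  move=> v0; rewrite lee_fin; apply: prodr_ge0 => j _.
  by rewrite ltW// envelope_gt0// addr_ge0// energy_ge0.
elim: n u v => [|n IH] u v v0.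
  rewrite !integral_iid_law0; [|exact: mR|exact: mL].
  congr EFin; apply: eq_bigr => j _.
  by rewrite /score /energy !big_nil !addr0 oppr0 mul0r expR0 mulr1.
rewrite integral_iid_lawS_swap; [|exact: mL|by move=> z; exact: L0].
transitivity (\int[iid_law P n]_z \int[P]_p
   (\prod_j (envelope (u j + score sigma (f j) z) (v j + f j p.1 ^+ 2 / sigma ^+ 2)
     * expR (- energy sigma (f j) z / 2)))%:E)%E.
  apply: eq_integral => z _.
  have cE (g : T -> 'I_M -> R) :
      (fun p => (\prod_j (g p j * expR (- energy sigma (f j) z / 2)))%:E) =
      (fun p => (\prod_j expR (- energy sigma (f j) z / 2))%:E * (\prod_j g p j)%:E)%E.
    by apply/funext => p; rewrite -EFinM -big_split/=; congr EFin;
      apply: eq_bigr => j _; rewrite mulrC.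
  have c0 : (0 <= (\prod_j expR (- energy sigma (f j) z / 2))%:E)%E.
    by rewrite lee_fin; apply: prodr_ge0 => j _; exact: expR_ge0.
  rewrite cE ge0_integralZl//; first last.
  - by move=> p _; rewrite lee_fin; apply: prodr_ge0 => j _;
      rewrite ltW// envelope_gt0// addr_ge0// divr_ge0 ?sqr_ge0.
  - apply: measurable_prod_EFin => j; apply: measurable_envelope => //.
      apply: measurable_funD => //; apply: measurable_funM => //; exact: measurable_funX.
    by move=> p; rewrite addr_ge0// divr_ge0 ?sqr_ge0.
  rewrite -prod_prob_envelope// -ge0_integralZl//; first last.
  - by move=> p _; rewrite lee_fin; apply: prodr_ge0 => j _;
      rewrite mulr_ge0 ?expR_ge0// ltW// envelope_gt0.
  - apply: measurable_prod_EFin => j; apply: measurable_funM.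
      apply: measurable_envelope => //; apply: measurable_funD => //.
      by apply: measurable_funM => //; exact: measurable_funM.
    apply: measurableT_comp => //; apply: measurable_funM => //.
    apply: measurableT_comp => //; apply: measurable_funM => //.
    exact: measurable_funX.
  rewrite -cE; apply: eq_integral => p _; congr EFin; apply: eq_bigr => j _.
  rewrite -mulrA -expRD /score /energy !big_cons; congr (envelope _ _ * expR _).
    by rewrite addrA addrAC.
  by rewrite -mulrDl -opprD.
pose G (z : n.-tuple T) (p : T) := (\prod_j (envelope
   (u j + score sigma (f j) z) (v j + f j p.1 ^+ 2 / sigma ^+ 2)
     * expR (- energy sigma (f j) z / 2)))%:E.
transitivity (\int[P]_p \int[iid_law P n]_z G z p)%E.
  apply: iid_fubini.
  - have mS j := measurableT_comp (measurable_score (n := n) sigma (mf j))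
      (@measurable_fst _ _ (n.-tuple T) T).
    have mE j := measurableT_comp (measurable_energy (n := n) sigma (mf j))
      (@measurable_fst _ _ (n.-tuple T) T).
    have mf2 j := measurableT_comp (mf1 j) (@measurable_snd _ _ (n.-tuple T) T).
    apply: measurable_prod_EFin => j; apply: measurable_funM.
      apply: measurable_envelope.
      + by apply: measurable_funD => //; exact: mS.
      + apply: measurable_funD => //; apply: measurable_funM => //.
        by apply: measurable_funX; exact: mf2.
      + by move=> p; rewrite addr_ge0// divr_ge0 ?sqr_ge0.
    apply: measurableT_comp => //; apply: measurable_funM => //.
    by apply: measurableT_comp => //; exact: mE.
  - by move=> z p; rewrite lee_fin; apply: prodr_ge0 => j _;
      rewrite mulr_ge0 ?expR_ge0// ltW// envelope_gt0// addr_ge0// divr_ge0 ?sqr_ge0.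
rewrite integral_iid_lawS; [|exact: mR|by move=> z; exact: R0].
apply: eq_integral => p _.
rewrite /G/= IH; last by move=> j; rewrite addr_ge0// divr_ge0 ?sqr_ge0.
apply: eq_integral => z _; congr EFin; apply: eq_bigr => j _.
by rewrite /energy big_cons addrA.
Qed.

End mean_envelope.

(** * Decoding the signs of a signal *)

Section decoding.
Context {R : realType} (PX : probability (measurableTypeR R) R) (sigma : R).
Hypothesis sigma_gt0 : 0 < sigma.
Local Notation T := (measurableTypeR R * measurableTypeR R)%type.
Local Notation P := (PX \x normal_prob 0 sigma)%E.

Definition likelihood_ratio (g : R -> R) (z : seq (R * R)) : R :=
  expR (score sigma g z - energy sigma g z / 2).

Lemma likelihood_ratio_ge0 g z : 0 <= likelihood_ratio g z.
Proof. exact: expR_ge0. Qed.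

Lemma measurable_likelihood_ratio n (g : R -> R) : measurable_fun setT g ->
  measurable_fun [set: n.-tuple T]
    (fun z : n.-tuple (R * R) => likelihood_ratio g z).
Proof.
move=> mg; apply: measurableT_comp => //; apply: measurable_funB.
  exact: measurable_score.
by apply: measurable_funM => //; exact: measurable_energy.
Qed.

Lemma likelihood_ratio_cons g p z :
  likelihood_ratio g (p :: z) = likelihood_ratio g [:: p] * likelihood_ratio g z.
Proof.
rewrite /likelihood_ratio -expRD /score /energy !big_cons !big_nil !addr0.
by congr expR; rewrite mulrDl opprD addrACA.
Qed.

Lemma measurable_likelihood_ratio1 (g : R -> R) : measurable_fun setT g ->
  measurable_fun [set: T] (fun p => likelihood_ratio g [:: p]).
Proof.
move=> mg; rewrite /likelihood_ratio /score /energy.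
under eq_fun do rewrite !big_cons !big_nil !addr0.
have mg1 := measurableT_comp mg (@measurable_fst _ _ (measurableTypeR R) (measurableTypeR R)).
apply: (measurableT_comp (@measurable_expR R)); apply: measurable_funB.
  exact: (measurable_funM (measurable_funM mg1 measurable_snd) (measurable_cst _)).
exact: (measurable_funM (measurable_funM (measurable_funX 2 mg1) (measurable_cst _))
  (measurable_cst _)).
Qed.

Lemma measurable_observation1 (g : R -> R) : measurable_fun setT g ->
  measurable_fun [set: T] (fun p => (p.1, g p.1 + p.2) : T).
Proof.
move=> mg.
have mg1 := measurableT_comp mg (@measurable_fst _ _ (measurableTypeR R) (measurableTypeR R)).
apply/measurable_fun_pairP; split; first exact: measurable_fst.
exact: (measurable_funD mg1 measurable_snd).
Qed.

(** At each design point x, this is the translation of the noise by g x. *)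
Lemma change_of_law1 (g : R -> R) (H : T -> \bar R) : measurable_fun setT g ->
  measurable_fun setT H -> (forall p, 0 <= H p)%E ->
  (\int[P]_p H (p.1, (g p.1 + p.2)%R) =
   \int[P]_p (H p * (likelihood_ratio g [:: p])%:E))%E.
Proof.
move=> mg mH H0.
have mg1 := measurableT_comp mg (@measurable_fst _ _ (measurableTypeR R) (measurableTypeR R)).
have mHo := measurableT_comp mH (measurable_observation1 mg).
have mHL : measurable_fun setT (fun p => H p * (likelihood_ratio g [:: p])%:E)%E.
  apply: (emeasurable_funM mH); apply/measurable_EFinP.
  exact: measurable_likelihood_ratio1.
have HL0 p : (0 <= H p * (likelihood_ratio g [:: p])%:E)%E.
  by rewrite mule_ge0// lee_fin likelihood_ratio_ge0.
apply: (etrans (design_noise_integral PX sigma mHo (fun p => H0 _))).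
apply: (etrans _ (esym (design_noise_integral PX sigma mHL HL0))).
apply: eq_integral => x _ /=.
have mHx : measurable_fun setT (fun y => H (x, y)).
  exact: (measurableT_comp mH (measurable_pair1 _)).
apply: (etrans (normal_prob_shift (g x) sigma_gt0 mHx (fun y => H0 _))).
apply: eq_integral => y _.
by rewrite /likelihood_ratio /score /energy !big_cons !big_nil !addr0.
Qed.

Lemma observations_cons (g : R -> R) n p (z : n.-tuple (R * R)) :
  observations g [tuple of p :: z] =
  [tuple of (p.1, g p.1 + p.2) :: observations g z].
Proof. exact: val_inj. Qed.

Lemma measurable_observations (g : R -> R) n : measurable_fun setT g ->
  measurable_fun [set: n.-tuple T] (@observations R g n : n.-tuple T -> n.-tuple T).
Proof.
move=> mg.
apply: (@measurable_map_tuple _ T n (fun p => (p.1, g p.1 + p.2))).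
exact: measurable_observation1.
Qed.

Lemma change_of_law n (g : R -> R) (G : n.-tuple T -> \bar R) : measurable_fun setT g ->
  measurable_fun setT G -> (forall z, 0 <= G z)%E ->
  (\int[iid_law P n]_z G (observations g z) =
   \int[iid_law P n]_z (G z * (likelihood_ratio g z)%:E))%E.
Proof.
move=> mg; elim: n G => [|n IH] G mG G0.
  rewrite !integral_iid_law0//.
  - rewrite /likelihood_ratio /score /energy !big_nil mul0r subr0 expR0 mule1.
    by congr G; exact: val_inj.
  - apply: emeasurable_funM => //; apply/measurable_EFinP.
    exact: measurable_likelihood_ratio.
  - exact: (measurableT_comp mG (measurable_observations mg)).
have mcons p : measurable_fun [set: n.-tuple T] (fun z => [tuple of p :: z]).
  exact: measurable_cons.
have mcons' (z : n.-tuple T) : measurable_fun [set: T] (fun p => [tuple of p :: z]).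
  exact: measurable_cons.
have mL1 := measurable_likelihood_ratio1 mg.
have mL m := @measurable_likelihood_ratio m _ mg.
rewrite integral_iid_lawS_swap//; last first.
  exact: (measurableT_comp mG (measurable_observations mg)).
transitivity (\int[iid_law P n]_z \int[P]_p
    (G [tuple of p :: observations g z] * (likelihood_ratio g [:: p])%:E))%E.
  apply: eq_integral => z _.
  rewrite -(change_of_law1 (H := fun p => G [tuple of p :: observations g z]) mg)//.
    by apply: eq_integral => p _; rewrite observations_cons.
  exact: (measurableT_comp mG (mcons' _)).
rewrite (@iid_fubini _ _ _ _ n (fun (z : n.-tuple T) p =>
  (G [tuple of p :: observations g z] * (likelihood_ratio g [:: p])%:E)%E)); first last.
- by move=> z p; rewrite mule_ge0// lee_fin likelihood_ratio_ge0.
- apply: emeasurable_funM.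
    apply: (measurableT_comp mG); apply: measurable_cons => //.
    exact: (measurableT_comp (measurable_observations mg)).
  by apply/measurable_EFinP; exact: (measurableT_comp mL1).
rewrite integral_iid_lawS; first last.
- by move=> z; rewrite mule_ge0// lee_fin likelihood_ratio_ge0.
- by apply: emeasurable_funM => //; apply/measurable_EFinP; exact: mL.
apply: eq_integral => p _.
rewrite (IH (fun z => G [tuple of p :: z] * (likelihood_ratio g [:: p])%:E)%E).
- by apply: eq_integral => z _; rewrite -muleA -EFinM -likelihood_ratio_cons.
- by apply: emeasurable_funM => //; exact: (measurableT_comp mG (mcons p)).
- by move=> z; rewrite mule_ge0// lee_fin likelihood_ratio_ge0.
Qed.

Context (M : nat) (f : 'I_M -> R -> R).
Hypothesis mf : forall j, measurable_fun setT (f j).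
Hypothesis f_disjoint : forall i j x, i != j -> f i x != 0 -> f j x = 0.

Definition signal (theta : {ffun 'I_M -> bool}) (x : R) : R :=
  \sum_j (-1) ^+ theta j * f j x.

Lemma measurable_signal theta : measurable_fun setT (signal theta).
Proof. by apply: measurable_sum => j; exact: measurable_funM. Qed.

(** As the supports are disjoint, the square of the signal has no cross terms,
    and its squares do not see the signs: the likelihood ratio factorises over
    the bumps. *)
Lemma likelihood_ratio_signal theta z : likelihood_ratio (signal theta) z =
  \prod_j expR ((-1) ^+ theta j * score sigma (f j) z - energy sigma (f j) z / 2).
Proof.
rewrite /likelihood_ratio -expR_sum; congr expR.
rewrite sumrB -mulr_suml; congr (_ - _ / _).
  rewrite /score; under [RHS]eq_bigr do rewrite big_distrr/=.
  rewrite exchange_big/=; apply: eq_bigr => p _.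
  by rewrite /signal !mulr_suml; apply: eq_bigr => j _; rewrite !mulrA.
rewrite /energy exchange_big/=; apply: eq_bigr => p _.
rewrite -mulr_suml; congr (_ / _).
have [[j fj]|nf] := pselect (exists j, f j p.1 != 0); last first.
  have f0 j : f j p.1 = 0.
    by apply/eqP; apply: contrapT => /negP fj; apply: nf; exists j.
  rewrite /signal !big1 ?expr0n// => j _; rewrite f0 ?mulr0// expr0n//.
have f0 i : i != j -> f i p.1 = 0.
  by move=> ij; apply: (@f_disjoint j) => //; rewrite eq_sym.
rewrite /signal (bigD1 j)//= [RHS](bigD1 j)//= !big1 ?addr0.
- by rewrite exprMn -exprM mulnC exprM sqrrN !expr1n mul1r.
- by move=> i ij; rewrite f0// expr0n.
- by move=> i ij; rewrite f0// mulr0.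
Qed.

(** The least of the 2 ^ M probabilities is at most their average. After a
    change of law to pure noise, the events decode z = theta are disjoint, so
    that a single likelihood ratio survives at each z; it is at most the
    product of the exp(|score| - energy / 2), hence at most 2 ^ M times the
    product of the envelopes, whose mean is given by mean_envelope. *)
Lemma decoding_bound n (decode : n.-tuple T -> {ffun 'I_M -> bool}) :
  (forall theta, measurable (decode @^-1` [set theta])) ->
  exists theta, (iid_law P n [set z | decode (observations (signal theta) z) = theta]
    <= \int[iid_law P n]_z (\prod_j envelope 0 (energy sigma (f j) z))%:E)%E.
Proof.
move=> mdec.
set B := (\int[iid_law P n]_z (\prod_j envelope 0 (energy sigma (f j) z))%:E)%E.
pose A theta : set (n.-tuple T) := decode @^-1` [set theta].
have mlik theta : measurable_fun [set: n.-tuple T]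
    (fun z : n.-tuple (R * R) => (\1_(A theta) z * likelihood_ratio (signal theta) z)%:E).
  apply/measurable_EFinP; apply: measurable_funM.
    apply: measurable_indic; exact: mdec.
  exact: (measurable_likelihood_ratio (measurable_signal theta)).
have PE theta : iid_law P n [set z | decode (observations (signal theta) z) = theta] =
   (\int[iid_law P n]_z (\1_(A theta) z * likelihood_ratio (signal theta) z)%:E)%E.
  have mobs : measurable [set z : n.-tuple T | decode (observations (signal theta) z) = theta].
    have := measurable_observations (n := n) (measurable_signal theta) measurableT (mdec theta).
    by rewrite setTI.
  transitivity (\int[iid_law P n]_z (\1_(A theta) (observations (signal theta) z))%:E)%E.
    by rewrite -[LHS](congr1 (iid_law P n) (setIT _)) -(integral_indic _ measurableT mobs).
  apply: (etrans (@change_of_law n (signal theta) (fun z => (\1_(A theta) z)%:E)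
    (measurable_signal theta) _ _)).
  - by apply/measurable_EFinP; apply: measurable_indic; exact: mdec.
  - by move=> z; rewrite lee_fin.
  - by apply: eq_integral => z _; rewrite -EFinM.
have sumB : (\sum_theta iid_law P n [set z | decode (observations (signal theta) z) = theta]
    <= (2 ^+ M)%:E * B)%E.
  under eq_bigr do rewrite PE.
  rewrite -ge0_integral_sum//; last first.
    by move=> theta z _; rewrite lee_fin mulr_ge0// likelihood_ratio_ge0.
  have menv : measurable_fun [set: n.-tuple T] (fun z : n.-tuple (R * R) =>
      (\prod_j (envelope (0 + score sigma (f j) z) 0 * expR (- energy sigma (f j) z / 2)))%:E).
    apply: measurable_prod_EFin => j; apply: measurable_funM.
      apply: measurable_envelope => //; apply: measurable_funD => //.
      exact: measurable_score.
    apply: measurableT_comp => //; apply: measurable_funM => //.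
    by apply: measurableT_comp => //; exact: measurable_energy.
  have env0 (z : n.-tuple (R * R)) : 0 <= \prod_j
      (envelope (0 + score sigma (f j) z) 0 * expR (- energy sigma (f j) z / 2)).
    by apply: prodr_ge0 => j _; rewrite mulr_ge0 ?expR_ge0// ltW// envelope_gt0.
  have -> : B = (\int[iid_law P n]_z (\prod_j envelope 0 (0 + energy sigma (f j) z))%:E)%E.
    apply: eq_integral => z _; congr EFin; apply: eq_bigr => j _.
    by rewrite add0r.
  rewrite -(mean_envelope PX sigma_gt0 mf f_disjoint n (fun=> 0) (v := fun=> 0))//.
  rewrite -ge0_integralZl//; last by move=> z _; rewrite lee_fin.
  apply: ge0_le_integral => //.
  - by move=> z _; apply: sume_ge0 => theta _; rewrite lee_fin mulr_ge0// likelihood_ratio_ge0.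
  - exact: emeasurable_sum.
  - exact: emeasurable_funM.
  move=> z _; rewrite (bigD1 (decode z))//= big1 ?adde0; last first.
    move=> theta td; rewrite indicE memNset ?mul0r// /A/= => /esym/eqP.
    by rewrite (negbTE td).
  rewrite indicE mem_set// mul1r likelihood_ratio_signal -EFinM lee_fin.
  rewrite -[M in 2 ^+ M]card_ord -prodr_const -big_split/=; apply: ler_prod => j _.
  rewrite expR_ge0/= expRD mulrA mulNr; apply: ler_wpM2r; first exact: expR_ge0.
  have := envelope_ge_expR_norm (score sigma (f j) z); rewrite add0r.
  suff : expR ((-1) ^+ decode z j * score sigma (f j) z) <= expR `|score sigma (f j) z| by lra.
  rewrite ler_expR; apply: le_trans (ler_norm _) _.
  by rewrite normrM normrX normrN1 expr1n mul1r.
pose p theta := fine (iid_law P n [set z | decode (observations (signal theta) z) = theta]).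
have pE theta : (p theta)%:E = iid_law P n [set z | decode (observations (signal theta) z) = theta].
  have mobs : measurable [set z : n.-tuple T | decode (observations (signal theta) z) = theta].
    have := measurable_observations (n := n) (measurable_signal theta) measurableT (mdec theta).
    by rewrite setTI.
  by rewrite fineK//; exact: fin_num_measure.
pose theta0 : {ffun 'I_M -> bool} := [ffun=> true].
pose t := [arg min_(i < theta0) p i]%O.
have tmin i : p t <= p i by rewrite /t; case: Order.TotalTheory.arg_minP => // k _; apply.
exists t; rewrite -pE.
rewrite -(@lee_pmul2l _ (2 ^+ M)%:E) ?lte_fin ?exprn_gt0//.
apply: le_trans sumB; rewrite -EFinM.
under eq_bigr do rewrite -pE.
rewrite sumEFin lee_fin.
rewrite (_ : 2 ^+ M * p t = \sum_(theta : {ffun 'I_M -> bool}) p t).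
  exact: ler_sum.
rewrite sumr_const card_ffun card_bool card_ord -[RHS]mulr_natl.
by rewrite natrX.
Qed.

End decoding.

(** * Random design: bounding the mean of the envelopes *)

Lemma iid_exp_moment_le d (T : measurableType d) (R : realType)
    (P : probability T R) (k : T -> R) (B : R) n :
  measurable_fun setT k -> 0 <= B ->
  (\int[P]_p (expR (k p))%:E <= B%:E)%E ->
  (\int[iid_law P n]_z (expR (\sum_(p <- z) k p))%:E <= (B ^+ n)%:E)%E.
Proof.
move=> mk B0 PB.
have mE m : measurable_fun [set: m.-tuple T] (fun z : m.-tuple T => (expR (\sum_(p <- z) k p))%:E).
  apply/measurable_EFinP; apply: measurableT_comp => //.
  exact: measurable_tuple_sum.
have E0 m (z : m.-tuple T) : (0 <= (expR (\sum_(p <- z) k p))%:E)%E.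
  by rewrite lee_fin expR_ge0.
elim: n => [|n IH]; first by rewrite integral_iid_law0// big_nil expR0.
rewrite integral_iid_lawS//.
have mk1 : measurable_fun setT (fun p => (expR (k p))%:E).
  by apply/measurable_EFinP; exact: measurableT_comp.
apply: (@le_trans _ _ (\int[P]_p ((expR (k p))%:E * (B ^+ n)%:E))%E).
  apply: ge0_le_integral => //.
  - by move=> p _; exact: integral_ge0.
  - exact: (measurable_fun_fubini_tonelli_F (m2 := iid_law P n)
      (fun pz => (expR (\sum_(p <- [tuple of pz.1 :: pz.2]) k p))%:E)
      (measurableT_comp (mE n.+1) (@measurable_tuple_cons _ T n)) (fun pz => E0 _ _)).
  - exact: emeasurable_funM.
  move=> p _; under eq_integral do rewrite big_cons expRD EFinM.
  rewrite ge0_integralZl; [|exact: measurableT|exact: mE|by move=> z _; exact: E0|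
    by rewrite lee_fin expR_ge0].
  by apply: lee_wpmul2l => //; rewrite lee_fin expR_ge0.
rewrite ge0_integralZr//; last by rewrite lee_fin exprn_ge0.
by rewrite exprS EFinM; apply: lee_wpmul2r => //; rewrite lee_fin exprn_ge0.
Qed.

(** Since exp(- x) >= 1 - x, it suffices that (1 - x) (1 + x + 2 x^2) >= 1. *)
Lemma expR_le_quadratic (R : realType) (x : R) : 0 <= x -> x <= 2^-1 ->
  expR x <= 1 + x * (1 + 2 * x).
Proof.
move=> x0 x1.
have h1 : 1 - x <= expR (- x) by have := expR_ge1Dx (- x).
have h2 : expR x * expR (- x) = 1 by rewrite -expRD addrN expR0.
have h3 : expR x * (1 - x) <= 1.
  by apply: le_trans (ler_wpM2l (expR_ge0 x) h1) _; rewrite h2.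
have h4 : 1 <= (1 - x) * (1 + x * (1 + 2 * x)).
  have : 0 <= x ^+ 2 * (1 - 2 * x) by rewrite mulr_ge0 ?sqr_ge0//; lra.
  by lra.
rewrite -(@ler_pM2r _ (1 - x)); last by lra.
by apply: le_trans h3 _; rewrite mulrC.
Qed.

Section exponential_bound.
Context {R : realType} (PX : probability (measurableTypeR R) R) (sigma : R).
Hypothesis sigma_gt0 : 0 < sigma.
Local Notation T := (measurableTypeR R * measurableTypeR R)%type.
Local Notation P := (PX \x normal_prob 0 sigma)%E.

(** The envelope at u = 0 is 1 - exp(- (1 + v) / 2) / (2 sqrt(1 + v)). The
    bound ln(eta (1 + v)) <= eta (1 + v) - 1 turns the square root into an
    exponential, which costs a factor 1 + eta in the exponent, as near 1 as
    desired. *)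
Lemma envelope0_le (eta v : R) : 0 < eta -> eta <= 1 -> 0 <= v ->
  envelope 0 v <= expR (- (expR ((ln eta - 1) / 2) / 2 * expR (- ((1 + eta) / 2 * v)))).
Proof.
move=> e0 e1 v0.
apply: le_trans (expR_ge1Dx _).
rewrite /envelope oppr0 expR0 expr0n/= mul0r addr0.
suff : expR ((ln eta - 1) / 2) * expR (- ((1 + eta) / 2 * v)) <= expR (- (1 + v + ln (1 + v)) / 2).
  move: (expR _) (expR _) (expR _) => x y z; lra.
rewrite -expRD ler_expR.
have : ln (eta * (1 + v)) <= eta * (1 + v) - 1.
  have := @le_ln1Dx R (eta * (1 + v) - 1).
  rewrite (_ : 1 + (eta * (1 + v) - 1) = eta * (1 + v)); last lra.
  apply; have : 0 < eta * (1 + v) by rewrite mulr_gt0//; lra.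
  lra.
rewrite lnM ?posrE//; last lra.
lra.
Qed.

Context (M : nat) (f : 'I_M -> R -> R).
Hypothesis mf : forall j, measurable_fun setT (f j).

(** The energies of the bumps are random, and dependent through the design. By
    convexity, exp(- a v) is above its tangent at v = t, so the exponent given
    by envelope0_le is bounded by an affine function of the sum of the
    energies. This sum runs over the observations, and iid_exp_moment_le
    reduces its exponential moment to one observation, whose energy G x is at
    most delta: there exp(lam G) is at most 1 + lam (1 + 2 delta) G. The error
    due to 2 delta is absorbed by halving the constant, which is why the
    conclusion has / 4 where envelope0_le has / 2. *)
Lemma mean_prod_envelope_le n (eta t delta : R) :
  0 < eta -> eta <= 1 -> 0 <= t -> 0 <= delta -> delta <= 2^-1 -> 4 * delta * t <= 1 ->
  (forall x, \sum_j f j x ^+ 2 / sigma ^+ 2 <= delta) ->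
  (n%:R%:E * \int[PX]_x (\sum_j f j x ^+ 2 / sigma ^+ 2)%:E <= (M%:R * t)%:E)%E ->
  (\int[iid_law P n]_z (\prod_j envelope 0 (energy sigma (f j) z))%:E <=
   (expR (- (M%:R * (expR ((ln eta - 1) / 2) / 4) * expR (- ((1 + eta) / 2 * t)))))%:E)%E.
Proof.
move=> e0 e1 t0 d0 d12 dt Gd nG.
set c := expR ((ln eta - 1) / 2) / 2.
set a := (1 + eta) / 2.
pose G x := \sum_j f j x ^+ 2 / sigma ^+ 2.
(* The tangent at t of v |-> - c exp(- a v) has slope lam; the sum over the M
   bumps of its values at 0 is - K. *)
pose lam := c * a * expR (- (a * t)).
have G0 x : 0 <= G x by apply: sumr_ge0 => j _; rewrite divr_ge0 ?sqr_ge0.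
have mG : measurable_fun [set: measurableTypeR R] G.
  apply: measurable_sum => j.
  exact: (measurable_funM (measurable_funX 2 (mf j)) (measurable_cst _)).
have a0 : 0 < a by rewrite /a; lra.
have a1 : a <= 1 by rewrite /a; lra.
have c0 : 0 < c by rewrite divr_gt0 ?expR_gt0.
have c1 : c <= 1.
  have : expR ((ln eta - 1) / 2) <= 1.
    by rewrite -[leRHS]expR0 ler_expR; have := ln_le0 e1; lra.
  by rewrite /c; lra.
have ca0 : 0 <= c * a by rewrite mulr_ge0// ltW.
have lam0 : 0 <= lam by rewrite mulr_ge0 ?expR_ge0.
have et1 : expR (- (a * t)) <= 1.
  by rewrite -[leRHS]expR0 ler_expR oppr_le0 mulr_ge0// ltW.
have lam1 : lam <= 1.
  apply: mulr_ile1 => //.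
  by apply: mulr_ile1 => //; exact: ltW.
pose K := M%:R * c * expR (- (a * t)) * (1 + a * t).
have step1 (z : n.-tuple (R * R)) :
    \prod_j envelope 0 (energy sigma (f j) z) <=
    expR (- K) * expR (\sum_(p <- z) lam * G p.1).
  apply: (@le_trans _ _ (\prod_j expR (- (c * expR (- (a * energy sigma (f j) z)))))).
    apply: ler_prod => j _.
    by rewrite ltW ?envelope_gt0 ?energy_ge0//= envelope0_le// energy_ge0.
  rewrite -expR_sum -expRD ler_expR.
  have -> : \sum_(p <- z) lam * G p.1 = \sum_j lam * energy sigma (f j) z.
    under [RHS]eq_bigr do rewrite big_distrr/=.
    by rewrite exchange_big/=; apply: eq_bigr => p _; rewrite /G big_distrr.
  have -> : - K = \sum_(j < M) - (c * expR (- (a * t)) * (1 + a * t)).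
    by rewrite sumr_const card_ord -mulr_natl /K; lra.
  rewrite -big_split/=; apply: ler_sum => j _.
  set v := energy _ _ _.
  have : expR (- (a * v)) >= expR (- (a * t)) * (1 + (a * t - a * v)).
    rewrite (_ : expR (- (a * v)) = expR (- (a * t)) * expR (a * t - a * v)).
      by apply: ler_wpM2l; [exact: expR_ge0|exact: expR_ge1Dx].
    by rewrite -expRD; congr expR; lra.
  move=> h.
  have := ler_wpM2l (ltW c0) h; rewrite /lam.
  move: (expR (- (a * t))) (expR (- (a * v))) => x y; lra.
have EGd : (\int[PX]_x (G x)%:E <= delta%:E)%E.
  apply: (@le_trans _ _ (\int[PX]_x (cst delta%:E x))%E).
    by apply: ge0_le_integral => //; [move=> x _; rewrite lee_fin|exact/measurable_EFinP|
      move=> x _; rewrite lee_fin; exact: Gd].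
  by rewrite integral_cst//= probability_setT mule1.
have EG0 : (0 <= \int[PX]_x (G x)%:E)%E by apply: integral_ge0 => x _; rewrite lee_fin.
pose g := fine (\int[PX]_x (G x)%:E).
have gE : (\int[PX]_x (G x)%:E = g%:E)%E.
  by rewrite fineK// ge0_fin_numE// (le_lt_trans EGd)// ltry.
have g0 : 0 <= g by rewrite -lee_fin -gE.
have ng : n%:R * g <= M%:R * t by move: nG; rewrite -/(G _) gE -EFinM lee_fin.
pose b := lam * (1 + 2 * delta).
have b0 : 0 <= b by rewrite mulr_ge0//; lra.
have mGL : measurable_fun [set: measurableTypeR R] (fun x => (expR (lam * G x))%:E).
  apply/measurable_EFinP; apply: measurableT_comp => //.
  exact: (measurable_funM (measurable_cst _) mG).
have meanG : (\int[P]_p (expR (lam * G p.1))%:E <= (1 + b * g)%:E)%E.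
  have mL : measurable_fun [set: T] (fun p => (expR (lam * G p.1))%:E).
    exact: (measurableT_comp mGL measurable_fst).
  rewrite (design_noise_integral PX sigma mL); last by move=> p; rewrite lee_fin expR_ge0.
  apply: (@le_trans _ _ (\int[PX]_x (1%:E + b%:E * (G x)%:E))%E).
    have -> : (\int[PX]_x \int[normal_prob 0 sigma]_y (expR (lam * G (x, y).1))%:E =
        \int[PX]_x (expR (lam * G x))%:E)%E.
      by apply: eq_integral => x _ /=; rewrite integral_cst//= probability_setT mule1.
    have mbG : measurable_fun [set: measurableTypeR R] (fun x => 1%:E + b%:E * (G x)%:E)%E.
      apply: emeasurable_funD => //; apply: emeasurable_funM => //.
      exact/measurable_EFinP.
    apply: ge0_le_integral; first exact: measurableT.
    - by move=> x _; rewrite lee_fin expR_ge0.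
    - exact: mGL.
    - exact: mbG.
    move=> x _; rewrite -EFinM -EFinD lee_fin.
    have lG : lam * G x <= delta.
      by apply: le_trans (Gd x); rewrite -[leRHS]mul1r ler_wpM2r.
    have lG0 : 0 <= lam * G x by rewrite mulr_ge0.
    apply: le_trans (expR_le_quadratic lG0 (le_trans lG d12)) _.
    rewrite lerD2l /b (mulrAC lam (1 + 2 * delta)); apply: ler_wpM2l => //; lra.
  rewrite ge0_integralD//; [|by move=> x _; rewrite -EFinM lee_fin mulr_ge0|
    by apply: emeasurable_funM => //; exact/measurable_EFinP].
  rewrite integral_cst//= probability_setT mule1 ge0_integralZl//;
    [|exact/measurable_EFinP|by move=> x _; rewrite lee_fin].
  by rewrite gE -EFinM -EFinD.
have mGp : measurable_fun [set: T] (fun p => lam * G p.1).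
  exact: (measurable_funM (measurable_cst _) (measurableT_comp mG measurable_fst)).
have B0 : 0 <= 1 + b * g by rewrite addr_ge0// mulr_ge0.
have moment := @iid_exp_moment_le _ _ _ P (fun p => lam * G p.1) (1 + b * g) n mGp B0 meanG.
apply: (@le_trans _ _ (\int[iid_law P n]_z ((expR (- K))%:E *
    (expR (\sum_(p <- z) lam * G p.1))%:E))%E).
  apply: ge0_le_integral => //.
  - move=> z _; rewrite lee_fin; apply: prodr_ge0 => j _.
    by rewrite ltW// envelope_gt0// energy_ge0.
  - apply: measurable_prod_EFin => j; apply: measurable_envelope => //.
      exact: measurable_energy.
    by move=> z; exact: energy_ge0.
  - apply: emeasurable_funM => //; apply/measurable_EFinP.
    by apply: measurableT_comp => //; exact: measurable_tuple_sum.
  by move=> z _; rewrite -EFinM lee_fin; exact: step1.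
rewrite ge0_integralZl; [|exact: measurableT| |by move=> z _; rewrite lee_fin expR_ge0|
  by rewrite lee_fin expR_ge0]; last first.
  apply/measurable_EFinP; apply: measurableT_comp => //.
  exact: measurable_tuple_sum.
apply: (@le_trans _ _ ((expR (- K))%:E * ((1 + b * g) ^+ n)%:E)%E).
  by apply: lee_wpmul2l => //; rewrite lee_fin expR_ge0.
rewrite -EFinM lee_fin.
apply: (@le_trans _ _ (expR (- K) * expR (b * (M%:R * t)))).
  apply: ler_wpM2l; first exact: expR_ge0.
  apply: (@le_trans _ _ (expR (b * g) ^+ n)).
    by apply: lerXn2r; rewrite ?nnegrE ?expR_ge0//; exact: expR_ge1Dx.
  rewrite -expRM_natl ler_expR mulrCA; exact: ler_wpM2l.
rewrite -expRD ler_expR /K /b /lam -/a.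
have -> : expR ((ln eta - 1) / 2) / 4 = c / 2 by rewrite /c; lra.
set e := expR (- (a * t)).
have h1 : 4 * delta * t * a <= 1.
  by apply: mulr_ile1 => //; [rewrite !mulr_ge0|exact: ltW].
have h2 : 0 <= M%:R * c * e.
  by rewrite mulr_ge0 ?expR_ge0// mulr_ge0 ?ler0n// ltW.
have h3 : 0 <= (1 - 4 * delta * t * a) / 2 by lra.
have h := mulr_ge0 h3 h2.
rewrite -subr_ge0; apply: le_trans h _; rewrite le_eqVlt; apply/orP; left; apply/eqP.
by lra.
Qed.
End exponential_bound.

(** * Iterated derivatives on the line *)

Section derivatives.
Context {R : realType}.
Implicit Types (f g h : R -> R) (x y l : R).

Lemma dnbhs_normP (x : R) (P : R -> Prop) :
  (\forall y \near x^', P y) <->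
  (exists2 d, 0 < d & forall y, `|x - y| < d -> y != x -> P y).
Proof.
split.
  move/nbhs_ballP => [d /= d0 h]; exists d => // y xy; exact: h.
by move=> [d d0 h]; apply/nbhs_ballP; exists d => //= y xy; exact: h.
Qed.

Lemma is_derive_quotientP f x l : is_derive x 1 f l <->
  (f y - f x) / (y - x) @[y --> x^'] --> l.
Proof.
split.
  move=> [df <-]; apply/cvgrPdist_le => e e0.
  have /cvgrPdist_le/(_ _ e0)/dnbhs_normP[d d0 h] : h^-1 *: ((f \o shift x) (h *: 1) - f x) @[h --> 0^'] --> 'D_1 f x.
    exact: df.
  apply/dnbhs_normP; exists d => // y xy yx.
  have := h (y - x); rewrite sub0r normrN distrC subr_eq0 => /(_ xy yx).
  by rewrite /= /GRing.scale/= mulr1 subrK mulrC.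
move=> fl.
have cv : h^-1 *: ((f \o shift x) (h *: 1) - f x) @[h --> 0^'] --> l.
  apply/cvgrPdist_le => e e0.
  move/cvgrPdist_le: fl => /(_ _ e0)/dnbhs_normP[d d0 h].
  apply/dnbhs_normP; exists d => // y; rewrite sub0r normrN => y0 yn0.
  have := h (y + x); rewrite opprD addrCA subrr addr0 normrN addrK => /(_ y0).
  rewrite -subr_eq0 addrK => /(_ yn0).
  by rewrite /= /GRing.scale/= mulr1 mulrC.
apply: DeriveDef; first by apply/cvg_ex; exists l.
exact: cvg_lim.
Qed.

Definition derivative_of f g := forall x, is_derive x (1 : R) f (g x).

Fixpoint iter_derivative (k : nat) f g : Prop :=
  if k is k'.+1 then
    exists2 f1, derivative_of f f1 & iter_derivative k' f1 g
  else f = g.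

Lemma nth_derivative_within_setT k f g :
  nth_derivative_within setT k f g -> iter_derivative k f g.
Proof.
elim: k f => [|k IH] f /=.
  by move=> fg; apply/funext => x; apply: fg; rewrite inE.
move=> [f1 ff1 /IH f1g]; exists f1 => // x; apply/is_derive_quotientP.
by have := ff1 x I; rewrite withinET.
Qed.

Lemma iter_derivative_within D k f g :
  iter_derivative k f g -> nth_derivative_within D k f g.
Proof.
elim: k f => [|k IH] f /=; first by move=> -> x.
move=> [f1 ff1 /IH f1g]; exists f1 => // x Dx.
have /is_derive_quotientP := ff1 x.
apply: cvg_trans; exact: (cvg_app _ (cvg_within _)).
Qed.

Lemma derivative_of_continuous f g : derivative_of f g -> continuous f.
Proof.
move=> fg x; apply/differentiable_continuous/derivable1_diffP.
by have [] := fg x.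
Qed.

Lemma derivative_of_MVT f g x y : derivative_of f g -> x < y ->
  exists2 c, x < c < y & f y - f x = g c * (y - x).
Proof.
move=> fg xy; have [|c cxy h] := @MVT R f g x y xy (fun z _ => fg z).
  exact/continuous_subspaceT/(derivative_of_continuous fg).
by exists c => //; move: cxy; rewrite in_itv.
Qed.

Lemma derivative_of_lipschitz f g B x y : derivative_of f g ->
  (forall z, `|g z| <= B) -> `|f x - f y| <= B * `|x - y|.
Proof.
move=> fg gB; wlog xy : x y / x < y.
  move=> h; have [xy|yx|->] := ltgtP x y; first exact: h.
    by rewrite distrC (distrC x); exact: h.
  by rewrite !subrr normr0 mulr0.
rewrite distrC (distrC x); have [c _ ->] := derivative_of_MVT fg xy.
by rewrite normrM ler_wpM2r.
Qed.

Lemma derivative_ofD f f' g g' : derivative_of f f' -> derivative_of g g' ->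
  derivative_of (fun x => f x + g x) (fun x => f' x + g' x).
Proof. by move=> ff' gg' x; exact: is_deriveD. Qed.

Lemma derivative_ofM f f' g g' : derivative_of f f' -> derivative_of g g' ->
  derivative_of (fun x => f x * g x) (fun x => f' x * g x + f x * g' x).
Proof.
move=> ff' gg' x; have := is_deriveM (ff' x) (gg' x).
by rewrite /GRing.scale/= addrC (mulrC (g x)).
Qed.

Lemma derivative_ofZ (c : R) f f' : derivative_of f f' ->
  derivative_of (fun x => c * f x) (fun x => c * f' x).
Proof. by move=> ff' x; exact: is_deriveZ. Qed.

Lemma derivative_of_affine (a b : R) f f' : derivative_of f f' ->
  derivative_of (fun x => f ((x - a) / b)) (fun x => f' ((x - a) / b) / b).
Proof.
move=> ff' x; apply: (@is_derive1_comp _ f (fun x => (x - a) / b)) => //.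
have := @is_deriveZ R _ _ (fun x => x - a) b^-1 x 1 1.
rewrite /GRing.scale/= mulr1.
have -> : (b^-1 \*: (fun x => x - a) = fun x => (x - a) / b)%R.
  by apply/funext => z /=; rewrite mulrC.
apply; exact: is_derive_shift.
Qed.

Lemma derivative_of_unique f g g' : derivative_of f g -> derivative_of f g' -> g = g'.
Proof.
by move=> fg fg'; apply/funext => x; have [_ <-] := fg x; have [_ <-] := fg' x.
Qed.

Lemma iter_derivative_unique k f g g' :
  iter_derivative k f g -> iter_derivative k f g' -> g = g'.
Proof.
elim: k f => [|k IH] f /=; first by move=> <- <-.
move=> [f1 ff1 f1g] [f2 ff2 f2g]; apply: (IH f1) => //.
by rewrite (derivative_of_unique ff1 ff2).
Qed.

Lemma iter_derivativeD k f f' g g' : iter_derivative k f f' -> iter_derivative k g g' ->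
  iter_derivative k (fun x => f x + g x) (fun x => f' x + g' x).
Proof.
elim: k f g => [|k IH] f g /=; first by move=> -> ->.
move=> [f1 ff1 f1f'] [g1 gg1 g1g']; exists (fun x => f1 x + g1 x); last exact: IH.
exact: derivative_ofD.
Qed.

Lemma iter_derivativeZ k (c : R) f f' : iter_derivative k f f' ->
  iter_derivative k (fun x => c * f x) (fun x => c * f' x).
Proof.
elim: k f => [|k IH] f /=; first by move=> ->.
move=> [f1 ff1 f1f']; exists (fun x => c * f1 x); last exact: IH.
exact: derivative_ofZ.
Qed.

Lemma iter_derivative_affine k (a b : R) f f' : iter_derivative k f f' ->
  iter_derivative k (fun x => f ((x - a) / b)) (fun x => f' ((x - a) / b) / b ^+ k).
Proof.
elim: k f => [|k IH] f /=; first by move=> ->; apply/funext => x; rewrite expr0 divr1.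
move=> [f1 ff1 f1f']; exists (fun x => f1 ((x - a) / b) / b).
  exact: derivative_of_affine.
have := iter_derivativeZ b^-1 (IH _ f1f').
set F := (fun x => _ * _); set G := (fun x => _ * _).
rewrite (_ : F = fun x => f1 ((x - a) / b) / b); last first.
  by apply/funext => x; rewrite /F mulrC.
rewrite (_ : G = fun x => f' ((x - a) / b) / b ^+ k.+1) //.
by apply/funext => x; rewrite /G exprS invfM mulrA mulrAC mulrC.
Qed.

Lemma iter_derivative0 k : iter_derivative k (fun=> 0) (fun=> 0 : R).
Proof. by elim: k => [//|k IH]; exists (fun=> 0) => // x; exact: is_derive_cst. Qed.

Lemma iter_derivative_sum k n (f f' : 'I_n -> R -> R) :
  (forall i, iter_derivative k (f i) (f' i)) ->
  iter_derivative k (fun x => \sum_i f i x) (fun x => \sum_i f' i x).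
Proof.
elim: n f f' => [|n IH] f f' ff'.
  under eq_fun do rewrite big_ord0.
  under [X in iter_derivative _ _ X]eq_fun do rewrite big_ord0.
  exact: iter_derivative0.
under eq_fun do rewrite big_ord_recl.
under [X in iter_derivative _ _ X]eq_fun do rewrite big_ord_recl.
by apply: iter_derivativeD => //; apply: IH.
Qed.

(** A derivative vanishes wherever the function vanishes in a neighbourhood,
    and the complement of a ball is open. *)
Lemma iter_derivative_eq0 k f g (B : R) : iter_derivative k f g ->
  (forall x, B < `|x| -> f x = 0) -> forall x, B < `|x| -> g x = 0.
Proof.
elim: k f => [|k IH] f /=; first by move=> <-.
move=> [f1 ff1 f1g] f0; apply: (IH f1) => // x Bx.
have ff0 : is_derive x (1 : R) f 0.
  apply: (near_eq_is_derive _ (is_derive_cst (0 : R) x 1)).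
  have : \forall y \near x, B < `|y|.
    apply: (@cvgr_gt _ _ (nbhs x) _ (fun y => `|y|) `|x|) => //.
    exact: norm_continuous.
  by apply: filterS => y /f0 ->.
by have [_ <-] := ff1 x; have [_ ->] := ff0.
Qed.

End derivatives.

(** * Functions bounded together with their derivatives *)

Section smooth_bound.
Context {R : realType} (alpha : R).
Hypotheses (alpha_gt0 : 0 < alpha) (alpha_le1 : alpha <= 1).
Implicit Types (f g : R -> R) (B x y : R).

(** A single constant bounds f, its derivatives up to order k, and the Hoelder
    constant of the last one, so that sums, products and dilations are each
    governed by one inequality between constants. *)
Fixpoint smooth_bound (k : nat) B f : Prop :=
  (forall x, `|f x| <= B) /\
  if k is k'.+1 then exists2 f', derivative_of f f' & smooth_bound k' B f'
  else forall x y, `|f x - f y| <= B * `|x - y| `^ alpha.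

Lemma smooth_bound_sup k B f x : smooth_bound k B f -> `|f x| <= B.
Proof. by case: k => [|k] []. Qed.

Lemma smooth_bound_ge0 k B f : smooth_bound k B f -> 0 <= B.
Proof. by move=> /(smooth_bound_sup 0); apply: le_trans. Qed.

Lemma one_powR (a : R) : 1 `^ a = 1.
Proof. by rewrite powR1. Qed.

Lemma le_powR_of_le1 (d t : R) : 0 <= t -> d <= 1 -> d <= t -> d <= t `^ alpha.
Proof.
move=> t0 d1 dt; have [t1|t1] := leP 1 t.
  apply: le_trans d1 _; rewrite -[leLHS](one_powR alpha).
  by apply: ge0_ler_powR; rewrite ?nnegrE// ltW.
apply: le_trans dt _; have [->|tn0] := eqVneq t 0; first by rewrite powR_ge0.
rewrite -[leLHS]powRr1//; apply: ger_powR => //.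
by rewrite lt_neqAle eq_sym tn0 t0/= ltW.
Qed.

Lemma smooth_boundW k B B' f : B <= B' -> smooth_bound k B f -> smooth_bound k B' f.
Proof.
move=> BB'; elim: k f => [|k IH] f /= [fB].
  move=> h; split=> [x|x y]; first exact: le_trans BB'.
  by apply: le_trans (h x y) _; rewrite ler_wpM2r ?powR_ge0.
move=> [f' ff' f'B]; split=> [x|]; first exact: le_trans BB'.
by exists f' => //; exact: IH.
Qed.

(** Interpolation between the oscillation and the Lipschitz constant: min(1,
    t) <= t^alpha. *)
Lemma bounded_lipschitz_hoelder f B C : (forall x y, `|f x - f y| <= B) ->
  (forall x y, `|f x - f y| <= C * B * `|x - y|) -> 0 < B -> 0 <= C ->
  forall x y, `|f x - f y| <= B * C `^ alpha * `|x - y| `^ alpha.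
Proof.
move=> fB fC B0 C0 x y; rewrite -mulrA -powRM//.
rewrite -ler_pdivrMl//; apply: le_powR_of_le1; first by rewrite mulr_ge0.
  by rewrite ler_pdivrMl// mulr1.
by rewrite ler_pdivrMl// mulrA (mulrC B); exact: fC.
Qed.

(** A bounded derivative makes the function Lipschitz continuous, hence
    Hoelder continuous because it is bounded. *)
Lemma smooth_bound_pred k B f : smooth_bound k.+1 B f -> smooth_bound k (2 * B) f.
Proof.
elim: k f => [|k IH] f [fB [f' ff' f'B]]; have B0 : 0 <= B := le_trans (normr_ge0 _) (fB 0).
  split=> [x|x y].
    by apply: le_trans (fB x) _; lra.
  have [B00|Bn0] := eqVneq B 0.
    have f0 z : f z = 0 by apply/eqP; rewrite -normr_le0 -B00.
    by rewrite !f0 subrr normr0 mulr_ge0 ?powR_ge0// mulr_ge0.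
  have Bgt0 : 0 < B by rewrite lt_neqAle eq_sym Bn0.
  have := @bounded_lipschitz_hoelder f (2 * B) 2^-1 _ _ _ _ x y.
  have h12 : 2^-1 `^ alpha <= 1 :> R.
    have i2 : 2^-1 <= 1 :> R by rewrite invf_le1// ler1n.
    rewrite -[leRHS](one_powR alpha).
    apply: ge0_ler_powR; rewrite ?nnegrE//; exact: ltW.
  move=> h; apply: le_trans (h _ _ _ _) _; rewrite ?mulr_gt0// ?invr_ge0//.
  - by move=> u v; apply: le_trans (ler_normB _ _) _; have := fB u; have := fB v; lra.
  - move=> u v; rewrite mulKf//; apply: derivative_of_lipschitz ff' _ => z.
    by case: f'B => + _; apply.
  rewrite ler_wpM2r ?powR_ge0//; rewrite -[leRHS]mulr1 ler_wpM2l//; lra.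
split=> [x|]; first by apply: le_trans (fB x) _; lra.
by exists f' => //; exact: IH.
Qed.

Lemma smooth_boundD k B B' f g : smooth_bound k B f -> smooth_bound k B' g ->
  smooth_bound k (B + B') (fun x => f x + g x).
Proof.
elim: k f g => [|k IH] f g /= [fB hf] [gB hg]; split.
- by move=> x; apply: le_trans (ler_normD _ _) _; exact: lerD.
- move=> x y; rewrite opprD addrACA; apply: le_trans (ler_normD _ _) _.
  by rewrite mulrDl; exact: lerD.
- by move=> x; apply: le_trans (ler_normD _ _) _; exact: lerD.
case: hf hg => [f' ff' f'B] [g' gg' g'B].
by exists (fun x => f' x + g' x); [exact: derivative_ofD|exact: IH].
Qed.

Lemma smooth_boundZ k (c : R) B f : smooth_bound k B f ->
  smooth_bound k (`|c| * B) (fun x => c * f x).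
Proof.
elim: k f => [|k IH] f /= [fB hf]; split.
- by move=> x; rewrite normrM ler_wpM2l.
- by move=> x y; rewrite -mulrBr normrM -mulrA ler_wpM2l.
- by move=> x; rewrite normrM ler_wpM2l.
case: hf => [f' ff' f'B].
by exists (fun x => c * f' x); [exact: derivative_ofZ|exact: IH].
Qed.

(** The Leibniz rule; in each term smooth_bound_pred lets the factor that is
    not differentiated lose one order. *)
Lemma smooth_boundM k : exists2 C, 0 < C & forall B B' f g,
  smooth_bound k B f -> smooth_bound k B' g ->
  smooth_bound k (C * (B * B')) (fun x => f x * g x).
Proof.
elim: k => [|k [C C0 IH]].
  exists 2 => // B B' f g hf hg.
  have B0 := smooth_bound_ge0 hf; have B'0 := smooth_bound_ge0 hg.
  have BB' : 0 <= B * B' by rewrite mulr_ge0.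
  case: hf hg => [fB hf] [gB hg]; split.
    move=> x; rewrite normrM; apply: (@le_trans _ _ (B * B')); first exact: ler_pM.
    by lra.
  move=> x y; have -> : f x * g x - f y * g y = f x * (g x - g y) + (f x - f y) * g y by lra.
  apply: le_trans (ler_normD _ _) _; rewrite !normrM.
  have h1 : `|f x| * `|g x - g y| <= B * (B' * `|x - y| `^ alpha) by apply: ler_pM.
  have h2 : `|f x - f y| * `|g y| <= (B * `|x - y| `^ alpha) * B' by apply: ler_pM.
  by apply: le_trans (lerD h1 h2) _; lra.
(* Two products, in each of which one constant was doubled by
   smooth_bound_pred. *)
exists (1 + 4 * C); first by lra.
move=> B B' f g hf hg.
have B0 := smooth_bound_ge0 hf; have B'0 := smooth_bound_ge0 hg.
have BB' : 0 <= B * B' by rewrite mulr_ge0.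
have CB : 0 <= C * (B * B') by rewrite mulr_ge0// ltW.
have hf2 := smooth_bound_pred hf; have hg2 := smooth_bound_pred hg.
have [fB [f' ff' f'B]] := hf; have [gB [g' gg' g'B]] := hg; split.
  move=> x; rewrite normrM; apply: (@le_trans _ _ (B * B')); first exact: ler_pM.
  by lra.
exists (fun x => f' x * g x + f x * g' x); first exact: derivative_ofM.
have := smooth_boundD (IH _ _ _ _ f'B hg2) (IH _ _ _ _ hf2 g'B).
by apply: smooth_boundW; lra.
Qed.

Lemma smooth_bound_scale k B f (m : R) : 1 <= m -> smooth_bound k B f ->
  smooth_bound k B (fun x => f (x / m)).
Proof.
move=> m1; have m0 : 0 < m := lt_le_trans ltr01 m1.
have mV1 : m^-1 <= 1 by rewrite invf_le1.
have mV0 : 0 <= m^-1 by rewrite invr_ge0 ltW.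
elim: k f => [|k IH] f hf; have B0 := smooth_bound_ge0 hf; case: hf => [fB hf]; split => //.
  move=> x y; apply: le_trans (hf _ _) _; rewrite ler_wpM2l//.
  rewrite -mulrBl normrM (ger0_norm mV0); apply: ge0_ler_powR; rewrite ?nnegrE ?mulr_ge0//.
    exact: ltW.
  by rewrite -[leRHS]mulr1 ler_wpM2l.
case: hf => f' ff' f'B; exists (fun x => f' (x / m) / m).
  by have := derivative_of_affine 0 m ff'; under eq_fun do rewrite subr0;
     under [X in derivative_of _ X]eq_fun do rewrite subr0.
have := smooth_boundZ m^-1 (IH _ f'B).
under eq_fun do rewrite mulrC.
by apply: smooth_boundW; rewrite (ger0_norm mV0) -[leRHS]mul1r ler_wpM2r.
Qed.

Lemma smooth_bound_iter k B f : smooth_bound k B f ->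
  exists2 g, iter_derivative k f g & smooth_bound 0 B g.
Proof.
elim: k f => [|k IH] f hf; first by exists f.
by case: hf => _ [f' ff' /IH[g f'g gB]]; exists g => //; exists f'.
Qed.

(** In the Leibniz formula for the k-th derivative of f * chi, every term but
    g * chi contains a derivative of chi, and these are at most eta. *)
Lemma iter_derivative_cutoff k : exists2 C, 0 < C & forall B eta f g chi chi',
  iter_derivative k f g -> smooth_bound k B f ->
  (forall x, `|chi x| <= 1) -> derivative_of chi chi' -> smooth_bound k eta chi' ->
  exists2 r, iter_derivative k (fun x => f x * chi x) (fun x => g x * chi x + r x) &
    smooth_bound 0 (C * (B * eta)) r.
Proof.
elim: k => [|k [C C0 IH]].
  exists 1 => // B eta f g chi chi' fg fB c1 cc' c'e; exists (fun=> 0).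
    by rewrite -fg; apply/funext => x; rewrite addr0.
  have h : 0 <= 1 * (B * eta).
    by rewrite mul1r mulr_ge0// ?(smooth_bound_ge0 fB)// (smooth_bound_ge0 c'e).
  by split=> [x|x y]; rewrite ?subrr normr0// mulr_ge0// powR_ge0.
have [D D0 hM] := smooth_boundM k.
exists (2 * C + 4 * D); first by lra.
move=> B eta f g chi chi' [f1 ff1 f1g] hf c1 cc' hc.
have B0 := smooth_bound_ge0 hf; have eta0 := smooth_bound_ge0 hc.
have Be : 0 <= B * eta by rewrite mulr_ge0.
have hf2 := smooth_bound_pred hf; have hc2 := smooth_bound_pred hc.
case: hf => fB [f1' ff1' f1B].
have E := derivative_of_unique ff1 ff1'; subst f1'.
have [r1 f1r r1B] := IH _ _ _ _ _ _ f1g f1B c1 cc' hc2.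
have [r2 fr2 r2B] := smooth_bound_iter (hM _ _ _ _ hf2 hc2).
exists (fun x => r1 x + r2 x).
  exists (fun x => f1 x * chi x + f x * chi' x); first exact: derivative_ofM.
  have := iter_derivativeD f1r fr2.
  by under [X in iter_derivative _ _ X]eq_fun do rewrite -addrA.
have := smooth_boundD r1B r2B; apply: smooth_boundW.
have : 0 <= C * (B * eta) by rewrite mulr_ge0// ltW.
by lra.
Qed.

End smooth_bound.

(** * Cut-off functions *)

Section cutoffs.
Context {R : realType}.
Implicit Types (x t : R).

(** The exponent is at least 2, so that the difference quotients at the corner
    0 tend to 0. *)
Lemma derivative_of_pos_pow m :
  derivative_of (fun t => Num.max t 0 ^+ m.+2 : R)
    (fun t => m.+2%:R * Num.max t 0 ^+ m.+1).
Proof.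
move=> t; have [t0|t0|t0] := ltgtP t 0.
- rewrite expr0n/= mulr0.
  apply: (near_eq_is_derive _ (is_derive_cst (0 : R) t 1)).
  have : \forall y \near t, y < 0 by exact: lt_nbhsl.
  by apply: filterS => y y0 /=; rewrite max_r ?(ltW y0)// expr0n.
- have h := is_deriveX m.+2 (is_derive_id t (1 : R)).
  rewrite /GRing.scale/= mulr1 in h.
  apply: (near_eq_is_derive _ h).
  have : \forall y \near t, 0 < y by exact: lt_nbhsr.
  by apply: filterS => y y0 /=; rewrite max_l ?(ltW y0)// exprfctE.
apply/is_derive_quotientP; rewrite t0 maxxx !expr0n/= mulr0.
apply/cvgrPdist_le => e e0; apply/dnbhs_normP.
exists (Num.min 1 e); first by rewrite lt_min ltr01.
move=> y; rewrite sub0r normrN lt_min => /andP[y1 ye] y0.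
rewrite !subr0 sub0r normrN normrM normfV ler_pdivrMr ?normr_gt0//.
rewrite normrX.
have h : `|Num.max y 0| <= `|y|.
  by case: (leP y 0) => // _; rewrite normr0.
apply: (@le_trans _ _ (`|y| ^+ m.+2)); first by apply: lerXn2r; rewrite ?nnegrE.
rewrite 2!exprS mulrA; apply: (@le_trans _ _ (`|y| * `|y| * 1)).
  by rewrite ler_wpM2l ?mulr_ge0// exprn_ile1// ltW.
by rewrite mulr1 ler_wpM2r// ltW.
Qed.

(** This function has only m - 1 continuous derivatives, but they are
    combinations of the same functions with smaller m and of their products by
    x, so that smooth_bound_cutoff is a plain induction. *)
Definition cutoff m x : R := Num.max (1 - x ^+ 2) 0 ^+ m.

Lemma cutoff0 m : cutoff m 0 = 1.
Proof. by rewrite /cutoff expr0n subr0 max_l ?expr1n. Qed.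

Lemma cutoff_ge0 m x : 0 <= cutoff m x.
Proof. by rewrite exprn_ge0// le_max lexx orbT. Qed.

Lemma cutoff_le1 m x : cutoff m x <= 1.
Proof.
rewrite exprn_ile1// ?le_max ?lexx ?orbT// ge_max ler01 andbT.
by have := sqr_ge0 x; lra.
Qed.

Lemma cutoff_out m x : 1 <= `|x| -> cutoff m.+1 x = 0.
Proof.
move=> x1; rewrite /cutoff max_r ?expr0n//.
by rewrite subr_le0 -[leLHS](expr1n _ 2) -[x ^+ 2]real_normK ?num_real// lerXn2r ?nnegrE.
Qed.

(** Eliminates x^2 from the derivative of x * cutoff m x. *)
Lemma cutoff_sqr m x : x ^+ 2 * cutoff m.+1 x = cutoff m.+1 x - cutoff m.+2 x.
Proof.
rewrite /cutoff (exprS _ m.+1); set t := Num.max _ _.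
have [h|h] := leP 0 (1 - x ^+ 2).
  have -> : t = 1 - x ^+ 2 by rewrite /t max_l.
  by move: (_ ^+ m.+1) => T; lra.
have -> : t = 0 by rewrite /t max_r// ltW.
by rewrite expr0n/= !mulr0 subr0.
Qed.

Lemma derivative_of_cutoff m :
  derivative_of (cutoff m.+2) (fun x => - (2 * m.+2%:R) * (x * cutoff m.+1 x)).
Proof.
move=> x.
have h : is_derive x (1 : R) (fun z : R => 1 - z ^+ 2) (- (2 * x)).
  have h1 := is_deriveX 2 (is_derive_id x (1 : R)).
  rewrite /GRing.scale/= mulr1 expr1 in h1.
  by have := is_deriveB (is_derive_cst (1 : R) x 1) h1; rewrite sub0r exprfctE.
have := @is_derive1_comp R _ (fun z : R => 1 - z ^+ 2) x _ _ (derivative_of_pos_pow m (1 - x ^+ 2)) h.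
move=> hh; apply: (is_derive_eq (f := cutoff m.+2) hh); rewrite /cutoff.
by move: (_ ^+ m.+1) => T; lra.
Qed.

Lemma derivative_of_id_cutoff m :
  derivative_of (fun x => x * cutoff m.+2 x)
    (fun x => (1 + 2 * m.+2%:R) * cutoff m.+2 x - 2 * m.+2%:R * cutoff m.+1 x).
Proof.
have h := derivative_ofM (f := id) (fun x => is_derive_id x (1 : R)) (derivative_of_cutoff m).
move=> x; apply: (is_derive_eq (f := fun x => x * cutoff m.+2 x) (h x)); rewrite mul1r.
have := cutoff_sqr m x; set a := cutoff _ _; set b := cutoff _ _ => ab.
have -> : x * (- (2 * m.+2%:R) * (x * a)) = - (2 * m.+2%:R) * (x ^+ 2 * a) by lra.
by rewrite ab; lra.
Qed.

Lemma norm_cutoff_le1 m x : `|cutoff m x| <= 1.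
Proof. by rewrite ger0_norm ?cutoff_ge0// cutoff_le1. Qed.

Lemma norm_id_cutoff_le1 m x : `|x * cutoff m.+1 x| <= 1.
Proof.
rewrite normrM; have [x1|x1] := leP 1 `|x|.
  by rewrite cutoff_out// normr0 mulr0.
by rewrite -[leRHS]mulr1 ler_pM// ?norm_cutoff_le1// ltW.
Qed.

Context (alpha : R).
Hypotheses (alpha_gt0 : 0 < alpha) (alpha_le1 : alpha <= 1).

(** The derivatives of cutoff m and of x * cutoff m are linear combinations of
    functions of the same two kinds, with m or m - 1 in place of m; the
    induction therefore treats both kinds together. *)
Lemma smooth_bound_cutoff k m : (k.+2 <= m)%N -> exists B,
  smooth_bound alpha k B (cutoff m) /\ smooth_bound alpha k B (fun x => x * cutoff m x).
Proof.
elim: k m => [|k IH] [|[|m]]//.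
  move=> _; pose C : R := 1 + 4 * m.+2%:R.
  have C0 : 0 <= C by rewrite /C; have := ler0n R m.+2; lra.
  have hol (f : R -> R) : (forall x, `|f x| <= 1) -> (forall x y, `|f x - f y| <= C * `|x - y|) ->
      smooth_bound alpha 0 (1 + 2 * (C / 2) `^ alpha) f.
    move=> f1 fC; split=> [x|x y].
      by apply: le_trans (f1 x) _; have := powR_ge0 (C / 2) alpha; lra.
    have := @bounded_lipschitz_hoelder _ _ alpha_gt0 alpha_le1 f 2 (C / 2) _ _ _ _ x y.
    move=> h; apply: le_trans (h _ _ _ _) _ => //; last 1 first.
    - by rewrite ler_wpM2r ?powR_ge0//; lra.
    - by move=> u v; apply: le_trans (ler_normB _ _) _; have := f1 u; have := f1 v; lra.
    - by move=> u v; rewrite divfK//; exact: fC.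
    - by rewrite divr_ge0.
  exists (1 + 2 * (C / 2) `^ alpha); split; apply: hol.
  - exact: norm_cutoff_le1.
  - move=> x y; apply: derivative_of_lipschitz (derivative_of_cutoff m) _ => z.
    have m0 : 0 <= 2 * m.+2%:R :> R by rewrite mulr_ge0.
    rewrite normrM normrN (ger0_norm m0).
    apply: le_trans (ler_wpM2l m0 (norm_id_cutoff_le1 m z)) _.
    by rewrite /C; have := ler0n R m.+2; lra.
  - exact: norm_id_cutoff_le1.
  - move=> x y; apply: derivative_of_lipschitz (derivative_of_id_cutoff m) _ => z.
    have m0 := ler0n R m.+2.
    have c0 : 0 <= 1 + 2 * m.+2%:R :> R by lra.
    have c1 : 0 <= 2 * m.+2%:R :> R by lra.
    apply: le_trans (ler_normB _ _) _; rewrite (normrM (1 + 2 * m.+2%:R)) (normrM (2 * m.+2%:R)).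
    rewrite (ger0_norm c0) (ger0_norm c1).
    have h1 := ler_wpM2l c0 (norm_cutoff_le1 m.+2 z).
    have h2 := ler_wpM2l c1 (norm_cutoff_le1 m.+1 z).
    by apply: le_trans (lerD h1 h2) _; rewrite /C; lra.
rewrite ltnS => km; have [B1 [b1 ib1]] := IH m.+1 km.
have [B2 [b2 ib2]] := IH m.+2 (leqW km).
pose c1 : R := - (2 * m.+2%:R); pose c2 : R := 1 + 2 * m.+2%:R.
pose B := 1 + `|c1| * B1 + (`|c2| * B2 + `|c1| * B1).
have B10 := smooth_bound_ge0 b1; have B20 := smooth_bound_ge0 b2.
have p1 : 0 <= `|c1| * B1 by rewrite mulr_ge0.
have p2 : 0 <= `|c2| * B2 by rewrite mulr_ge0.
exists B; split; split.
- by move=> x; apply: le_trans (norm_cutoff_le1 _ _) _; rewrite /B; lra.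
- exists (fun x => c1 * (x * cutoff m.+1 x)); first exact: derivative_of_cutoff.
  by apply: smooth_boundW (smooth_boundZ c1 ib1); rewrite /B; lra.
- by move=> x; apply: le_trans (norm_id_cutoff_le1 _ _) _; rewrite /B; lra.
- exists (fun x => c2 * cutoff m.+2 x + c1 * cutoff m.+1 x).
    by move=> x; apply: (is_derive_eq (derivative_of_id_cutoff m x)); rewrite /c1 mulNr.
  by apply: smooth_boundW (smooth_boundD (smooth_boundZ c2 b2) (smooth_boundZ c1 b1)); rewrite /B; lra.
Qed.

End cutoffs.

(** * Boundedness of the derivatives of a square integrable function *)

Section interpolation.
Context {R : realType}.

(** The trace of square integrability that passes on to derivatives. *)
Definition often_small (C l : R) (f : R -> R) :=
  forall x, exists2 y, x <= y <= x + l & `|f y| <= C.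

(** The mean value theorem between two points at distance at least l where f
    is at most C. *)
Lemma often_small_derivative C l (f f' : R -> R) : 0 < l ->
  derivative_of f f' -> often_small C l f -> often_small (2 * C / l) (3 * l) f'.
Proof.
move=> l0 ff' hf x.
have [y1 /andP[xy1 y1l] fy1] := hf x.
have [y2 /andP[xy2 y2l] fy2] := hf (x + 2 * l).
have y12 : l <= y2 - y1 by lra.
have [c /andP[cy1 cy2] fc] := derivative_of_MVT ff' (ltac:(lra) : y1 < y2).
exists c; first by apply/andP; split; lra.
have y120 : 0 < y2 - y1 by lra.
have : `|f' c| * (y2 - y1) <= 2 * C.
  have := congr1 Num.norm fc; rewrite normrM (gtr0_norm y120) => <-.
  by apply: le_trans (ler_normB _ _) _; lra.
rewrite ler_pdivlMr//; apply: le_trans.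
by rewrite ler_wpM2l.
Qed.

(** Descending induction on the order of the derivative: the k-th one is
    bounded because it is often small and Hoelder continuous, and each of the
    others because it is often small and its derivative is bounded. *)
Lemma smooth_bound_of_often_small alpha k C l (f g : R -> R) : 0 < alpha ->
  0 < l -> 0 <= C -> often_small C l f -> iter_derivative k f g ->
  (forall x y, `|g x - g y| <= `|x - y| `^ alpha) ->
  exists B, smooth_bound alpha k B f.
Proof.
move=> a0; elim: k C l f => [|k IH] C l f l0 C0 hf /=.
  move=> <- fa; exists (1 + C + l `^ alpha).
  have la := powR_ge0 l alpha.
  split=> [x|x y].
    have [y /andP[xy yl] fy] := hf x.
    have -> : f x = (f x - f y) + f y by lra.
    apply: le_trans (ler_normD _ _) _.
    suff : `|f x - f y| <= l `^ alpha by lra.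
    apply: le_trans (fa _ _) _; apply: ge0_ler_powR; rewrite ?nnegrE ?(ltW a0) ?(ltW l0)//.
    by rewrite distrC ger0_norm; lra.
  apply: le_trans (fa x y) _; rewrite -[leLHS]mul1r ler_wpM2r ?powR_ge0//; lra.
move=> [f1 ff1 f1g] ga.
have [||B f1B] := IH _ _ f1 _ _ (often_small_derivative l0 ff1 hf) f1g ga.
- by rewrite mulr_gt0.
- by rewrite divr_ge0 ?mulr_ge0// ltW.
have B0 := smooth_bound_ge0 f1B.
have Bl : 0 <= B * l by rewrite mulr_ge0// ltW.
exists (B + C + B * l); split; last first.
  by exists f1 => //; apply: smooth_boundW f1B; lra.
move=> x; have [y /andP[xy yl] fy] := hf x.
have -> : f x = (f x - f y) + f y by lra.
apply: le_trans (ler_normD _ _) _.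
suff : `|f x - f y| <= B * l by lra.
apply: le_trans (derivative_of_lipschitz x y ff1 (fun z => smooth_bound_sup z f1B)) _.
by rewrite ler_wpM2l// distrC ger0_norm; lra.
Qed.

End interpolation.

(** * Compactly supported near-maximisers *)

Section localized.
Context {R : realType}.
Implicit Types (f g phi psi : R -> R) (s alpha : R).

Lemma hoelder_continuous alpha C f : 0 < alpha ->
  (forall x y, `|f x - f y| <= C * `|x - y| `^ alpha) -> continuous f.
Proof.
move=> a0 hf x; apply/cvgrPdist_le => e e0.
have C1 : 0 < `|C| + 1 by rewrite ltr_wpDl.
have d0 : 0 < (e / (`|C| + 1)) `^ alpha^-1 by rewrite powR_gt0// divr_gt0.
apply/nbhs_ballP; exists ((e / (`|C| + 1)) `^ alpha^-1) => //= y /= xy.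
apply: le_trans (hf x y) _.
apply: (@le_trans _ _ ((`|C| + 1) * `|x - y| `^ alpha)).
  by rewrite ler_wpM2r ?powR_ge0// (le_trans (ler_norm C))// lerDl.
rewrite -ler_pdivlMl// mulrC.
have -> : e / (`|C| + 1) = ((e / (`|C| + 1)) `^ alpha^-1) `^ alpha.
  by rewrite -powRrM mulVf ?gt_eqF// powRr1// divr_ge0 ?ltW.
apply: ge0_ler_powR; rewrite ?nnegrE ?(ltW a0) ?(ltW d0)//.
exact: ltW.
Qed.

Lemma iter_derivative_continuous alpha C k f g : 0 < alpha -> iter_derivative k f g ->
  (forall x y, `|g x - g y| <= C * `|x - y| `^ alpha) -> continuous f.
Proof.
move=> a0; case: k => [|k] /=; first by move=> ->; exact: hoelder_continuous.
by move=> [f1 ff1 _] _; exact: derivative_of_continuous ff1.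
Qed.

Lemma integral_sqr_le1 phi :
  ('N[lebesgue_measure]_2%:E[EFin \o phi] <= 1)%E ->
  (\int[lebesgue_measure]_x (phi x ^+ 2)%:E <= 1)%E.
Proof.
move=> N1; set I := (\int[_]_x _)%E.
have -> : I = ('N[lebesgue_measure]_2%:E[EFin \o phi] `^ 2)%E.
  rewrite poweR_Lnorm//; apply: eq_integral => x _ /=.
  by rewrite ?poweR_EFin powR_mulrn// real_normK ?num_real.
have <- : (1%:E `^ 2 = 1 :> \bar R)%E by rewrite poweR_EFin powR1.
apply: gt0_ler_poweR => //; rewrite in_itv/= ?leey ?andbT//.
exact: Lnorm_ge0.
Qed.

(** If |phi| > 2 on an interval of length 1, the integral of its square is at
    least 4. *)
Lemma often_small_of_integral_sqr phi : continuous phi ->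
  (\int[lebesgue_measure]_x (phi x ^+ 2)%:E <= 1)%E -> often_small 2 1 phi.
Proof.
move=> cphi I1 x; apply: contrapT => h.
have phi2 y : x <= y <= x + 1 -> 2 <= `|phi y|.
  move=> xy; rewrite leNgt; apply/negP => h2; apply: h; exists y => //; exact: ltW.
have mphi : measurable_fun setT (fun x : R => (phi x ^+ 2)%:E).
  apply/measurable_EFinP; apply: measurable_funX; exact: continuous_measurable_fun.
have : (\int[lebesgue_measure]_(y in `[x, (x + 1)%R]) cst 4%:E y <=
    \int[lebesgue_measure]_y (phi y ^+ 2)%:E)%E.
  apply: (@le_trans _ _ (\int[lebesgue_measure]_(y in `[x, (x + 1)%R]) (phi y ^+ 2)%:E)%E).
    apply: ge0_le_integral; first by [].
    - by move=> y _; rewrite lee_fin.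
    - exact: measurable_cst.
    - exact: (measurable_funTS mphi).
    move=> y /=; rewrite in_itv/= => /phi2 hy; rewrite lee_fin.
    rewrite -real_normK ?num_real// expr2.
    by have := ler_pM (ler0n R 2) (ler0n R 2) hy hy; lra.
  apply: ge0_subset_integral => //= y _; rewrite lee_fin sqr_ge0//.
rewrite integral_cst//= lebesgue_measure_itv/= lte_fin ltrDl ltr01.
rewrite -EFinD addrAC subrr add0r mule1 => /le_trans /(_ I1).
by rewrite lee_fin; lra.
Qed.

(** The product of phi by a slowly varying cut-off chi has compact support, no
    larger norm and the same value at 0. By smooth_bound_of_often_small, phi
    has bounded derivatives, so the Hoelder constant of its k-th derivative g
    increases by at most delta: g * chi contributes delta / 2 because chi
    varies slowly, and the remainder r of iter_derivative_cutoff contributes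
    delta / 2. Division by 1 + delta restores the Hoelder constant 1, and (1 -
    delta) (1 + delta) <= 1. *)
Lemma localized_recovery s phi delta : 0 < s -> recovery_admissible s phi ->
  0 <= phi 0 -> 0 < delta -> delta < 1 ->
  exists psi psik : R -> R, exists B M : R, [/\ 0 < M, 0 <= B,
    iter_derivative (hoelder_order s) psi psik,
    (forall x y, `|psik x - psik y| <= `|x - y| `^ (s - (hoelder_order s)%:R)) &
    (forall x, `|psi x| <= B) /\ (forall x, `|psik x| <= B)] /\
   [/\ (forall x, M < `|x| -> psi x = 0), continuous psi,
    (\int[lebesgue_measure]_x (psi x ^+ 2)%:E <= 1)%E &
    (1 - delta) * phi 0 <= psi 0].
Proof.
move=> s0 [[g phig ghol] phi1] phi0 d0 d1.
have /andP[ks sk] := hoelder_orderP s0.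
move: phig ghol ks sk; set k := hoelder_order s; set alpha := s - k%:R.
move=> /nth_derivative_within_setT phig ghol ks sk.
have a0 : 0 < alpha by rewrite subr_gt0.
have a1 : alpha <= 1 by rewrite lerBlDr nat1r.
have gh x y : `|g x - g y| <= 1 * `|x - y| `^ alpha by exact: ghol.
have gh1 x y : `|g x - g y| <= `|x - y| `^ alpha by rewrite -[leRHS]mul1r.
have cphi := iter_derivative_continuous a0 phig gh.
have I1 := integral_sqr_le1 phi1.
have [B phiB] := smooth_bound_of_often_small a0 ltr01 (ler0n _ 2)
  (often_small_of_integral_sqr cphi I1) phig gh1.
have B0 := smooth_bound_ge0 phiB.
have [C C0 hC] := iter_derivative_cutoff a0 a1 k.
have [E [chiE _]] := smooth_bound_cutoff a0 a1 (leqnn k.+3).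
have E0 := smooth_bound_ge0 chiE.
have E1 : E <= E + 1 by lra.
have [_ [chi' cc' chi'E]] := smooth_boundW E1 chiE.
(* A bound on the derivatives of chi: at most E + 1 so that the dilation
   factor M below is at least 1, the other two so that the terms g * chi and r
   contribute at most delta / 2 each. *)
pose eta := Num.min (E + 1) (Num.min ((delta / (2 * (B + 1))) `^ alpha^-1) (delta / (2 * (C * B + 1)))).
have CB0 : 0 <= C * B by rewrite mulr_ge0// ltW.
have eta0 : 0 < eta.
  by rewrite !lt_min powR_gt0 ?divr_gt0 ?mulr_gt0//; lra.
have etaE : eta <= E + 1 by rewrite ge_min lexx.
have eta1 : eta <= (delta / (2 * (B + 1))) `^ alpha^-1 by rewrite !ge_min lexx orbT.
have eta2 : eta <= delta / (2 * (C * B + 1)) by rewrite !ge_min lexx !orbT.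
have etaa : B * eta `^ alpha <= delta / 2.
  have h : eta `^ alpha <= delta / (2 * (B + 1)).
    have h0 : 0 <= delta / (2 * (B + 1)) by rewrite divr_ge0 ?mulr_ge0//; lra.
    have -> : delta / (2 * (B + 1)) = ((delta / (2 * (B + 1))) `^ alpha^-1) `^ alpha.
      by rewrite -powRrM mulVf ?gt_eqF// powRr1.
    by apply: ge0_ler_powR; rewrite ?nnegrE ?powR_ge0 ?(ltW a0) ?(ltW eta0).
  apply: le_trans (ler_wpM2l B0 h) _.
  rewrite mulrA ler_pdivrMr; last by rewrite mulr_gt0//; lra.
  by have := mulr_ge0 B0 (ltW d0); lra.
have etaC : C * (B * eta) <= delta / 2.
  rewrite mulrA; apply: le_trans (ler_wpM2l CB0 eta2) _.
  rewrite mulrA ler_pdivrMr; last by rewrite mulr_gt0//; lra.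
  by have := mulr_ge0 CB0 (ltW d0); lra.
pose M := (E + 1) / eta.
have M1 : 1 <= M by rewrite ler_pdivlMr// mul1r.
have M0 : 0 < M := lt_le_trans ltr01 M1.
pose chi x := cutoff k.+3 (x / M).
pose dchi x := M^-1 * chi' (x / M).
have chidchi : derivative_of chi dchi.
  have := derivative_of_affine 0 M cc'.
  under eq_fun do rewrite subr0.
  by under [X in derivative_of _ X]eq_fun do rewrite subr0 mulrC.
have dchieta : smooth_bound alpha k eta dchi.
  have := smooth_boundZ M^-1 (smooth_bound_scale a0 M1 chi'E).
  apply: smooth_boundW.
  by rewrite gtr0_norm ?invr_gt0// /M invfM invrK mulrAC mulVf ?mul1r// gt_eqF//; lra.
have chi1 x : `|chi x| <= 1 by exact: norm_cutoff_le1.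
have [r phichi rB] := hC _ _ _ _ _ _ phig phiB chi1 chidchi dchieta.
have [gB _] : smooth_bound alpha 0 B g.
  have [g' phig' g'B] := smooth_bound_iter phiB.
  by rewrite (iter_derivative_unique phig phig').
have chihol x y : `|chi x - chi y| <= eta `^ alpha * `|x - y| `^ alpha.
  rewrite -[X in X * _]mul1r; apply: bounded_lipschitz_hoelder => //; last exact: ltW.
    move=> u v; rewrite ler_norml; have := cutoff_ge0 k.+3 (u / M); have := cutoff_ge0 k.+3 (v / M).
    have := cutoff_le1 k.+3 (u / M); have := cutoff_le1 k.+3 (v / M).
    by rewrite -/(chi u) -/(chi v) => *; apply/andP; split; lra.
  move=> u v; rewrite mulr1; apply: derivative_of_lipschitz chidchi _ => z.
  exact: smooth_bound_sup dchieta.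
have d10 : 0 < 1 + delta by lra.
have dV1 : (1 + delta)^-1 <= 1 by rewrite invf_le1//; lra.
have dV0 : 0 <= (1 + delta)^-1 by rewrite invr_ge0 ltW.
have [rB1 rB2] := rB.
have CBe0 : 0 <= C * (B * eta) by rewrite (smooth_bound_ge0 rB).
have contract c x : 0 <= c -> `|x| <= c -> `|(1 + delta)^-1 * x| <= c.
  move=> c0 xc; rewrite normrM (ger0_norm dV0); apply: le_trans xc.
  by rewrite -[leRHS]mul1r ler_wpM2r.
exists (fun x => (1 + delta)^-1 * (phi x * chi x)).
exists (fun x => (1 + delta)^-1 * (g x * chi x + r x)), (B + 1), M.
split; split => //.
- by lra.
- exact: iter_derivativeZ.
- move=> x y; rewrite -mulrBr normrM (ger0_norm dV0) ler_pdivrMl//.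
  have -> : g x * chi x + r x - (g y * chi y + r y) =
     (g x - g y) * chi x + g y * (chi x - chi y) + (r x - r y) by lra.
  set p := `|x - y| `^ alpha; have p0 : 0 <= p by exact: powR_ge0.
  have h1 : `|(g x - g y) * chi x| <= p.
    by rewrite normrM -[leRHS]mulr1 ler_pM// ?gh1.
  have h2 : `|g y * (chi x - chi y)| <= delta / 2 * p.
    rewrite normrM; apply: (@le_trans _ _ (B * (eta `^ alpha * p))); first by rewrite ler_pM.
    by rewrite mulrA ler_wpM2r.
  have h3 : `|r x - r y| <= delta / 2 * p.
    by apply: le_trans (rB2 x y) _; rewrite ler_wpM2r.
  apply: le_trans (ler_normD _ _) _.
  by have := ler_normD ((g x - g y) * chi x) (g y * (chi x - chi y)); lra.
- split=> x; apply: contract; rewrite ?addr_ge0//.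
    rewrite normrM; apply: (@le_trans _ _ (B * 1)).
      by rewrite ler_pM//; exact: smooth_bound_sup phiB.
    by lra.
  apply: le_trans (ler_normD _ _) _; rewrite normrM.
  have h1 : `|g x| * `|chi x| <= B * 1 by rewrite ler_pM.
  by have := rB1 x; lra.
- move=> x Mx; rewrite /chi cutoff_out ?mulr0//.
  by rewrite normrM normfV (gtr0_norm M0) ler_pdivlMr// mul1r ltW.
- move=> x; apply: cvgM; first exact: cvg_cst.
  by apply: cvgM; [exact: cphi|exact: derivative_of_continuous chidchi x].
- apply: le_trans I1; apply: ge0_le_integral => //.
  + by move=> x _; rewrite lee_fin sqr_ge0.
  + apply/measurable_EFinP; apply: measurable_funX.
    apply: measurable_funM => //; apply: measurable_funM; apply: continuous_measurable_fun => //.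
    exact: derivative_of_continuous chidchi.
  + apply/measurable_EFinP; apply: measurable_funX.
    exact: continuous_measurable_fun.
  + move=> x _; rewrite lee_fin -real_normK ?num_real// -[leRHS]real_normK ?num_real//.
    rewrite lerXn2r ?nnegrE//; apply: contract => //.
    by rewrite normrM -[leRHS]mulr1 ler_wpM2l.
rewrite /chi mul0r cutoff0 mulr1 ler_pdivlMl// mulrA -[leRHS]mul1r ler_wpM2r//.
by have := sqr_ge0 delta; lra.
Qed.

End localized.

(** * Signed sums of disjoint bumps *)

Lemma sum_unique_nonzero (R : realType) M (F : 'I_M -> R) i :
  (forall j, j != i -> F j = 0) -> \sum_j F j = F i.
Proof. by move=> F0; rewrite (bigD1 i)//= big1 ?addr0. Qed.

Section bumps.
Context {R : realType}.
Variables (psi psik : R -> R) (k : nat) (s B S K L h a : R).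
Local Notation alpha := (s - k%:R).
Hypotheses (alpha_gt0 : 0 < alpha) (B_ge0 : 0 <= B) (S_gt0 : 0 < S) (SK : S < K)
  (L_gt0 : 0 < L) (h_gt0 : 0 < h).
Hypotheses (psi_psik : iter_derivative k psi psik)
  (psik_hoelder : forall x y, `|psik x - psik y| <= `|x - y| `^ alpha)
  (psi_le : forall x, `|psi x| <= B) (psik_le : forall x, `|psik x| <= B)
  (psi_supp : forall x, S < `|x| -> psi x = 0)
  (gap : 2 * B <= (2 * (K - S)) `^ alpha).

Definition centre (j : nat) : R := a + (2 * j%:R + 1) * (K * h).

(** The factor L * h `^ s turns a function of the Hoelder class of order s and
    constant 1 into one of constant L. *)
Definition scaled_bump (j : nat) (x : R) : R := L * h `^ s * psi ((x - centre j) / h).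

Let K_gt0 : 0 < K. Proof. exact: lt_trans SK. Qed.

Lemma centre_separated (i j : nat) : i != j -> 2 * (K * h) <= `|centre i - centre j|.
Proof.
wlog ij : i j / (i < j)%N.
  move=> hw nij; have [ij|ji] := ltnP i j; first exact: (hw _ _ ij nij).
  rewrite distrC; apply: hw; last by rewrite eq_sym.
  by rewrite ltn_neqAle eq_sym nij.
move=> _; rewrite distrC.
have -> : centre j - centre i = 2 * (K * h) * (j%:R - i%:R) by rewrite /centre; lra.
have c0 : 0 < 2 * (K * h) by rewrite !mulr_gt0.
rewrite normrM (gtr0_norm c0) -[leLHS]mulr1; apply: (ler_wpM2l (ltW c0)).
by rewrite -natrB ?(ltnW ij)// normr_nat ler1n subn_gt0.
Qed.

Lemma near_centre_unique (i j : nat) x y : i != j ->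
  `|x - centre i| <= S * h -> `|y - centre j| <= S * h -> 2 * (K - S) * h <= `|x - y|.
Proof.
move=> ij xi yj; have := centre_separated ij.
have -> : centre i - centre j = (x - y) - (x - centre i) + (y - centre j) by lra.
move=> hc; have := le_trans hc (ler_normD _ _).
have := ler_normB (x - y) (x - centre i); lra.
Qed.

Lemma far_centre_eq0 (f : R -> R) j x : (forall x, S < `|x| -> f x = 0) ->
  S * h < `|x - centre j| -> f ((x - centre j) / h) = 0.
Proof.
move=> f0 xj; apply: f0.
by rewrite normrM normfV (gtr0_norm h_gt0) ltr_pdivlMr.
Qed.

Lemma near_of_neq0 (f : R -> R) j x : (forall x, S < `|x| -> f x = 0) ->
  f ((x - centre j) / h) != 0 -> `|x - centre j| <= S * h.
Proof.
by move=> f0; apply: contra_neqT; rewrite -ltNge; exact: far_centre_eq0.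
Qed.

Lemma other_centre_far i j x : j != i -> `|x - centre i| <= S * h ->
  S * h < `|x - centre j|.
Proof.
move=> ji xi; rewrite ltNge; apply/negP => xj.
have := near_centre_unique ji xj xi; rewrite subrr normr0.
have : 0 < 2 * (K - S) * h by rewrite !mulr_gt0// subr_gt0.
by lra.
Qed.

Lemma scaled_bump_disjoint i j x : i != j -> scaled_bump i x != 0 -> scaled_bump j x = 0.
Proof.
move=> ij; rewrite mulf_eq0 negb_or => /andP[_ /(near_of_neq0 psi_supp) xi].
rewrite /scaled_bump (far_centre_eq0 psi_supp) ?mulr0//.
by apply: other_centre_far xi; rewrite eq_sym.
Qed.

Let psik_supp x : S < `|x| -> psik x = 0.
Proof. exact: iter_derivative_eq0 psi_psik psi_supp x. Qed.

Variables (M : nat) (eps : 'I_M -> R).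
Hypothesis eps1 : forall j, `|eps j| = 1.

Lemma bump_sum_le (f : R -> R) x : (forall x, `|f x| <= B) -> (forall x, S < `|x| -> f x = 0) ->
  `|\sum_j eps j * f ((x - centre j) / h)| <= B.
Proof.
move=> fB f0.
have [[i xi]|nx] := pselect (exists i : 'I_M, `|x - centre i| <= S * h).
  rewrite (@sum_unique_nonzero _ _ _ i).
    by rewrite normrM eps1 mul1r.
  by move=> j ji; rewrite (far_centre_eq0 f0) ?mulr0//; exact: other_centre_far xi.
rewrite big1 ?normr0// => j _; rewrite (far_centre_eq0 f0) ?mulr0//.
by rewrite ltNge; apply/negP => xj; apply: nx; exists j.
Qed.

(** If x and y are near the same centre, the two sums reduce to the same bump.
    If they are near different centres, their distance is at least 2 (K - S)
    h, and the Hoelder bound allows a difference as large as 2 B. *)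
Lemma bump_sum_hoelder x y :
  `|\sum_j eps j * psik ((x - centre j) / h) - \sum_j eps j * psik ((y - centre j) / h)|
  <= (`|x - y| / h) `^ alpha.
Proof.
have single (i : 'I_M) : (forall j : 'I_M, j != i -> S * h < `|x - centre j|) ->
    (forall j : 'I_M, j != i -> S * h < `|y - centre j|) ->
    `|\sum_j eps j * psik ((x - centre j) / h) - \sum_j eps j * psik ((y - centre j) / h)|
    <= (`|x - y| / h) `^ alpha.
  move=> fx fy; rewrite !(@sum_unique_nonzero _ _ _ i); first last.
  - by move=> j ji; rewrite (far_centre_eq0 psik_supp) ?mulr0//; exact: fx.
  - by move=> j ji; rewrite (far_centre_eq0 psik_supp) ?mulr0//; exact: fy.
  rewrite -mulrBr normrM eps1 mul1r.
  have := psik_hoelder ((x - centre i) / h) ((y - centre i) / h).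
  by rewrite -mulrBl opprB addrA subrK normrM normfV (gtr0_norm h_gt0).
have nearP z : (exists2 i : 'I_M, `|z - centre i| <= S * h &
      forall j : 'I_M, j != i -> S * h < `|z - centre j|)
    \/ (forall j : 'I_M, S * h < `|z - centre j|).
  have [[i zi]|nz] := pselect (exists i : 'I_M, `|z - centre i| <= S * h).
    by left; exists i => // j ji; exact: other_centre_far zi.
  by right=> j; rewrite ltNge; apply/negP => zj; apply: nz; exists j.
have [[i xi fx]|fx] := nearP x; have [[j yj fy]|fy] := nearP y.
- have [ij|ij] := eqVneq i j; first by subst j; exact: single fx fy.
  apply: (@le_trans _ _ (2 * B)).
    apply: le_trans (ler_normB _ _) _.
    by have := bump_sum_le x psik_le psik_supp; have := bump_sum_le y psik_le psik_supp; lra.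
  apply: le_trans gap _; apply: ge0_ler_powR; rewrite ?nnegrE ?(ltW alpha_gt0)//.
  + by rewrite mulr_ge0// subr_ge0 ltW.
  + by rewrite divr_ge0// ltW.
  + by rewrite ler_pdivlMr//; exact: near_centre_unique ij xi yj.
- by apply: (single i) => // j _; exact: fy.
- by apply: (single j) => // i _; exact: fx.
rewrite !big1 ?subrr ?normr0 ?powR_ge0//.
- by move=> j _; rewrite (far_centre_eq0 psik_supp) ?mulr0.
- by move=> j _; rewrite (far_centre_eq0 psik_supp) ?mulr0.
Qed.

(** Homogeneity reduces the claim to bump_sum_hoelder. *)
Lemma bump_signal_hoelder : hoelder_order s = k ->
  hoelder_class `[0, 1] s L (fun x => \sum_j eps j * scaled_bump j x).
Proof.
move=> sk; rewrite /hoelder_class/= sk.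
have hk : h `^ s / h ^+ k = h `^ alpha.
  have := @powRB R h s k%:R; rewrite (gt_eqF h_gt0) implybT => ->//.
  by rewrite powR_mulrn// ltW.
exists (fun x => \sum_j (eps j * (L * h `^ s) * (psik ((x - centre j) / h) / h ^+ k))).
  apply: iter_derivative_within.
  have -> : (fun x => \sum_j eps j * scaled_bump j x) =
      (fun x => \sum_j eps j * (L * h `^ s) * psi ((x - centre j) / h)).
    by apply/funext => x; apply: eq_bigr => j _; rewrite /scaled_bump mulrA.
  apply: (@iter_derivative_sum R k M
    (fun j x => eps j * (L * h `^ s) * psi ((x - centre j) / h))
    (fun j x => eps j * (L * h `^ s) * (psik ((x - centre j) / h) / h ^+ k))) => i.
  by apply: iter_derivativeZ; exact: iter_derivative_affine.
move=> x y _ _.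
have sumE z : \sum_j (eps j * (L * h `^ s) * (psik ((z - centre j) / h) / h ^+ k)) =
   L * h `^ alpha * \sum_j eps j * psik ((z - centre j) / h).
  rewrite -hk big_distrr/=; apply: eq_bigr => j _.
  by move: (eps j) (psik _) (h ^+ k)^-1 (h `^ s) => e p r t; lra.
rewrite !sumE -mulrBr normrM ger0_norm ?mulr_ge0 ?powR_ge0 ?(ltW L_gt0)//.
rewrite -mulrA ler_wpM2l ?(ltW L_gt0)//.
apply: le_trans (ler_wpM2l (powR_ge0 _ _) (bump_sum_hoelder x y)) _.
by rewrite -powRM ?divr_ge0 ?(ltW h_gt0)// mulrC divfK ?gt_eqF.
Qed.

Lemma bump_signal_le x : `|\sum_j eps j * scaled_bump j x| <= L * h `^ s * B.
Proof.
have -> : \sum_j eps j * scaled_bump j x = L * h `^ s * \sum_j eps j * psi ((x - centre j) / h).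
  by rewrite big_distrr/=; apply: eq_bigr => j _; rewrite /scaled_bump mulrCA.
have Lh : 0 <= L * h `^ s by rewrite mulr_ge0 ?powR_ge0// ltW.
by rewrite normrM (ger0_norm Lh) ler_wpM2l// bump_sum_le.
Qed.

Lemma sum_sqr_scaled_bump_le x : \sum_(j < M) scaled_bump j x ^+ 2 <= (L * h `^ s * B) ^+ 2.
Proof.
have Lh : 0 <= L * h `^ s by rewrite mulr_ge0 ?powR_ge0// ltW.
have one j : scaled_bump j x ^+ 2 <= (L * h `^ s * B) ^+ 2.
  have e : `|scaled_bump j x| <= L * h `^ s * B.
    by rewrite normrM (ger0_norm Lh) ler_wpM2l.
  rewrite -real_normK ?num_real//; apply: lerXn2r => //.
  by rewrite nnegrE mulr_ge0.
have [[i xi]|nx] := pselect (exists i : 'I_M, scaled_bump i x != 0).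
  rewrite (@sum_unique_nonzero _ _ _ i)// => j ji.
  by rewrite (scaled_bump_disjoint _ xi) ?expr0n// eq_sym.
rewrite big1 ?sqr_ge0// => j _.
have -> : scaled_bump j x = 0 by apply/eqP; apply: contrapT => /negP xj; apply: nx; exists j.
by rewrite expr0n.
Qed.

Lemma scaled_bump_support j x : scaled_bump j x != 0 -> `|x - centre j| <= S * h.
Proof. by rewrite mulf_eq0 negb_or => /andP[_ /(near_of_neq0 psi_supp)]. Qed.

Lemma scaled_bump_centre j : scaled_bump j (centre j) = L * h `^ s * psi 0.
Proof. by rewrite /scaled_bump subrr mul0r. Qed.

Lemma integral_sqr_scaled_bump j : continuous psi ->
  (\int[lebesgue_measure]_x (psi x ^+ 2)%:E <= 1)%E ->
  (\int[lebesgue_measure]_x (scaled_bump j x ^+ 2)%:E <= ((L * h `^ s) ^+ 2 * h)%:E)%E.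
Proof.
move=> cpsi I1.
have mpsi : measurable_fun setT (fun x : R => (psi x ^+ 2)%:E).
  by apply/measurable_EFinP; apply: measurable_funX; exact: continuous_measurable_fun.
have mG : measurable_fun setT (fun x : R => ((L * h `^ s) ^+ 2)%:E * (psi x ^+ 2)%:E)%E.
  exact: emeasurable_funM.
have -> : (\int[lebesgue_measure]_x (scaled_bump j x ^+ 2)%:E =
    h%:E * \int[lebesgue_measure]_x (((L * h `^ s) ^+ 2)%:E * (psi x ^+ 2)%:E))%E.
  rewrite -(@ge0_integral_affine _ _ (centre j) h h_gt0 mG); last first.
    by move=> x; rewrite -EFinM lee_fin mulr_ge0 ?sqr_ge0.
  by apply: eq_integral => x _; rewrite -EFinM -exprMn.
rewrite ge0_integralZl; [|exact: measurableT|exact: mpsi|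
  by move=> x _; rewrite lee_fin sqr_ge0|by rewrite lee_fin sqr_ge0].
rewrite muleA -EFinM mulrC.
rewrite -[leRHS]mule1; apply: lee_wpmul2l => //.
by rewrite lee_fin mulr_ge0 ?sqr_ge0// ltW.
Qed.

End bumps.

(** * The density of the design *)

Section design_density.
Context {R : realType} (PX : probability (measurableTypeR R) R) (mu : R -> R).
Hypothesis PX_mu : has_density_on01 PX mu.
Variables (nu rho q : R).
Hypotheses (nu_gt0 : 0 < nu)
  (mu_hoelder : forall x y, `[0, 1]%classic x -> `[0, 1]%classic y ->
     `|mu x - mu y| <= rho * `|x - y| `^ nu)
  (q_gt0 : 0 < q) (mu_ge : forall x, x \in `[0, 1] -> q <= mu x).

(** The retraction of the line to [0, 1]: the density is controlled on [0,
    1] only, and its composition with the retraction is continuous on the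
    line. *)
Definition clamp01 (x : R) : R := Num.max 0 (Num.min x 1).

Lemma clamp01_in x : `[0, 1]%classic (clamp01 x).
Proof. by rewrite /= in_itv/= /clamp01 le_max lexx/= ge_max ler01/= ge_min lexx orbT. Qed.

Lemma clamp01_id x : `[0, 1]%classic x -> clamp01 x = x.
Proof. by rewrite /= in_itv/= /clamp01 => /andP[x0 x1]; rewrite min_l// max_r. Qed.

Lemma clamp01_lipschitz x y : `|clamp01 x - clamp01 y| <= `|x - y|.
Proof.
wlog xy : x y / x <= y.
  move=> hw; have [xy|yx] := leP x y; first exact: hw.
  by rewrite distrC (distrC x); apply: hw; exact: ltW.
rewrite distrC (distrC x) [leRHS]ger0_norm ?subr_ge0// /clamp01.
have clampE (z : R) : (z <= 0 /\ Num.max 0 (Num.min z 1) = 0) \/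
    (0 <= z <= 1 /\ Num.max 0 (Num.min z 1) = z) \/ (1 <= z /\ Num.max 0 (Num.min z 1) = 1).
  have [z1|z1] := leP z 1; last by right; right; split; [exact: ltW|rewrite max_r].
  have [z0|z0] := leP 0 z; first by right; left.
  by left; split => //; exact: ltW.
by rewrite ler_norml; case: (clampE x) => [[? ->]|[[/andP[? ?] ->]|[? ->]]];
  case: (clampE y) => [[? ->]|[[/andP[? ?] ->]|[? ->]]]; apply/andP; split; lra.
Qed.

Lemma measurable_density :
  measurable_fun setT (fun x => mu (clamp01 x) * \1_(`[0, 1]%classic : set R) x).
Proof.
apply: measurable_funM; last by apply: measurable_indic.
apply: continuous_measurable_fun; apply: (@hoelder_continuous _ nu `|rho|) => // x y.
apply: le_trans (mu_hoelder (clamp01_in x) (clamp01_in y)) _.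
apply: (@le_trans _ _ (`|rho| * `|clamp01 x - clamp01 y| `^ nu)).
  by rewrite ler_wpM2r ?powR_ge0// ler_norm.
rewrite ler_wpM2l//; apply: ge0_ler_powR; rewrite ?nnegrE ?(ltW nu_gt0)//.
exact: clamp01_lipschitz.
Qed.

Lemma design_integral_le (F : R -> \bar R) (m1 : R) : 0 <= m1 ->
  measurable_fun setT F -> (forall x, 0 <= F x)%E ->
  (forall x, F x != 0%E -> mu (clamp01 x) <= m1) ->
  (\int[PX]_x F x <= m1%:E * \int[lebesgue_measure]_x F x)%E.
Proof.
move=> m10 mF F0 Fm.
pose p x := mu (clamp01 x) * \1_(`[0, 1]%classic : set R) x.
have mup x : 0 <= mu (clamp01 x).
  apply: le_trans (ltW q_gt0) (mu_ge _); exact: clamp01_in.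
have p0 x : 0 <= p x by rewrite mulr_ge0.
have pE A : measurable A -> PX A = (\int[lebesgue_measure]_(x in A) (p x)%:E)%E.
  move=> mA; rewrite (PX_mu mA) integral_mkcondr; apply: eq_integral => x _.
  rewrite patchE /p indicE; case: ifPn => xI; last by rewrite mulr0.
  by rewrite mulr1 clamp01_id//; exact: set_mem.
rewrite (@ge0_integral_density _ _ _ lebesgue_measure PX p F measurable_density p0 pE mF F0).
rewrite -ge0_integralZl//; apply: ge0_le_integral => //.
- by move=> x _; rewrite mule_ge0// lee_fin.
- by apply: emeasurable_funM => //; apply/measurable_EFinP; exact: measurable_density.
- exact: emeasurable_funM.
move=> x _; rewrite muleC; have [->|Fx] := eqVneq (F x) 0%E; first by rewrite !mule0.
apply: lee_wpmul2r => //; rewrite lee_fin /p indicE.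
case: (x \in _); last by rewrite mulr0.
by rewrite mulr1; exact: Fm.
Qed.

End design_density.

(** * From decoding to the minimax risk *)

(** Comparison of lower integrals, valid without measurability; a supremum of
    errors over an interval need not be a measurable function of the
    observations. *)
Lemma ge0_le_integral_lower d (T : measurableType d) (R : realType)
    (m : {measure set T -> \bar R}) (f g : T -> \bar R) :
  (forall x, 0 <= f x)%E -> (forall x, f x <= g x)%E ->
  (\int[m]_x f x <= \int[m]_x g x)%E.
Proof.
move=> f0 fg; have g0 x : (0 <= g x)%E by exact: le_trans (fg x).
rewrite !ge0_integralTE//; apply: ereal_sup_le => _ [h /= hf <-].
by exists h => //= x; exact: le_trans (fg x).
Qed.

Section loss.
Context {R : realType} (w : R -> R).
Hypotheses (w_ge0 : forall x, 0 <= w x) (w_nondecreasing : {homo w : x y / x <= y}).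

Lemma loss_ge0 y : (0 <= loss w y)%E.
Proof.
case: y => [r| |] /=; rewrite ?lee_fin//.
apply: (@le_trans _ _ (w 0)%:E); first by rewrite lee_fin.
by apply: ereal_sup_ubound; exists 0.
Qed.

Lemma loss_ge c y : (c%:E <= y)%E -> ((w c)%:E <= loss w y)%E.
Proof.
case: y => [r| |] //=; first by rewrite !lee_fin; exact: w_nondecreasing.
by move=> _; apply: ereal_sup_ubound; exists c.
Qed.

End loss.

Section risk.
Context {R : realType} (PX : probability (measurableTypeR R) R) (sigma : R).
Hypothesis sigma_gt0 : 0 < sigma.
Local Notation T := (measurableTypeR R * measurableTypeR R)%type.

(** Decode the sign at x j as that of fhat at x j. When the decoded signs
    differ from theta, then at some x j the estimator and the signal are on
    different sides of 0, the error is at least amp >= c * rate, and the loss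
    at least w c. By decoding_bound, for some theta this happens with
    probability at least 1 - beta. *)
Lemma minimax_risk_ge (w : R -> R) (s L Q : R) (mu : R -> R) (I : interval R) (n M : nat)
    (f : 'I_M -> R -> R) (x : 'I_M -> R) (amp c beta : R) :
  (forall x, 0 <= w x) -> {homo w : x y / x <= y} ->
  (forall j, measurable_fun setT (f j)) ->
  (forall i j x, i != j -> f i x != 0 -> f j x = 0) ->
  (forall theta, bounded_hoelder_class `[0, 1] s L Q (signal f theta)) ->
  (forall j, [set` I] (x j)) -> (forall j, `[0, 1]%classic (x j)) ->
  (forall j, f j (x j) = amp) -> (forall i j, i != j -> f i (x j) = 0) ->
  (forall j, 0 < rate s mu n (x j)) -> (forall j, c * rate s mu n (x j) <= amp) ->
  (\int[iid_law (PX \x normal_prob 0 sigma)%E n]_z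
     (\prod_j envelope 0 (energy sigma (f j) z))%:E <= beta%:E)%E ->
  ((w c * (1 - beta))%:E <= minimax_risk w s L Q sigma mu PX I n)%E.
Proof.
move=> w0 wle mf fdisj fclass xI x01 fx fx0 rate0 camp hbeta.
apply/ereal_infP => _ [fhat mfhat <-].
pose decode (z : n.-tuple T) : {ffun 'I_M -> bool} := [ffun j => fhat z (x j) < 0].
have mdec theta : measurable (decode @^-1` [set theta]).
  have -> : decode @^-1` [set theta] =
      \bigcap_(j in [set: 'I_M]) [set z | (fhat z (x j) < 0) = theta j].
    apply/seteqP; split => [z /= <- j _ /=|z /= h]; first by rewrite ffunE.
    by apply/ffunP => j; rewrite ffunE; exact: h.
  apply: fin_bigcap_measurable => // j _.
  have mneg : measurable [set z : n.-tuple T | fhat z (x j) < 0].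
    have := mfhat (x j) (x01 j) measurableT _ (measurable_itv (Interval -oo%O (BLeft (0 : R)))).
    by rewrite setTI; congr measurable; apply/seteqP; split => z /=; rewrite in_itv.
  have [->|tj] := eqVneq (theta j) true.
    by rewrite (_ : [set z | _] = [set z : n.-tuple T | fhat z (x j) < 0]).
  rewrite (_ : [set z | _] = ~` [set z : n.-tuple T | fhat z (x j) < 0]).
    exact: measurableC.
  apply/seteqP; split => z /=; case: (theta j) tj => // _; first by move=> ->.
  by move/negP/negbTE.
have [theta htheta] := decoding_bound PX sigma_gt0 mf fdisj mdec.
apply: (le_trans _ (ereal_sup_ubound _)); last by exists (signal f theta); [exact: fclass|reflexivity].
rewrite /expectation_obs /design_noise_law.
set P := iid_law _ n in htheta hbeta *.
set S := [set z | _ = theta] in htheta.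
have mS : measurable S.
  have := measurable_observations (n := n) (measurable_signal mf theta) measurableT (mdec theta).
  by rewrite setTI.
have PS : (P S <= beta%:E)%E by exact: le_trans hbeta.
have signalx j : signal f theta (x j) = (-1) ^+ theta j * amp.
  by rewrite /signal (bigD1 j)//= big1 ?addr0 ?fx// => i ij; rewrite fx0 ?mulr0.
apply: (@le_trans _ _ (\int[P]_z ((w c)%:E * (\1_(~` S) z)%:E))%E).
  rewrite ge0_integralZl//; last 2 first.
  - by apply/measurable_EFinP; apply: measurable_indic; exact: measurableC.
  - by rewrite lee_fin.
  rewrite integral_indic//; last exact: measurableC.
  rewrite setIT EFinM; apply: lee_wpmul2l; first by rewrite lee_fin.
  have PC := probability_setC P mS.
  apply: (@le_trans _ _ (1 - P S)%E); last by rewrite -PC.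
  by rewrite EFinB leeB.
apply: ge0_le_integral_lower => z; first by rewrite mule_ge0// lee_fin.
rewrite indicE; have [zS|zS] := boolP (z \in ~` S); last first.
  by rewrite mule0; exact: loss_ge0.
rewrite mule1; apply: loss_ge => //.
move/set_mem: zS; rewrite /S/= => zS.
have [j zj] : exists j, (fhat (observations (signal f theta) z) (x j) < 0) != theta j.
  apply: contrapT => h; apply: zS; apply/ffunP => j; rewrite ffunE.
  by apply/eqP; apply: contrapT => /negP hj; apply: h; exists j.
apply: (@le_trans _ _ ((rate s mu n (x j))^-1 *
    `|fhat (observations (signal f theta) z) (x j) - signal f theta (x j)|)%:E); last first.
  by apply: ereal_sup_ubound; exists (x j).
rewrite lee_fin ler_pdivlMl// mulrC; apply: le_trans (camp j) _.
rewrite signalx; move: zj; move: (fhat _ _) => y.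
case: (theta j); rewrite ?expr1 ?expr0 ?mulN1r ?mul1r.
  rewrite eqb_id -leNgt opprK => y0; apply: le_trans (ler_norm _); lra.
rewrite eqbF_neg negbK => y0; rewrite distrC; apply: le_trans (ler_norm _); lra.
Qed.

End risk.

(** * The lower bound for one sample size *)

Section fixed_sample_size.
Context {R : realType} (PX : probability (measurableTypeR R) R) (sigma : R).
Hypothesis sigma_gt0 : 0 < sigma.
Variables (mu : R -> R) (nu rho q : R).
Hypotheses (PX_mu : has_density_on01 PX mu) (nu_gt0 : 0 < nu)
  (mu_hoelder : forall x y, `[0, 1]%classic x -> `[0, 1]%classic y ->
     `|mu x - mu y| <= rho * `|x - y| `^ nu)
  (q_gt0 : 0 < q) (mu_ge : forall x, x \in `[0, 1] -> q <= mu x) (rho_gt0 : 0 < rho).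
Variables (s L Q : R) (psi psik : R -> R) (B S K : R).
Local Notation k := (hoelder_order s).
Local Notation alpha := (s - k%:R).
Hypotheses (s_gt0 : 0 < s) (L_gt0 : 0 < L) (B_ge0 : 0 <= B) (S_gt0 : 0 < S) (SK : S < K).
Hypotheses (psi_psik : iter_derivative k psi psik)
  (psik_hoelder : forall x y, `|psik x - psik y| <= `|x - y| `^ alpha)
  (psi_le : forall x, `|psi x| <= B) (psik_le : forall x, `|psik x| <= B)
  (psi_supp : forall x, S < `|x| -> psi x = 0)
  (gap : 2 * B <= (2 * (K - S)) `^ alpha) (psi_continuous : continuous psi)
  (psi_norm : (\int[lebesgue_measure]_x (psi x ^+ 2)%:E <= 1)%E).
Variables (w : R -> R).
Hypotheses (w_ge0 : forall x, 0 <= w x) (w_nondecreasing : {homo w : x y / x <= y}).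

(** Specialises minimax_risk_ge to M bumps of width h placed at the left end a
    of the interval. On the length len, the density is within a factor 1 -
    delta or 1 + delta of its value at a. The bound d concerns the energy of
    one observation, and t the mean energy of one bump. *)
Lemma minimax_risk_ge_cube (I : interval R) (n M : nat) (a b len h delta d t eta c : R) :
  [set` I] `<=` `[0, 1] -> `]a, b[ `<=` [set` I] -> len <= b - a ->
  0 < delta -> delta < 1 -> rho * len `^ nu <= delta * q ->
  0 < h -> 2 * M%:R * (K * h) <= len -> (1 < n)%N ->
  0 <= c -> c * (ln n%:R / (n%:R * ((1 - delta) * mu (clamp01 a)))) `^ (s / (2 * s + 1)) <=
     L * h `^ s * psi 0 ->
  L * h `^ s * B <= Q ->
  (L * h `^ s * B) ^+ 2 / sigma ^+ 2 <= d -> d <= 2^-1 -> 4 * d * t <= 1 -> 0 <= t ->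
  n%:R * ((1 + delta) * mu (clamp01 a) * ((L * h `^ s) ^+ 2 * h) / sigma ^+ 2) <= t ->
  0 < eta -> eta <= 1 ->
  ((w c * (1 - expR (- (M%:R * (expR ((ln eta - 1) / 2) / 4) *
      expR (- ((1 + eta) / 2 * t))))))%:E <= minimax_risk w s L Q sigma mu PX I n)%E.
Proof.
move=> I01 abI lenab d0 d1 rhol h0 MKh n1 c0 camp hQ hd d12 dt t0 hen e0 e1.
have K0 : 0 < K := lt_trans S_gt0 SK.
have Kh0 : 0 < K * h by rewrite mulr_gt0.
have Sh0 : 0 < S * h by rewrite mulr_gt0.
have SKh : S * h < K * h by rewrite ltr_pM2r.
have alpha_gt0 : 0 < alpha by rewrite subr_gt0; have /andP[] := hoelder_orderP s_gt0.
set m0 := mu (clamp01 a) in camp hen.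
have m0q : q <= m0 by apply: mu_ge; exact: clamp01_in.
have m00 : 0 < m0 := lt_le_trans q_gt0 m0q.
pose f := fun j : 'I_M => scaled_bump psi s K L h a j.
pose x := fun j : 'I_M => centre K h a j.
have mpsi : measurable_fun setT psi by exact: continuous_measurable_fun.
have mf j : measurable_fun setT (f j).
  apply: measurable_funM => //; apply: (measurableT_comp mpsi).
  by apply: measurable_funM => //; exact: measurable_funB.
have inJ j y : `|y - x j| <= S * h -> a < y < a + len.
  have jM : j%:R + 1 <= M%:R :> R by rewrite natr1 ler_nat ltn_ord.
  have j0 : 0 <= j%:R :> R by [].
  have h1 : (j%:R + 1) * (2 * (K * h)) <= M%:R * (2 * (K * h)).
    by rewrite ler_wpM2r// mulr_ge0// ltW.
  have h2 : 0 <= j%:R * (2 * (K * h)) by rewrite !mulr_ge0// ltW.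
  rewrite ler_norml /x /centre => /andP[y1 y2]; apply/andP; split; lra.
have inab j y : `|y - x j| <= S * h -> `]a, b[%classic y.
  by move=> /inJ /andP[y1 y2]; rewrite /= in_itv/= y1/=; lra.
have muJ y : a < y < a + len -> (1 - delta) * m0 <= mu (clamp01 y) <= (1 + delta) * m0.
  move=> /andP[y1 y2].
  have : `|mu (clamp01 y) - m0| <= delta * m0.
    apply: le_trans (mu_hoelder (clamp01_in y) (clamp01_in a)) _.
    apply: (@le_trans _ _ (delta * q)); last by rewrite ler_wpM2l// ltW.
    apply: le_trans rhol; rewrite ler_wpM2l ?(ltW rho_gt0)//.
    apply: ge0_ler_powR; rewrite ?nnegrE ?(ltW nu_gt0)//; first by lra.
    apply: le_trans (clamp01_lipschitz _ _) _; rewrite gtr0_norm; lra.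
  by rewrite ler_norml => /andP[z1 z2]; apply/andP; split; lra.
have xJ j : a < x j < a + len by apply: (inJ j); rewrite subrr normr0 ltW.
have xI j : [set` I] (x j) by apply/abI/(inab j); rewrite subrr normr0 ltW.
have x01 j : `[0, 1]%classic (x j) by apply: I01.
have ln0 : 0 < ln n%:R :> R by rewrite ln_gt0// ltr1n.
have n0 : 0 < n%:R :> R by rewrite ltr0n; exact: leq_trans n1.
have p0 : 0 < s / (2 * s + 1) by rewrite divr_gt0// addr_gt0// mulr_gt0.
have mux j : (1 - delta) * m0 <= mu (x j).
  by have /muJ/andP[+ _] := xJ j; rewrite clamp01_id.
have mux0 j : 0 < mu (x j).
  by apply: lt_le_trans (mux j); rewrite mulr_gt0// subr_gt0.
have fdisj i j y : i != j -> f i y != 0 -> f j y = 0.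
  by move=> ij; apply: (scaled_bump_disjoint S_gt0 SK h0 psi_supp).
apply: (@minimax_risk_ge R PX sigma sigma_gt0 w s L Q mu I n M f x (L * h `^ s * psi 0) c
  (expR (- (M%:R * (expR ((ln eta - 1) / 2) / 4) * expR (- ((1 + eta) / 2 * t)))))) => //.
- move=> theta.
  have sign1 j : `|(-1) ^+ theta j| = 1 :> R by rewrite normrX normrN1 expr1n.
  split.
    exact: (bump_signal_hoelder a alpha_gt0 B_ge0 S_gt0 SK L_gt0 h0 psi_psik
      psik_hoelder psik_le psi_supp gap sign1).
  move=> y _; apply: le_trans hQ.
  exact: (bump_signal_le s a B_ge0 S_gt0 SK L_gt0 h0 psi_le psi_supp sign1).
- by move=> j; exact: scaled_bump_centre.
- move=> i j ij; rewrite /f /scaled_bump (far_centre_eq0 h0 psi_supp) ?mulr0//.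
  by apply: (other_centre_far S_gt0 SK h0 ij); rewrite subrr normr0 ltW.
- by move=> j; rewrite /rate powR_gt0// divr_gt0// mulr_gt0.
- move=> j; apply: le_trans camp; rewrite ler_wpM2l//.
  apply: ge0_ler_powR; rewrite ?nnegrE ?(ltW p0)//.
  + by rewrite divr_ge0 ?(ltW ln0)// mulr_ge0 ?(ltW n0) ?(ltW (mux0 _)).
  + by rewrite divr_ge0 ?(ltW ln0)// mulr_ge0 ?(ltW n0)// mulr_ge0 ?subr_ge0 ?(ltW d1) ?(ltW m00).
  rewrite ler_pM2l// lef_pV2 ?posrE ?mulr_gt0 ?subr_gt0//.
  by rewrite ler_pM2l.
apply: (mean_prod_envelope_le (PX := PX) mf e0 e1 t0 _ d12 dt).
- by apply: le_trans hd; rewrite divr_ge0 ?sqr_ge0.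
- move=> y; rewrite -mulr_suml; apply: le_trans hd.
  rewrite ler_wpM2r ?invr_ge0 ?sqr_ge0//.
  exact: (sum_sqr_scaled_bump_le s a B_ge0 S_gt0 SK L_gt0 h0 psi_le psi_supp).
have mf2 j : measurable_fun setT (fun y => (f j y ^+ 2)%:E).
  by apply/measurable_EFinP; exact: measurable_funX.
have m1 : 0 <= (1 + delta) * m0 by rewrite mulr_ge0 ?(ltW m00)// addr_ge0// ltW.
have one j : (\int[PX]_y (f j y ^+ 2)%:E <= ((1 + delta) * m0 * ((L * h `^ s) ^+ 2 * h))%:E)%E.
  apply: le_trans (design_integral_le PX_mu nu_gt0 mu_hoelder q_gt0 mu_ge m1 (mf2 j) _ _) _.
  - by move=> y; rewrite lee_fin sqr_ge0.
  - move=> y; rewrite eqe sqrf_eq0 => /(scaled_bump_support h0 psi_supp)/inJ/muJ.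
    by case/andP.
  rewrite [leRHS]EFinM; apply: lee_wpmul2l; first by rewrite lee_fin.
  exact: integral_sqr_scaled_bump.
have -> : (\int[PX]_y (\sum_j f j y ^+ 2 / sigma ^+ 2)%:E =
    \sum_(j < M) ((sigma ^+ 2)^-1%:E * \int[PX]_y (f j y ^+ 2)%:E))%E.
  transitivity (\int[PX]_y (\sum_(j < M) ((sigma ^+ 2)^-1%:E * (f j y ^+ 2)%:E)))%E.
    apply: eq_integral => y _; rewrite -sumEFin; apply: eq_bigr => j _.
    by rewrite -EFinM mulrC.
  rewrite ge0_integral_sum//; last 2 first.
  - by move=> j; apply: emeasurable_funM; [exact: measurable_cst|exact: mf2].
  - by move=> j y _; rewrite -EFinM lee_fin mulr_ge0 ?sqr_ge0// invr_ge0 sqr_ge0.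
  apply: eq_bigr => j _; rewrite ge0_integralZl//.
  - exact: mf2.
  - by move=> y _; rewrite lee_fin sqr_ge0.
  - by rewrite lee_fin invr_ge0 sqr_ge0.
apply: (@le_trans _ _ (n%:R%:E * \sum_(j < M) ((sigma ^+ 2)^-1 *
    ((1 + delta) * m0 * ((L * h `^ s) ^+ 2 * h)))%:E)%E).
  apply: lee_wpmul2l; first by rewrite lee_fin.
  apply: lee_sum => j _; rewrite EFinM; apply: lee_wpmul2l => //.
  by rewrite lee_fin invr_ge0 sqr_ge0.
rewrite sumEFin -EFinM lee_fin sumr_const card_ord mulrnAr -[leLHS]mulr_natl.
by rewrite (mulrC (sigma ^- 2)); apply: ler_wpM2l.
Qed.
End fixed_sample_size.

(** * Growth of the number of bumps *)

Section asymptotics.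
Context {R : realType}.
Implicit Types (N : R).

Lemma powR_le (r x y : R) : 0 <= r -> 0 <= x -> x <= y -> x `^ r <= y `^ r.
Proof.
by move=> r0 x0 xy; apply: ge0_ler_powR; rewrite ?nnegrE// (le_trans x0).
Qed.

Lemma ln_le_powR N (gamma : R) : 0 < N -> 0 < gamma -> ln N <= N `^ gamma / gamma.
Proof.
move=> N0 g0; rewrite ler_pdivlMr// mulrC -ln_powR.
apply: le_trans (_ : N `^ gamma - 1 <= _); last by rewrite gerBl.
have := @le_ln1Dx R (N `^ gamma - 1); rewrite (addrC 1) subrK; apply.
by have := powR_gt0 gamma N0; lra.
Qed.

(** With u = 1 / (2 s + 1) and m0 the value of the density, this is the width
    of the bumps for N observations. *)
Definition bandwidth (kappa u N m0 : R) : R := (kappa * ln N / (N * m0)) `^ u.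

(** The logarithm is bounded by N `^ gamma / gamma. *)
Lemma bandwidth_le (kappa q m0 u gamma N : R) :
  0 < kappa -> 0 < q -> q <= m0 -> 0 < u -> 0 < gamma -> 1 <= N ->
  bandwidth kappa u N m0 <= (kappa / (q * gamma)) `^ u * N `^ (- ((1 - gamma) * u)).
Proof.
move=> k0 q0 qm u0 g0 N1.
have N0 : 0 < N := lt_le_trans ltr01 N1.
have m0_gt0 := lt_le_trans q0 qm.
have l0 := ln_ge0 N1.
have C0 : 0 <= kappa / (q * gamma) by rewrite divr_ge0 ?mulr_ge0// ltW.
rewrite /bandwidth -mulNr powRrM -powRM ?powR_ge0//; apply: powR_le => //; first exact: ltW.
  by rewrite divr_ge0 ?mulr_ge0// ltW.
rewrite opprB ler_pdivrMr ?mulr_gt0//.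
have -> : N `^ (gamma - 1) = N `^ gamma / N.
  have := @powRB R N gamma 1; rewrite (gt_eqF N0) implybT => ->//.
  by rewrite powRr1// ltW.
have h : ln N <= N `^ gamma / gamma by exact: ln_le_powR.
have -> : kappa / (q * gamma) * (N `^ gamma / N) * (N * m0) =
    kappa * (N `^ gamma / gamma) * (m0 / q).
  rewrite invfM; have e : N^-1 * N = 1 by rewrite mulVf// gt_eqF.
  transitivity (kappa * (N `^ gamma / gamma) * (m0 / q) * (N^-1 * N)); first by lra.
  by rewrite e mulr1.
rewrite -[leLHS]mulr1; apply: ler_pM => //.
- by rewrite mulr_ge0// ltW.
- by rewrite ler_wpM2l// ltW.
- by rewrite ler_pdivlMr// mul1r.
Qed.

Lemma near_powR_ge (C p : R) : 0 < p -> \forall n \near \oo, C <= n%:R `^ p.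
Proof.
move=> p0; near=> n.
have h : (`|C| + 1) `^ p^-1 <= n%:R by near: n; exact: nbhs_infty_ger.
apply: (@le_trans _ _ (`|C| + 1)); first by rewrite (le_trans (ler_norm C))// lerDl.
have C1 : 0 <= `|C| + 1 by rewrite addr_ge0.
rewrite -[leLHS]powRr1// -[X in _ `^ X](mulVf (_ : p != 0)) ?gt_eqF// powRrM.
by apply: powR_le; [exact: ltW|exact: powR_ge0|exact: h].
Unshelve. all: by end_near. Qed.

Lemma near_powRN_le (C r p : R) : 0 < p -> 0 < r -> \forall n \near \oo, C * n%:R `^ (- p) <= r.
Proof.
move=> p0 r0; near=> n.
have h : `|C| / r <= n%:R `^ p by near: n; exact: near_powR_ge.
have n0 : 0 < n%:R `^ p :> R by rewrite powR_gt0//; near: n; exact: nbhs_infty_gtr.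
rewrite powRN ler_pdivrMr//; apply: (@le_trans _ _ `|C|); first exact: ler_norm.
by rewrite mulrC -ler_pdivrMr.
Unshelve. all: by end_near. Qed.

(** The amplitude of the bumps is at most a negative power of n, uniformly in
    the value m0 of the density, so that powers of log n do not matter. *)
Lemma near_bump_small (kappa q u s D sigma T Q : R) :
  0 < kappa -> 0 < q -> 0 < u -> 0 < s -> 0 <= D -> 0 <= T -> 0 < Q ->
  \forall n \near \oo, forall m0, q <= m0 ->
    [/\ D * bandwidth kappa u n%:R m0 `^ s <= Q,
      (D * bandwidth kappa u n%:R m0 `^ s) ^+ 2 / sigma ^+ 2 <= 2^-1 &
      4 * ((D * bandwidth kappa u n%:R m0 `^ s) ^+ 2 / sigma ^+ 2) * (T * ln n%:R) <= 1].
Proof.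
move=> k0 q0 u0 s0 D0 T0 Q0.
pose v := u * s / 2; have v0 : 0 < v by rewrite !mulr_gt0.
pose C := D * ((kappa / (q * 2^-1)) `^ u) `^ s.
have C0 : 0 <= C by rewrite mulr_ge0 ?powR_ge0.
pose F := C ^+ 2 / sigma ^+ 2.
have F0 : 0 <= F by rewrite divr_ge0 ?sqr_ge0.
near=> n.
move=> m0 qm; set E := D * _.
have N1 : 1 <= n%:R :> R by near: n; exact: nbhs_infty_ger.
have N0 : 0 < n%:R :> R := lt_le_trans ltr01 N1.
have E0 : 0 <= E by rewrite mulr_ge0 ?powR_ge0.
have EC : E <= C * n%:R `^ (- v).
  have h12 : 0 < 2^-1 :> R by rewrite invr_gt0.
  have hb := bandwidth_le k0 q0 qm u0 h12 N1.
  rewrite /E /C -mulrA; apply: ler_wpM2l => //.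
  apply: le_trans (powR_le (ltW s0) (powR_ge0 _ _) hb) _.
  rewrite powRM ?powR_ge0//; apply: ler_wpM2l; first exact: powR_ge0.
  rewrite -powRrM (_ : - ((1 - 2^-1) * u) * s = - v)// /v; lra.
have EF : E ^+ 2 / sigma ^+ 2 <= F * n%:R `^ (- (2 * v)).
  rewrite /F (mulrAC (C ^+ 2)); apply: ler_wpM2r; first by rewrite invr_ge0 sqr_ge0.
  have -> : n%:R `^ (- (2 * v)) = (n%:R `^ (- v)) ^+ 2.
    by rewrite -powR_mulrn ?powR_ge0// -powRrM; congr (_ `^ _); lra.
  by rewrite -exprMn; apply: lerXn2r; rewrite ?nnegrE ?mulr_ge0 ?powR_ge0.
split.
- by apply: le_trans EC _; near: n; exact: near_powRN_le.
- by apply: le_trans EF _; near: n; apply: near_powRN_le; rewrite ?mulr_gt0// invr_gt0.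
have hl := ln_le_powR N0 v0.
have hT : T * ln n%:R <= T * (n%:R `^ v / v) by rewrite ler_wpM2l.
apply: (@le_trans _ _ (4 * F * (T / v) * n%:R `^ (- v))); last first.
  by near: n; exact: near_powRN_le.
have step : (E ^+ 2 / sigma ^+ 2) * (T * ln n%:R) <=
    F * n%:R `^ (- (2 * v)) * (T * (n%:R `^ v / v)).
  have h1 : 0 <= E ^+ 2 / sigma ^+ 2 by rewrite divr_ge0 ?sqr_ge0.
  have h2 : 0 <= T * ln n%:R by apply: mulr_ge0 => //; exact: ln_ge0.
  exact: (ler_pM h1 h2 EF hT).
have eN : n%:R `^ (- (2 * v)) * n%:R `^ v = n%:R `^ (- v).
  rewrite -powRD; first by congr (_ `^ _); lra.
  by rewrite (gt_eqF N0) implybT.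
have -> : 4 * F * (T / v) * n%:R `^ (- v) = 4 * (F * n%:R `^ (- (2 * v)) * (T * (n%:R `^ v / v))).
  by rewrite -eN; lra.
rewrite -mulrA; apply: (ler_wpM2l _ step); exact: ler0n.
Unshelve. all: by end_near. Qed.

(** There are at least n^((1 - g - eps) u) bumps up to a constant, and each
    sign is missed with a probability of order n^(- (1 - eps) (1 - delta)
    u). With g = (1 - eps) delta / 2 the product of the two is of order
    n^(g u). *)
Lemma near_many_bumps (kappa q u eps delta eta0 K c0 e : R) (l : nat -> R) :
  0 < kappa -> 0 < q -> 0 < u -> 0 < eps < 1 -> 0 < delta < 1 -> 0 < eta0 -> 0 < K ->
  0 < c0 -> 0 < e ->
  l n * n%:R `^ (eps * u) @[n --> \oo] --> +oo ->
  \forall n \near \oo, forall m0, q <= m0 ->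
    expR (- ((Num.trunc (eta0 * l n / (2 * (K * bandwidth kappa u n%:R m0))))%:R * c0 *
      expR (- ((1 - eps) * (1 - delta) * u * ln n%:R)))) <= e.
Proof.
move=> k0 q0 u0 /andP[ep0 ep1] /andP[d0 d1] et0 K0 c00 e0 linf.
pose g := (1 - eps) * delta / 2.
have g0 : 0 < g by rewrite !mulr_gt0 ?subr_gt0.
pose C := (kappa / (q * g)) `^ u.
have C0 : 0 < C by rewrite powR_gt0// divr_gt0// mulr_gt0.
pose A := eta0 / (2 * (K * C)).
have A0 : 0 < A by rewrite divr_gt0// !mulr_gt0.
near=> n.
move=> m0 qm; set h := bandwidth _ _ _ _.
have N2 : 2 <= n%:R :> R by near: n; exact: nbhs_infty_ger.
have N1 : 1 <= n%:R :> R by lra.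
have N0 : 0 < n%:R :> R by lra.
have lN : 1 <= l n * n%:R `^ (eps * u).
  by near: n; move/cvgryPge : linf; apply.
have m00 := lt_le_trans q0 qm.
have ln0 : 0 < ln n%:R :> R by rewrite ln_gt0//; lra.
have h0 : 0 < h by rewrite powR_gt0// divr_gt0 ?mulr_gt0.
have hC : h <= C * n%:R `^ (- ((1 - g) * u)) by exact: bandwidth_le.
have l1 : n%:R `^ (- (eps * u)) <= l n.
  by rewrite powRN -[leLHS]mul1r ler_pdivrMr// powR_gt0.
set M := Num.trunc _.
have M1 : A * n%:R `^ ((1 - g - eps) * u) <= M%:R + 1.
  rewrite natr1; apply: le_trans (ltW (truncnS_gt _)).
  rewrite ler_pdivlMr ?mulr_gt0//.
  apply: (@le_trans _ _ (eta0 * n%:R `^ (- (eps * u)))); last by rewrite ler_wpM2l// ltW.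
  have -> : A * n%:R `^ ((1 - g - eps) * u) * (2 * (K * h)) =
     (A * (2 * K) * n%:R `^ ((1 - g - eps) * u)) * h by lra.
  apply: le_trans (ler_wpM2l _ hC) _.
    by rewrite mulr_ge0 ?powR_ge0// mulr_ge0 ?(ltW A0)// mulr_ge0// ltW.
  have -> : A * (2 * K) * n%:R `^ ((1 - g - eps) * u) * (C * n%:R `^ (- ((1 - g) * u))) =
     (A * (2 * (K * C))) * (n%:R `^ ((1 - g - eps) * u) * n%:R `^ (- ((1 - g) * u))) by lra.
  rewrite -powRD; last by rewrite (gt_eqF N0) implybT.
  rewrite /A divfK; last by rewrite gt_eqF// !mulr_gt0.
  by rewrite (_ : (1 - g - eps) * u + _ = - (eps * u)) //; lra.
set z := expR (- ((1 - eps) * (1 - delta) * u * ln n%:R)).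
have zE : z = n%:R `^ (- ((1 - eps) * (1 - delta) * u)).
  by rewrite /z -mulNr mulrC expRM lnK// posrE.
have z0 : 0 <= z by exact: expR_ge0.
have z1 : z <= 1.
  rewrite /z -[leRHS]expR0 ler_expR oppr_le0 mulr_ge0 ?(ltW ln0)//.
  by rewrite !mulr_ge0 ?subr_ge0// ltW.
have zN : n%:R `^ ((1 - g - eps) * u) * z = n%:R `^ (g * u).
  rewrite zE -powRD; last by rewrite (gt_eqF N0) implybT.
  by congr (_ `^ _); rewrite /g; lra.
have big : (1 - ln e / c0) / A <= n%:R `^ (g * u).
  by near: n; apply: near_powR_ge; rewrite mulr_gt0.
rewrite ler_pdivrMr// in big.
rewrite -[leRHS]lnK ?posrE// ler_expR lerNl.
apply: (@le_trans _ _ (c0 * (A * n%:R `^ (g * u) - 1))).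
  rewrite -ler_pdivrMl// mulrN mulrC; lra.
have h1 : (A * n%:R `^ ((1 - g - eps) * u) - 1) * z <= M%:R * z.
  by rewrite ler_wpM2r// lerBlDr.
have h2 : A * n%:R `^ (g * u) - 1 <= M%:R * z.
  by apply: le_trans h1; rewrite -zN; lra.
by have := ler_wpM2l (ltW c00) h2; lra.
Unshelve. all: by end_near. Qed.
End asymptotics.

(** * The sharp constant *)

Lemma limn_einf_ge_near (R : realType) (u : (\bar R)^nat) (x : \bar R) :
  (\forall n \near \oo, (x <= u n)%E) -> (x <= limn_einf u)%E.
Proof.
move=> [N _ hN]; rewrite limn_einf_lim (cvg_lim _ (@cvg_einfs_sup _ u))//.
apply: le_trans (ereal_sup_ubound _); last by exists N.
by apply/ereal_infP => _ [n /= Nn <-]; exact: hN.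
Qed.

Lemma open_subinterval (R : realType) (I : interval R) :
  [set` I] `<=` (`[0, 1]%classic : set R) -> 0 < fine (lebesgue_measure [set` I]) ->
  exists a b : R, [/\ `]a, b[ `<=` [set` I],
    fine (lebesgue_measure [set` I]) = b - a & b - a <= 1].
Proof.
move=> I01; have le1 : (lebesgue_measure ([set` I] : set R) <= 1)%E.
  apply: (@le_trans _ _ (lebesgue_measure (`[0, 1]%classic : set R))).
    by apply: le_measure => //; rewrite inE.
  by rewrite lebesgue_measure_itv/= lte01 oppr0 adde0.
move: le1; rewrite lebesgue_measure_itv.
case: I I01 => [[[] a|[]] [[] b|[]]] I01 //=; rewrite ?ltxx//;
  case: ifPn => //= ab; rewrite ?lee_fin ?ltxx//.
all: move=> ba1 ba0; exists a, b; split => // x /=; rewrite !in_itv/= => /andP[ax xb];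
  by rewrite ?ax ?xb ?(ltW ax) ?(ltW xb).
Qed.

Section constants.
Context {R : realType}.
Implicit Types (s L sigma eps delta : R).

(** Without eps and delta, the bumps L * h `^ s * phi(x / h) would have
    exactly P times the rate as amplitude, and, for phi of norm 1, 2 u log n
    as mean energy. This is the critical energy: the probability of missing a
    sign is of order n^(- u) and the number of bumps of order n^u, up to
    logarithms. *)
Definition bandwidth_constant s L sigma eps delta : R :=
  sigma `^ 2 * L `^ (- 2) * (2 / (2 * s + 1)) *
    ((1 - eps) * (1 - delta) / (1 + delta) ^+ 2).

Lemma bandwidth_constant_gt0 s L sigma eps delta :
  0 < s -> 0 < L -> 0 < sigma -> eps < 1 -> 0 < delta < 1 ->
  0 < bandwidth_constant s L sigma eps delta.
Proof.
move=> s0 L0 sg0 e1 /andP[d0 d1].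
have s21 : 0 < 2 * s + 1 by rewrite addr_gt0// mulr_gt0.
rewrite /bandwidth_constant !mulr_gt0 ?powR_gt0 ?invr_gt0 ?exprn_gt0 ?subr_gt0//.
by rewrite addr_gt0.
Qed.

(** The exponent s / (2 s + 1) is less than 1 / 2, so the factors lost on the
    density, on the bandwidth constant and on psi(0) cost at most ((1 - delta)
    b)^(1/2) (1 - delta), with b the last factor of bandwidth_constant. This
    is at least 1 - eps for delta = eps / 6. *)
Lemma amplitude_ge s L sigma eps (phi : R -> R) psi0 :
  0 < s -> 0 < L -> 0 < sigma -> 0 < eps < 1 -> 0 <= phi 0 ->
  (1 - eps / 6) * phi 0 <= psi0 ->
  (1 - eps) * sharp_constant phi s L sigma <=
    (1 - eps / 6) `^ (s / (2 * s + 1)) *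
     (L * bandwidth_constant s L sigma eps (eps / 6) `^ (s / (2 * s + 1)) * psi0).
Proof.
move=> s0 L0 sg0 /andP[e0 e1] phi0 hpsi.
set delta := eps / 6 in hpsi *.
have d0 : 0 < delta by rewrite divr_gt0.
have d6 : eps = 6 * delta by rewrite /delta; lra.
have d1 : delta < 1 by lra.
have s21 : 0 < 2 * s + 1 by rewrite addr_gt0// mulr_gt0.
set p := s / (2 * s + 1).
have p0 : 0 < p by rewrite divr_gt0.
have p12 : p <= 2^-1 by rewrite ler_pdivrMr//; lra.
set b := (1 - eps) * (1 - delta) / (1 + delta) ^+ 2.
have dd0 : 0 < (1 + delta) ^+ 2 by rewrite exprn_gt0// addr_gt0.
have b0 : 0 < b by apply: divr_gt0 => //; apply: mulr_gt0; rewrite subr_gt0.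
have base0 : 0 < (1 - delta) * b by apply: mulr_gt0 => //; rewrite subr_gt0.
pose y := ((1 - delta) * b) `^ 2^-1.
have y0 : 0 <= y by exact: powR_ge0.
have y2 : y ^+ 2 = (1 - delta) * b.
  by rewrite -powR_mulrn// -powRrM mulVf// powRr1// ltW.
have base1 : (1 - delta) * b <= 1.
  rewrite /b mulrA ler_pdivrMr// mul1r.
  have h1 : (1 - delta) * ((1 - eps) * (1 - delta)) <= 1 * (1 * 1).
    by rewrite !ler_pM ?mulr_ge0 ?subr_ge0//; lra.
  by have := sqr_ge0 delta; lra.
have yr : y <= ((1 - delta) * b) `^ p.
  by rewrite /y; apply: ger_powR => //; rewrite base0.
have y1 : 1 - eps <= y * (1 - delta).
  rewrite -(@ler_pXn2r _ 2) ?nnegrE ?mulr_ge0 ?subr_ge0 ?(ltW d1) ?(ltW e1)//.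
  rewrite exprMn y2 /b.
  have -> : (1 - delta) * ((1 - eps) * (1 - delta) / (1 + delta) ^+ 2) * (1 - delta) ^+ 2 =
     (1 - eps) * (1 - delta) ^+ 4 / (1 + delta) ^+ 2 by lra.
  rewrite ler_pdivlMr// expr2 -mulrA; apply: ler_wpM2l; first by rewrite subr_ge0 ltW.
  have c1 : 0 <= delta ^+ 2 by exact: sqr_ge0.
  have c2 : 0 <= delta ^+ 2 * delta by rewrite mulr_ge0// ltW.
  have c3 : 0 <= delta ^+ 2 * delta ^+ 2 by rewrite mulr_ge0.
  have c4 : delta ^+ 2 * delta <= delta ^+ 2 by rewrite -[leRHS]mulr1 ler_wpM2l// ltW.
  by rewrite d6; lra.
pose Z := sigma `^ (2 * p) * L `^ (1 / (2 * s + 1)) * (2 / (2 * s + 1)) `^ p.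
have Z0 : 0 <= Z by rewrite !mulr_ge0 ?powR_ge0.
have -> : (1 - eps) * sharp_constant phi s L sigma = Z * ((1 - eps) * phi 0).
  rewrite /sharp_constant /Z -/p (_ : 2 * s / (2 * s + 1) = 2 * p) /p; last by rewrite mulrA.
  by move: (_ `^ _) (_ `^ _) (_ `^ _) => A1 A2 A3; lra.
have -> : (1 - delta) `^ p * (L * bandwidth_constant s L sigma eps delta `^ p * psi0) =
    Z * (((1 - delta) * b) `^ p * psi0).
  rewrite /bandwidth_constant -/b.
  rewrite (powRM p _ (ltW b0)) ?mulr_ge0 ?powR_ge0 ?divr_ge0 ?(ltW s21)//.
  rewrite (powRM p (_ : 0 <= sigma `^ 2 * L `^ (- 2))) ?mulr_ge0 ?powR_ge0 ?divr_ge0 ?(ltW s21)//.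
  rewrite (powRM p (powR_ge0 sigma 2)) ?powR_ge0// -!powRrM.
  rewrite (powRM p _ (ltW b0)) ?subr_ge0 ?(ltW d1)//.
  rewrite /Z; have -> : L `^ (1 / (2 * s + 1)) = L * L `^ (- 2 * p).
    have := @powRD R L 1 (- 2 * p); rewrite (gt_eqF L0) implybT powRr1 ?(ltW L0)//.
    move=> <-//; congr (_ `^ _).
    have e : (2 * s + 1) * (2 * s + 1)^-1 = 1 by rewrite mulfV// gt_eqF.
    by rewrite /p; move: e; move: (_^-1) => z; lra.
  move: (sigma `^ _) (L `^ _) (b `^ p) (_ `^ p) (_ `^ p) => A1 A2 A3 A4 A5.
  by lra.
- by rewrite invr_ge0 ltW.
- by rewrite invr_ge0 ltW.
apply: (ler_wpM2l Z0); apply: le_trans (_ : (y * (1 - delta)) * phi 0 <= _).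
  exact: ler_wpM2r.
rewrite -mulrA; apply: ler_pM => //.
by rewrite mulr_ge0// subr_ge0 ltW.
Qed.

Lemma bump_energy s L sigma eps delta (N m0 h : R) :
  0 < s -> 0 < L -> 0 < sigma -> eps < 1 -> 0 < delta < 1 -> 1 < N -> 0 < m0 ->
  h = bandwidth (bandwidth_constant s L sigma eps delta) (2 * s + 1)^-1 N m0 ->
  N * ((1 + delta) * m0 * ((L * h `^ s) ^+ 2 * h) / sigma ^+ 2) =
  2 * (1 - eps) * (1 - delta) * (2 * s + 1)^-1 / (1 + delta) * ln N.
Proof.
move=> s0 L0 sg0 e1 d01 N1 m00 hE.
have k0 := bandwidth_constant_gt0 s0 L0 sg0 e1 d01.
have /andP[d0 d1] := d01.
have s21 : 0 < 2 * s + 1 by rewrite addr_gt0// mulr_gt0.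
have N0 : 0 < N by lra.
have l0 : 0 < ln N by rewrite ln_gt0.
set kappa := bandwidth_constant _ _ _ _ _ in hE k0.
have X0 : 0 < kappa * ln N / (N * m0) by apply: divr_gt0; exact: mulr_gt0.
have h0 : 0 < h by rewrite hE powR_gt0.
have hh : (h `^ s) ^+ 2 * h = kappa * ln N / (N * m0).
  rewrite -powR_mulrn ?powR_ge0// -powRrM -[X in _ * X]powRr1 ?(ltW h0)//.
  rewrite -powRD; last by rewrite (gt_eqF h0) implybT.
  rewrite hE /bandwidth -powRrM (_ : (2 * s + 1)^-1 * _ = 1) ?powRr1 ?(ltW X0)//.
  by rewrite (mulrC s) mulVf// gt_eqF.
have -> : N * ((1 + delta) * m0 * ((L * h `^ s) ^+ 2 * h) / sigma ^+ 2) =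
   N * ((1 + delta) * m0 * (L ^+ 2 * ((h `^ s) ^+ 2 * h)) / sigma ^+ 2) by lra.
rewrite hh /kappa /bandwidth_constant powR_mulrn ?(ltW sg0)// powRN powR_mulrn ?(ltW L0)//.
have i1 : sigma ^+ 2 * (sigma ^+ 2)^-1 = 1 by rewrite mulfV// gt_eqF// exprn_gt0.
have i2 : L ^+ 2 * (L ^+ 2)^-1 = 1 by rewrite mulfV// gt_eqF// exprn_gt0.
have i3 : (N * m0) * (N * m0)^-1 = 1 by rewrite mulfV// gt_eqF// mulr_gt0.
have i4 : (1 + delta) * (1 + delta)^-1 = 1 by rewrite mulfV// gt_eqF// addr_gt0.
rewrite (expr2 (1 + delta)) (invfM (1 + delta) (1 + delta)).
move: i1 i2 i3 i4; move: (sigma ^+ 2) (sigma ^+ 2)^-1 (L ^+ 2) (L ^+ 2)^-1 => S S' L2 L2'.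
move: (N * m0)^-1 (1 + delta)^-1 (2 * s + 1)^-1 (ln N) => Nm' d' u l i1 i2 i3 i4.
transitivity ((S * S') * (L2 * L2') * ((N * m0) * Nm') * ((1 + delta) * d') *
  (2 * (1 - eps) * (1 - delta) * u * d' * l)); first by lra.
by rewrite i1 i2 i3 i4; lra.
Qed.

End constants.

(** * The limit inferior of the minimax risk *)

Section lower_bound.
Context {R : realType}.
Variables (s L Q sigma : R).
Hypotheses (s_gt0 : 0 < s) (L_gt0 : 0 < L) (Q_gt0 : 0 < Q) (sigma_gt0 : 0 < sigma).
Variable phi : R -> R.
Hypothesis phi_argmax : recovery_argmax s phi.
Variables (mu : R -> R) (PX : probability (measurableTypeR R) R).
Hypothesis PX_mu : has_density_on01 PX mu.
Variables (nu rho q : R).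
Hypotheses (nu_gt0 : 0 < nu) (nu_le1 : nu <= 1) (rho_gt0 : 0 < rho) (q_gt0 : 0 < q)
  (mu_hoelder : hoelder_class `[0, 1] nu rho mu)
  (mu_ge : forall x, x \in `[0, 1] -> q <= mu x).
Variable w : R -> R.
Hypotheses (w_ge0 : forall x, 0 <= w x) (w_nondecreasing : {homo w : x y / x <= y}).
Variable I : nat -> interval R.
Hypothesis I_sub : forall n, [set` I n] `<=` `[0, 1].

Lemma recovery_max_ge0 : 0 <= phi 0.
Proof.
have [_ hmax] := phi_argmax; apply: (hmax (fun=> 0)); split.
  exists (fun=> 0); first by apply: iter_derivative_within; exact: iter_derivative0.
  by move=> x y _ _; rewrite subrr normr0 mul1r powR_ge0.
have N00 : 2%:E != 0%E :> \bar R by rewrite eqe pnatr_eq0.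
have N0 := @Lnorm0 _ _ R lebesgue_measure 2%:E N00.
have N1 : ('N[lebesgue_measure]_2%:E[cst (0%R%:E : \bar R)] <= 1)%E by rewrite N0 lee01.
exact: N1.
Qed.

Lemma sharp_constant_ge0 : 0 <= sharp_constant phi s L sigma.
Proof. by rewrite !mulr_ge0 ?powR_ge0 ?recovery_max_ge0. Qed.

Lemma density_hoelder x y : `[0, 1]%classic x -> `[0, 1]%classic y ->
  `|mu x - mu y| <= rho * `|x - y| `^ nu.
Proof.
have k0 : hoelder_order nu = 0%N.
  have /andP[h _] := hoelder_orderP nu_gt0.
  have : (hoelder_order nu)%:R < 1 :> R by exact: lt_le_trans nu_le1.
  by rewrite ltrn1; case: (hoelder_order nu).
case: mu_hoelder => g; rewrite k0 subr0 /= => mug hg x01 y01.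
by rewrite (mug x) ?(mug y) ?inE//; exact: hg.
Qed.

(** The condition on I_n is what near_many_bumps requires. The width h depends
    on n through the value of the density at the left end of I_n, which is why
    the asymptotic estimates are uniform over m0 >= q. *)
Lemma near_minimax_risk_ge eps e : 0 < eps < 1 -> 0 < e -> long_intervals s I eps ->
  \forall n \near \oo,
    ((w ((1 - eps) * sharp_constant phi s L sigma) * (1 - e))%:E <=
       minimax_risk w s L Q sigma mu PX (I n) n)%E.
Proof.
move=> eps01 e0 Ilong; have /andP[ep0 ep1] := eps01.
pose delta := eps / 6.
have d0 : 0 < delta by rewrite divr_gt0.
have d1 : delta < 1 by rewrite /delta; lra.
have d01 : 0 < delta < 1 by rewrite d0.
have [adm _] := phi_argmax.
have [psi [psik [B [S [[S0 B0 psiD psikh [psiB psikB]] [psiS cpsi psi2 psi0]]]]]] :=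
  localized_recovery s_gt0 adm recovery_max_ge0 d0 d1.
set k := hoelder_order s in psiD psikh.
have a0 : 0 < s - k%:R by rewrite subr_gt0; have /andP[] := hoelder_orderP s_gt0.
(* Half the distance between centres, in units of h: large enough for the
   separation required by bump_sum_hoelder. *)
pose K := S + (2 * B + 1) `^ (s - k%:R)^-1.
have B21 : 0 < 2 * B + 1 by rewrite ltr_wpDl// mulr_ge0.
have SK : S < K by rewrite ltrDl powR_gt0.
have K0 : 0 < K := lt_trans S0 SK.
have gap : 2 * B <= (2 * (K - S)) `^ (s - k%:R).
  apply: (@le_trans _ _ (2 * B + 1)); first by lra.
  have -> : 2 * B + 1 = ((2 * B + 1) `^ (s - k%:R)^-1) `^ (s - k%:R).
    by rewrite -powRrM mulVf ?gt_eqF// powRr1// ltW.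
  have q0 := powR_ge0 (2 * B + 1) (s - k%:R)^-1.
  by apply: powR_le => //; [exact: ltW|rewrite /K; lra].
pose u := (2 * s + 1)^-1.
have s21 : 0 < 2 * s + 1 by rewrite addr_gt0// mulr_gt0.
have u0 : 0 < u by rewrite invr_gt0.
pose kappa := bandwidth_constant s L sigma eps delta.
have kappa0 : 0 < kappa by exact: bandwidth_constant_gt0.
(* The bumps occupy the proportion eta0 of I_n, short enough for the relative
   variation of the density to be at most delta. *)
pose eta0 := Num.min 1 ((delta * q / rho) `^ nu^-1).
have dqr : 0 < delta * q / rho by rewrite divr_gt0// mulr_gt0.
have eta00 : 0 < eta0 by rewrite lt_min ltr01 powR_gt0.
have eta0nu : rho * eta0 `^ nu <= delta * q.
  rewrite -ler_pdivlMl// mulrC.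
  have -> : delta * q / rho = ((delta * q / rho) `^ nu^-1) `^ nu.
    by rewrite -powRrM mulVf ?gt_eqF// powRr1// ltW.
  by apply: powR_le; [exact: ltW|exact: ltW|rewrite ge_min lexx orbT].
pose l n := fine (lebesgue_measure [set` I n]).
(* By bump_energy, the mean energy of a bump is T * ln n. *)
pose T := 2 * (1 - eps) * (1 - delta) * u / (1 + delta).
have T0 : 0 <= T.
  have ? : 0 <= 1 - eps by lra.
  have ? : 0 <= 1 - delta by lra.
  have ? : 0 <= 1 + delta by lra.
  by rewrite divr_ge0// mulr_ge0 ?(ltW u0)// !mulr_ge0.
have c00 : 0 < expR ((ln delta - 1) / 2) / 4 by rewrite divr_gt0 ?expR_gt0.
have LB0 : 0 <= L * B by rewrite mulr_ge0// ltW.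
have small := near_bump_small sigma kappa0 q_gt0 u0 s_gt0 LB0 T0 Q_gt0.
have many := near_many_bumps kappa0 q_gt0 u0 eps01 d01 eta00 K0 c00 e0 Ilong.
near=> n.
have smalln : forall m0, q <= m0 -> [/\ L * B * bandwidth kappa u n%:R m0 `^ s <= Q,
      (L * B * bandwidth kappa u n%:R m0 `^ s) ^+ 2 / sigma ^+ 2 <= 2^-1 &
      4 * ((L * B * bandwidth kappa u n%:R m0 `^ s) ^+ 2 / sigma ^+ 2) * (T * ln n%:R) <= 1].
  by near: n; exact: small.
have manyn : forall m0, q <= m0 ->
    expR (- ((Num.trunc (eta0 * l n / (2 * (K * bandwidth kappa u n%:R m0))))%:R *
      (expR ((ln delta - 1) / 2) / 4) *
      expR (- ((1 - eps) * (1 - delta) * u * ln n%:R)))) <= e.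
  by near: n; exact: many.
have n1 : (1 < n)%N by near: n; exact: nbhs_infty_gt.
have N1 : 1 < n%:R :> R by rewrite ltr1n.
have N0 : 0 < n%:R :> R by lra.
have lN : 0 < l n.
  have : 1 <= l n * n%:R `^ (eps * u) by near: n; move/cvgryPge : Ilong; apply.
  move=> h; have : 0 < l n * n%:R `^ (eps * u) by exact: lt_le_trans h.
  by rewrite pmulr_lgt0// powR_gt0.
have [a [b [abI lE ba1]]] := open_subinterval (@I_sub n) lN.
have m0q : q <= mu (clamp01 a) by apply: mu_ge; exact: clamp01_in.
have [hQ hd hdt] := smalln _ m0q.
have hM := manyn _ m0q.
set m0 := mu (clamp01 a) in m0q hQ hd hdt hM.
have m00 : 0 < m0 := lt_le_trans q_gt0 m0q.
set h := bandwidth kappa u n%:R m0 in hQ hd hdt hM.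
have ln0 : 0 < ln n%:R :> R by rewrite ln_gt0.
have h0 : 0 < h by rewrite powR_gt0//; apply: divr_gt0; exact: mulr_gt0.
have LBh : L * h `^ s * B = L * B * h `^ s by rewrite mulrAC.
set M := Num.trunc _ in hM.
pose t := T * ln n%:R.
have t0 : 0 <= t by rewrite mulr_ge0// ltW.
have P0 := sharp_constant_ge0.
set c := (1 - eps) * sharp_constant phi s L sigma.
have c0 : 0 <= c by rewrite mulr_ge0// subr_ge0 ltW.
have Kh0 : 0 < 2 * (K * h) by rewrite !mulr_gt0.
have eta01 : eta0 <= 1 by rewrite ge_min lexx.
have len1 : eta0 * l n <= b - a by rewrite -lE -[leRHS]mul1r ler_wpM2r// ltW.
have len2 : rho * (eta0 * l n) `^ nu <= delta * q.
  apply: le_trans eta0nu; apply: ler_wpM2l; first exact: ltW.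
  apply: powR_le; [exact: ltW|by rewrite mulr_ge0// ltW|].
  rewrite -[leRHS]mulr1; apply: ler_wpM2l; first exact: ltW.
  by move: ba1; rewrite -lE.
have len3 : 2 * M%:R * (K * h) <= eta0 * l n.
  rewrite -mulrA mulrCA -ler_pdivlMr//.
  have ge0 : 0 <= eta0 * l n / (2 * (K * h)).
    by rewrite divr_ge0 ?(ltW Kh0)// mulr_ge0 ?(ltW eta00) ?(ltW lN).
  by rewrite truncn_le.
have camp : c * (ln n%:R / (n%:R * ((1 - delta) * m0))) `^ (s / (2 * s + 1)) <= L * h `^ s * psi 0.
  have X0 : 0 < ln n%:R / (n%:R * m0) by rewrite divr_gt0// mulr_gt0.
  have dd : 0 < (1 - delta) `^ (s / (2 * s + 1)) by rewrite powR_gt0// subr_gt0.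
  have -> : ln n%:R / (n%:R * ((1 - delta) * m0)) = (ln n%:R / (n%:R * m0)) * (1 - delta)^-1.
    by rewrite (mulrCA n%:R) (invfM (1 - delta)) mulrA mulrAC.
  rewrite powRM ?(ltW X0) ?invr_ge0 ?subr_ge0 ?(ltW d1)//.
  have -> : (1 - delta)^-1 `^ (s / (2 * s + 1)) = ((1 - delta) `^ (s / (2 * s + 1)))^-1.
    have d1' : 0 <= 1 - delta by rewrite subr_ge0 ltW.
    by rewrite -(powR_inv1 d1') -powRrM mulN1r powRN.
  rewrite mulrA ler_pdivrMr//.
  have -> : h `^ s = kappa `^ (s / (2 * s + 1)) * (ln n%:R / (n%:R * m0)) `^ (s / (2 * s + 1)).
    rewrite /h /bandwidth -powRrM (mulrC u) -mulrA powRM//; first exact: ltW.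
    exact: ltW.
  have := amplitude_ge s_gt0 L_gt0 sigma_gt0 eps01 recovery_max_ge0 psi0.
  rewrite -/delta -/kappa -/c => hc.
  have := ler_wpM2r (powR_ge0 (ln n%:R / (n%:R * m0)) (s / (2 * s + 1))) hc.
  by move: (_ `^ _) (_ `^ _) (_ `^ _) => A1 A2 A3; lra.
have hen : n%:R * ((1 + delta) * m0 * ((L * h `^ s) ^+ 2 * h) / sigma ^+ 2) <= t.
  by rewrite (bump_energy s_gt0 L_gt0 sigma_gt0 ep1 d01 N1 m00 (erefl h)).
have := @minimax_risk_ge_cube R PX sigma sigma_gt0 mu nu rho q PX_mu nu_gt0 density_hoelder
  q_gt0 mu_ge rho_gt0 s L Q psi psik B S K s_gt0 L_gt0 B0 S0 SK psiD psikh psiB psikB psiS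
  gap cpsi psi2 w w_ge0 w_nondecreasing (I n) n M a b (eta0 * l n) h delta
  ((L * h `^ s * B) ^+ 2 / sigma ^+ 2) t delta c (@I_sub n) abI len1 d0 d1 len2 h0 len3 n1 c0 camp.
rewrite LBh => /(_ hQ (lexx _) hd hdt t0 hen d0 (ltW d1)).
apply: le_trans; rewrite lee_fin; apply: ler_wpM2l => //.
rewrite lerD2l lerN2; apply: le_trans hM.
have -> : (1 + delta) / 2 * t = (1 - eps) * (1 - delta) * u * ln n%:R; last by [].
have i4 : (1 + delta) * (1 + delta)^-1 = 1 by rewrite mulfV// gt_eqF// addr_gt0.
rewrite /t /T; move: i4; move: (1 + delta)^-1 (ln _) => d' y i4.
transitivity ((1 + delta) * d' * ((1 - eps) * (1 - delta) * u * y)); first by lra.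
by rewrite i4 mul1r.
Unshelve. all: by end_near. Qed.

Lemma minimax_liminf_ge eps : 0 < eps < 1 -> long_intervals s I eps ->
  ((w ((1 - eps) * sharp_constant phi s L sigma))%:E <=
    limn_einf (fun n => minimax_risk w s L Q sigma mu PX (I n) n))%E.
Proof.
move=> eps01 Ilong; set v := w _.
have v0 : 0 <= v by exact: w_ge0.
apply/lee_addgt0Pr => e e0.
have ve0 : 0 < e / (v + 1) by rewrite divr_gt0// ltr_wpDl.
have := limn_einf_ge_near (near_minimax_risk_ge eps01 ve0 Ilong).
rewrite -/v => h; apply: (@le_trans _ _ ((v * (1 - e / (v + 1)))%:E + e%:E)%E).
  rewrite -EFinD lee_fin.
  have : v * (e / (v + 1)) <= e.
    rewrite mulrA ler_pdivrMr ?ltr_wpDl//.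
    by have := ltW e0; lra.
  lra.
by rewrite leeD2r.
Qed.

End lower_bound.

Unset Implicit Arguments.
Set Strict Implicit.

Theorem theorem2 (R : realType) (s L Q sigma : R)
  (s_gt0 : 0 < s) (L_gt0 : 0 < L) (Q_gt0 : 0 < Q) (sigma_gt0 : 0 < sigma)
  (phi : R -> R) (phi_argmax : recovery_argmax s phi)
  (mu : R -> R) (PX : probability (measurableTypeR R) R)
  (PX_mu : has_density_on01 PX mu)
  (nu rho q : R) (nu_gt0 : 0 < nu) (nu_le1 : nu <= 1)
  (rho_gt0 : 0 < rho) (q_gt0 : 0 < q)
  (mu_hoelder : hoelder_class `[0, 1] nu rho mu)
  (mu_ge : forall x, x \in `[0, 1] -> q <= mu x)
  (w : R -> R) (w_ge0 : forall x, 0 <= w x)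
  (w_nondecreasing : {homo w : x y / x <= y})
  (A b : R) (A_gt0 : 0 < A) (b_gt0 : 0 < b)
  (w_growth : forall x, w x <= A * (1 + `|x| `^ b))
  (I : nat -> interval R) (I_sub : forall n, [set` I n] `<=` `[0, 1]) :
  let P := sharp_constant phi s L sigma in
  (forall eps : R, 0 < eps < 1 -> long_intervals s I eps ->
     ((w ((1 - eps) * P))%:E
       <= limn_einf (fun n => minimax_risk w s L Q sigma mu PX (I n) n))%E)
  /\
  ((forall eps : R, 0 < eps < 1 -> long_intervals s I eps) ->
     w y @[y --> P^'-] --> w P ->
     ((w P)%:E
       <= limn_einf (fun n => minimax_risk w s L Q sigma mu PX (I n) n))%E).
Proof.
move=> P.
have part1 eps : 0 < eps < 1 -> long_intervals s I eps ->
     ((w ((1 - eps) * P))%:E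
       <= limn_einf (fun n => minimax_risk w s L Q sigma mu PX (I n) n))%E.
  move=> eps01 Ilong.
  exact: (minimax_liminf_ge s_gt0 L_gt0 Q_gt0 sigma_gt0 phi_argmax PX_mu nu_gt0 nu_le1
    rho_gt0 q_gt0 mu_hoelder mu_ge w_ge0 w_nondecreasing I_sub eps01 Ilong).
split => // Ilong wP.
set F := limn_einf _ in part1 *.
have [P0|P0] := leP P 0.
  have PE : P = 0 by apply/eqP; rewrite eq_le P0 (sharp_constant_ge0 L sigma phi_argmax).
  have half : 0 < (2^-1 : R) < 1 by apply/andP; split; lra.
  by have := @part1 _ half (Ilong _ half); rewrite PE mulr0.
apply/lee_addgt0Pr => e e0.
have : \forall y \near P^'-, [/\ 0 < y, y < P & w P - e <= w y].
  near=> y; split.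
  - by near: y; exact: nbhs_left_gt.
  - by near: y; exact: nbhs_left_lt.
  - near: y; move/cvgrPdist_le : wP => /(_ _ e0); apply: filterS => y.
    by rewrite ler_norml => /andP[]; lra.
move=> /filter_ex[y [y0 yP wy]].
pose eps := 1 - y / P.
have yP1 : y / P < 1 by rewrite ltr_pdivrMr// mul1r.
have yP0 : 0 < y / P by rewrite divr_gt0.
have eps01 : 0 < eps < 1 by rewrite /eps; apply/andP; split; lra.
have := @part1 _ eps01 (Ilong _ eps01).
have -> : (1 - eps) * P = y by rewrite /eps opprB addrCA subrr addr0 divfK// gt_eqF.
move=> h; apply: (@le_trans _ _ ((w y)%:E + e%:E)%E); last by rewrite leeD2r.
by rewrite -EFinD lee_fin; lra.
Unshelve. all: by end_near. Qed.
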